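(* Let $r_0\ge3$, $P\in\mathcal P_{r_0}$ and $\alpha_h(x)=\sqrt h\arctan(x/\sqrt h)$. Assume that there exists a constant $b\ge1$ such that $$\forall\,a\in\mathcal N,\qquad\frac1b|a|^m\le\omega_a\le b|a|^m.$$ Let $z^n$ be the sequence defined by $z^{n+1}=\Phi_P^h\circ\Phi_{A_0}^1(z^n)$, $n\ge0$. Assume that $z^0=(\xi^0,\bar\xi^0)\in H^{m/2}$ and that the sequence $z^n$ remains bounded in $\ell^1$. Then there exist constants $C$, $\alpha$ and $\beta$ (and constants $c,h_0>0$) such that, for $h\le h_0$, $$\sum_{|j|<\alpha h^{-1/(2m)}}|j|^m|z_j^n|^2+\frac1{\sqrt h}\sum_{|j|\ge\alpha h^{-1/(2m)}}|z_j^n|^2\le C$$ over exponentially long time $nh\le\exp(ch^{-\beta})$.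
   Context: Phase space. Let $d\ge1$ and $\mathcal N=\mathbb Z^d$ or $\mathbb N^d$; for $a\in\mathcal N$ put $|a|^2=\max(1,a_1^2+\cdots+a_d^2)$. Let $\mathcal Z=\mathcal N\times\{\pm1\}$; for $j=(a,\delta)\in\mathcal Z$ put $|j|=|a|$ and $\overline j=(a,-\delta)$. A pair $(\xi,\eta)\in\mathbb C^{\mathcal N}\times\mathbb C^{\mathcal N}$ is identified with $z=(z_j)_{j\in\mathcal Z}$ by $z_{(a,1)}=\xi_a$, $z_{(a,-1)}=\eta_a$. $\ell^1$ is the space of $z\in\mathbb C^{\mathcal Z}$ with $\|z\|_{\ell^1}=\sum_{j}|z_j|<\infty$, and $H^s$ is the space of $z$ with $\|z\|_{H^s}=(\sum_{j}|j|^{2s}|z_j|^2)^{1/2}<\infty$. $z$ is real if $z_{\overline j}=\overline{z_j}$ for all $j$; a function $H(z)$ is real if $H(z)\in\mathbb R$ for all real $z$. The Hamiltonian vector field is $(X_H)_{(a,1)}=-i\,\partial H/\partial\eta_a$, $(X_H)_{(a,-1)}=i\,\partial H/\partial\xi_a$, and $\Phi_H^t$ is the flow at time $t$ of $\dot z=X_H(z)$. Polynomials. For $\boldsymbol j=(j_1,\dots,j_\ell)\in\mathcal Z^\ell$, $j_i=(a_i,\delta_i)$, put $z_{\boldsymbol j}=z_{j_1}\cdots z_{j_\ell}$, $\overline{\boldsymbol j}=(\overline{j_1},\dots,\overline{j_\ell})$, $\mathcal M(\boldsymbol j)=\sum_i\delta_ia_i$, and $\mathcal I_\ell=\{\boldsymbol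 j\in\mathcal Z^\ell:\mathcal M(\boldsymbol j)=0\}$. $\mathcal P_k$ is the set of real polynomial Hamiltonians of degree $k$, with a zero of order at least $2$ at $z=0$, of the form $P(z)=\sum_{\ell=2}^k\sum_{\boldsymbol j\in\mathcal I_\ell}a_{\boldsymbol j}z_{\boldsymbol j}$, with $a_{\overline{\boldsymbol j}}=\overline{a_{\boldsymbol j}}$ and bounded coefficients. Linear part. $\omega_a\in\mathbb R$ ($a\in\mathcal N$) are the frequencies, $m>0$ is a fixed constant, $h>0$ is the stepsize, $\lambda_a=\alpha_h(h\omega_a)$, $A_0(z)=\sum_{a}\lambda_a\xi_a\eta_a$, and $\Phi_{A_0}^1$ is its time-one flow: $(\Phi_{A_0}^1(z))_j=\exp(-i\delta\lambda_a)z_j$ for $j=(a,\delta)$. The constants do not depend on $n$ and $h$. *)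

(* Defs.v *)
From HB Require Import structures.
From mathcomp Require Import all_boot all_order all_algebra.
From mathcomp Require Import finmap.
From mathcomp Require Import all_classical all_reals all_analysis.
From mathcomp.analysis.showcase Require summability.
From mathcomp Require Export complex.

Set Implicit Arguments.
Unset Strict Implicit.
Unset Printing Implicit Defensive.

Import Order.TTheory GRing.Theory Num.Theory.
Import numFieldNormedType.Exports.

Local Open Scope classical_set_scope.
Local Open Scope ring_scope.

(* The two admissible index sets: [Zd] is the lattice of all integer vectors,
   [Nd] the vectors with nonnegative integer entries (0 included). *)
Variant lattice := Zd | Nd.

Definition in_lattice (L : lattice) (d : nat) (a : 'rV[int]_d) : bool :=
  if L is Nd then [forall i, 0 <= a ord0 i] else true.

Definition site (L : lattice) (d : nat) := {a : 'rV[int]_d | in_lattice L a}.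

(* The sign delta = +1 is encoded by [true] and delta = -1 by [false]. *)
Definition mode (L : lattice) (d : nat) := (site L d * bool)%type.

Definition bar {L d} (j : mode L d) : mode L d := (j.1, ~~ j.2).

Definition momentum {L d} (js : seq (mode L d)) : 'rV[int]_d :=
  \sum_(j <- js) (if j.2 then val j.1 else - val j.1).

(* The zero-momentum multi-indices of length l. *)
Definition zero_momentum (L : lattice) (d l : nat) :=
  {js : l.-tuple (mode L d) | momentum js == 0}.

Section PhaseSpace.
Variables (R : realType) (L : lattice) (d : nat).
Local Notation C := R[i].

(* Complex sequences indexed by modes: z (a, true) = xi_a and
   z (a, false) = eta_a. *)
Definition phase := mode L d -> C.

Definition site_norm (a : site L d) : R :=
  Num.sqrt (Num.max 1 (\sum_(i < d) (val a ord0 i)%:~R ^+ 2)).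

Definition mode_norm (j : mode L d) : R := site_norm j.1.

Definition modulus (w : C) : R := Normc.normc w.

Definition l1norm (z : phase) : \bar R :=
  \esum_(j in [set: mode L d]) (modulus (z j))%:E.

Definition in_l1 (z : phase) : Prop := (l1norm z < +oo)%E.

Definition Hsnorm2 (s : R) (z : phase) : \bar R :=
  \esum_(j in [set: mode L d])
    (mode_norm j `^ (2 * s) * modulus (z j) ^+ 2)%:E.

(* Finiteness of the squared norm, i.e. of the norm itself. *)
Definition in_Hs (s : R) (z : phase) : Prop := (Hsnorm2 s z < +oo)%E.

Definition real_phase (z : phase) : Prop :=
  forall j, z (bar j) = (z j)^*%C.

Definition real_hamiltonian (H : phase -> C) : Prop :=
  forall z, in_l1 z -> real_phase z -> complex.Im (H z) = 0.

(* Sum of a (possibly infinite) family of complex numbers: the limit of the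
   finite partial sums along the directed set of finite subsets.  It is only
   used below for absolutely summable families. *)
Definition csum {I : choiceType} (f : I -> C) : C :=
  @summability.sum I C C^o f.

Definition monomial (z : phase) (js : seq (mode L d)) : C :=
  \prod_(j <- js) z j.

Definition poly_eval (k : nat) (a : seq (mode L d) -> C) (z : phase) : C :=
  \sum_(2 <= l < k.+1)
    csum (fun js : zero_momentum L d l =>
            a (tval (val js)) * monomial z (tval (val js))).

(* The class P_k.  Only the values of the coefficient family [a] at
   zero-momentum multi-indices of length 2, ..., k matter.  Boundedness of the
   coefficients makes the series converge absolutely on l^1, which is the
   space on which the Hamiltonian is considered. *)
Definition poly_hamiltonian (k : nat) (P : phase -> C) : Prop :=
  real_hamiltonian P /\
  exists a : seq (mode L d) -> C,
    [/\ exists B : R, forall js, (2 <= size js <= k)%N -> momentum js = 0 ->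
          modulus (a js) <= B,
        forall js, (2 <= size js <= k)%N -> momentum js = 0 ->
          a (map bar js) = (a js)^*%C
      & forall z, in_l1 z -> P z = poly_eval k a z].

(* The complex partial derivative of H with respect to z_j. *)
Definition partial (H : phase -> C) (j : mode L d) (z : phase) : C :=
  derive1 (fun w : C =>
    (H (fun k => if k == j then z k + w else z k) : C^o)) 0.

(* - i dH/d(eta_a) at (a, +1) and i dH/d(xi_a) at (a, -1). *)
Definition vector_field (H : phase -> C) (z : phase) : phase :=
  fun j => if j.2 then - 'i%C * partial H (bar j) z
           else 'i%C * partial H (bar j) z.

(* [ham_flow H T x y]: y is the image of x under the time-T flow of H, i.e.
   there is a trajectory in l^1 from x to y on [0, T] which solves
   u' = X_H(u), the derivative being taken in the norm of l^1
   (one-sided at the two ends of the interval). *)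
Definition ham_flow (H : phase -> C) (T : R) (x y : phase) : Prop :=
  exists u : R -> phase,
    [/\ u 0 = x, u T = y,
        forall t, 0 <= t <= T -> in_l1 (u t)
      & forall t, 0 <= t <= T -> forall eps : R, 0 < eps ->
          \forall s \near (0 : R)^', 0 <= t + s <= T ->
            (l1norm (fun j => ((s^-1)%:C%C * (u (t + s) j - u t j)
                               - vector_field H (u t) j)%R) <= eps%:E)%E].

Definition cis (x : R) : C := (cos x +i* sin x)%C.

(* The time-one flow of the quadratic Hamiltonian
   sum_a lambda_a xi_a eta_a: z_j is multiplied by exp(- i delta lambda_a). *)
Definition linear_flow (lambda : site L d -> R) (z : phase) : phase :=
  fun j => cis (- (if j.2 then lambda j.1 else - lambda j.1)) * z j.

Definition alpha_step (h x : R) : R := Num.sqrt h * atan (x / Num.sqrt h).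

End PhaseSpace.

(* Main.v *)
Require Import Defs.
From mathcomp Require Import all_boot all_order all_algebra.
From mathcomp Require Import finmap.
From mathcomp Require Import all_classical all_reals all_analysis.
From mathcomp.analysis.showcase Require summability.
From mathcomp Require Import zify ring lra.

(** Why the theorem holds.  Write [v n t] for the trajectories of the flow of [P]
    on [0, h] that join [Phi_A0 (z n)] to [z (n + 1)].  Since the arctangent is
    bounded, the frequencies [lambda_a] are at most [2 * sqrt h], so one step
    moves the orbit by [O (sqrt h)] only, and its dependence on the index [n] can
    be treated as an analytic dependence on a slow time.

    The finite differences in [n] make this precise.  The difference of [v] in
    [n] is [Phi_A0 - 1] applied to [v] plus the integral of the vector field over
    one step; applying further differences to this equation, with the discrete
    Leibniz rule, gives differences of order [k] bounded in l^1 by [A * k! * sg^k]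
    with [sg = O (sqrt h)], as long as [k] is at most a small negative power of
    [h] (lemma [tame_orbit]).  Here the zero momentum of the Hamiltonian is what
    makes its vector field bounded on l^1 (lemma [ins1_sumle]).

    The operator [dlog], the logarithm of the shift in [n] truncated at order
    [N], is then a derivation up to an error [(N + 1)! * sg^(N + 1)] (lemma
    [dlog_defect]).  The shift in [n] is a symmetry of the family of
    trajectories, and Noether's argument applies to its generator [dlog]: with
    [bform] the one-form [p dq] and [g = p dq (X) - P] the Lagrangian, the
    derivative in [t] of [bform (v, dlog v)] is [dlog g] up to that error (lemma
    [noether]), while the linear flow preserves [bform (v, dlog v)].  Summed over
    one step, the increment of [bform (v, dlog v)] is [dlog F], with [F] the
    action of the step.  As [dlog] is a multiple of the difference operator, this
    is a conservation law: the energy [bform (v, dlog v) - (dlog / difference) F]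
    drifts by the error only.  With [N] a small negative power of [h], the error
    is exponentially small.

    This energy is [O (h)]-close to the sum of [sin lambda_a * |xi_a|^2] (lemma
    [noether_charge_approx]), which on a real phase is comparable with [h] times the
    left-hand side of the theorem: [lambda_a / h] is of the order of [|a|^m] below
    the threshold and of [1 / sqrt h] above it (lemma [step_freq_ge]).  Phases
    remain real because the flow of a real Hamiltonian is unique (lemma
    [flow_real]).

    All estimates in l^1 are stated through the finite sums of a family
    (predicate [sumle]).  Polynomials are linear functionals of tensor powers, so
    that one bilinear Leibniz rule handles all degrees. *)

Set Implicit Arguments.
Unset Strict Implicit.
Unset Printing Implicit Defensive.

Import Order.TTheory GRing.Theory Num.Theory.
Import numFieldNormedType.Exports.

Local Open Scope classical_set_scope.
Local Open Scope ring_scope.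

(** * Moduli of complex numbers *)

Arguments modulus : simpl never.

Section Modulus.
Variable R : realType.
Implicit Types (x y w : R[i]).

Lemma modulusE w : (modulus w)%:C%C = `|w|.
Proof. by []. Qed.

Lemma modulus_ge0 w : 0 <= modulus w.
Proof. by rewrite -ler0c modulusE. Qed.

Lemma modulus0 : modulus (0 : R[i]) = 0.
Proof. exact: Normc.normc0. Qed.

Lemma modulus1 : modulus (1 : R[i]) = 1.
Proof. exact: Normc.normc1. Qed.

Lemma modulusM x y : modulus (x * y) = modulus x * modulus y.
Proof. exact: Normc.normcM. Qed.

Lemma modulusD x y : modulus (x + y) <= modulus x + modulus y.
Proof. by rewrite -lecR rmorphD /= !modulusE ler_normD. Qed.

Lemma modulusN x : modulus (- x) = modulus x.
Proof. by apply: complexI; rewrite /= !modulusE normrN. Qed.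

Lemma modulusB x y : modulus (x - y) <= modulus x + modulus y.
Proof. by rewrite -(modulusN y) modulusD. Qed.

Lemma modulusBC x y : modulus (x - y) = modulus (y - x).
Proof. by rewrite -modulusN opprB. Qed.

Lemma modulusR (a : R) : modulus (a%:C)%C = `|a|.
Proof. by rewrite /modulus /= expr0n addr0 sqrtr_sqr. Qed.

Lemma modulusi : modulus ('i%C : R[i]) = 1.
Proof. by rewrite /modulus /= expr0n add0r expr1n sqrtr1. Qed.

Lemma modulusV w : modulus w^-1 = (modulus w)^-1.
Proof. exact: Normc.normcV. Qed.

Lemma modulusn n : modulus (n%:R : R[i]) = n%:R.
Proof.
by rewrite -(rmorph_nat (real_complex R)) modulusR ger0_norm ?ler0n.
Qed.

Lemma modulusX w n : modulus (w ^+ n) = modulus w ^+ n.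
Proof. by elim: n => [|n IH]; rewrite ?modulus1 // !exprS modulusM IH. Qed.

Lemma modulus_eq0 w : modulus w = 0 -> w = 0.
Proof. exact: Normc.eq0_normc. Qed.

Lemma modulus_conj w : modulus (w^*)%C = modulus w.
Proof. by case: w => a b; rewrite /modulus /= sqrrN. Qed.

Lemma ler_Re_modulus w : `|complex.Re w| <= modulus w.
Proof.
case: w => a b; rewrite /modulus /= -sqrtr_sqr ler_wsqrtr // lerDl sqr_ge0 //.
Qed.

Lemma ler_Im_modulus w : `|complex.Im w| <= modulus w.
Proof.
case: w => a b; rewrite /modulus /= -sqrtr_sqr ler_wsqrtr // lerDr sqr_ge0 //.
Qed.

Lemma modulus_ReIm w : modulus w <= `|complex.Re w| + `|complex.Im w|.
Proof.
rewrite {1}[w]complexE (le_trans (modulusD _ _)) // modulusM modulusi mul1r.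
by rewrite !modulusR.
Qed.

Lemma modulus_sum (I : Type) (s : seq I) (p : pred I) (F : I -> R[i]) :
  modulus (\sum_(i <- s | p i) F i) <= \sum_(i <- s | p i) modulus (F i).
Proof.
elim/big_rec2: _ => [|i a w _ IH]; first by rewrite modulus0.
by rewrite (le_trans (modulusD _ _)) // lerD2l.
Qed.

Lemma ReD x y : complex.Re (x + y) = complex.Re x + complex.Re y.
Proof. by case: x y => [a b] [c d]. Qed.
Lemma ImD x y : complex.Im (x + y) = complex.Im x + complex.Im y.
Proof. by case: x y => [a b] [c d]. Qed.
Lemma ReN x : complex.Re (- x) = - complex.Re x.
Proof. by case: x. Qed.
Lemma ImN x : complex.Im (- x) = - complex.Im x.
Proof. by case: x. Qed.
Lemma Re_sum (I : Type) (s : seq I) (p : pred I) (F : I -> R[i]) :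
  complex.Re (\sum_(i <- s | p i) F i) = \sum_(i <- s | p i) complex.Re (F i).
Proof. by elim/big_rec2: _ => [//|i a w _ IH]; rewrite ReD IH. Qed.
Lemma complex_ReZ (a : R) w : complex.Re (a%:C%C * w) = a * complex.Re w.
Proof. by case: w => b c /=; rewrite mul0r subr0. Qed.

(** Rotating a complex number onto the positive half-line: this is how a sum of
    moduli is read off from the real part of a linear functional. *)
Lemma unimodular w : exists2 u, modulus u = 1 & (modulus w)%:C%C = u * w.
Proof.
have [->|w0] := eqVneq w 0.
  by exists 1; rewrite ?modulus1 // modulus0 mulr0.
have m0 : modulus w != 0 by apply: contraNneq w0 => /modulus_eq0 ->.
exists ((modulus w)%:C%C / w); last by rewrite divfK.
by rewrite modulusM modulusV modulusR ger0_norm ?modulus_ge0 ?divff.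
Qed.

End Modulus.

(** * Families with bounded sums *)

Section BoundedSums.
Variable R : realType.

(** [sumle f c] is the inequality of the l^1 norm of [f] with [c], phrased
    without any infinite sum; it passes at once to sums, products, limits and
    restrictions. *)
Definition sumle (I : eqType) (f : I -> R[i]) (c : R) :=
  forall s : seq I, uniq s -> \sum_(j <- s) modulus (f j) <= c.

Lemma ler_sum_sub (I : eqType) (F : I -> R) (s t : seq I) :
  (forall i, 0 <= F i) -> uniq s -> {subset s <= t} ->
  \sum_(i <- s) F i <= \sum_(i <- t) F i.
Proof.
move=> F0; elim: s t => [|x s IH] t /=.
  by move=> _ _; rewrite big_nil sumr_ge0.
move=> /andP[xs us] st.
have xt : x \in t by apply: st; rewrite inE eqxx.
rewrite (perm_big _ (perm_to_rem xt)) /= !big_cons lerD2l IH // => y ys.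
have := st y; rewrite inE ys orbT => /(_ isT).
rewrite (perm_mem (perm_to_rem xt)) inE => /orP[/eqP yx|//].
by rewrite -yx ys in xs.
Qed.

Section OneIndex.
Variable I : eqType.
Implicit Types (f g : I -> R[i]).

Lemma sumle_ge0 f c : sumle f c -> 0 <= c.
Proof. by move=> /(_ [::] isT); rewrite big_nil. Qed.

Lemma sumle_bnd f c i : sumle f c -> modulus (f i) <= c.
Proof. by move=> /(_ [:: i] isT); rewrite big_seq1. Qed.

Lemma sumle_le f g c d : (forall i, modulus (f i) <= modulus (g i)) ->
  c <= d -> sumle g c -> sumle f d.
Proof.
move=> fg cd gc s us; apply: le_trans cd; apply: le_trans (gc s us).
by apply: ler_sum.
Qed.

Lemma sumle_eq f g c : f =1 g -> sumle g c -> sumle f c.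
Proof. by move=> fg; apply: sumle_le => // i; rewrite fg. Qed.

Lemma sumle_weak f c d : c <= d -> sumle f c -> sumle f d.
Proof. by move=> cd; apply: sumle_le. Qed.

Lemma sumle0 : sumle (fun _ : I => 0) 0.
Proof. by move=> s _; rewrite big1 // => i _; rewrite modulus0. Qed.

Lemma sumleD f g c d : sumle f c -> sumle g d ->
  sumle (fun i => f i + g i) (c + d).
Proof.
move=> fc gd s us; apply: le_trans (lerD (fc s us) (gd s us)).
by rewrite -big_split ler_sum // => i _; apply: modulusD.
Qed.

Lemma sumleN f c : sumle f c -> sumle (fun i => - f i) c.
Proof. by apply: sumle_le => // i; rewrite modulusN. Qed.

Lemma sumleB f g c d : sumle f c -> sumle g d ->
  sumle (fun i => f i - g i) (c + d).
Proof. by move=> fc /sumleN; apply: sumleD. Qed.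

Lemma sumleM u f a c : 0 <= a -> (forall i, modulus (u i) <= a) -> sumle f c ->
  sumle (fun i => u i * f i) (a * c).
Proof.
move=> a0 ua fc s us; apply: le_trans (ler_wpM2l a0 (fc s us)).
by rewrite mulr_sumr ler_sum // => i _; rewrite modulusM ler_wpM2r ?modulus_ge0.
Qed.

Lemma sumleZ u f c : sumle f c -> sumle (fun i => u * f i) (modulus u * c).
Proof. by apply: sumleM => //; apply: modulus_ge0. Qed.

Lemma sumle_sum (K : Type) (s : seq K) (p : pred K) (F : K -> I -> R[i])
    (c : K -> R) : (forall k, p k -> sumle (F k) (c k)) ->
  sumle (fun i => \sum_(k <- s | p k) F k i) (\sum_(k <- s | p k) c k).
Proof.
move=> H; elim: s => [|k s IH].
  by rewrite big_nil; apply: sumle_eq sumle0 => i; rewrite big_nil.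
rewrite big_cons; case: ifP => pk; last first.
  by apply: sumle_eq IH => i; rewrite big_cons pk.
by apply: sumle_eq (sumleD (H k pk) IH) => i; rewrite big_cons pk.
Qed.

Lemma sumle_closed f c : (forall e, 0 < e -> sumle f (c + e)) -> sumle f c.
Proof. by move=> H s us; apply/ler_addgt0Pr => e e0; apply: H. Qed.

Lemma sumle_image (J : eqType) (p : J -> I) f c : injective p -> sumle f c ->
  sumle (f \o p) c.
Proof.
move=> ip fc s us; have := fc (map p s); rewrite map_inj_uniq // big_map.
exact.
Qed.

(** Some finite sum comes within [e] of the supremum of all of them, which leaves
    at most [e] for the rest. *)
Lemma sumle_tail f c e : 0 < e -> sumle f c ->
  exists2 s, uniq s & sumle (fun i => if i \in s then 0 else f i) e.
Proof.
move=> e0 fc.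
pose E := [set x | exists2 s, uniq s & x = \sum_(j <- s) modulus (f j)].
have supE : has_sup E.
  split; first by exists 0; exists [::] => //; rewrite big_nil.
  by exists c => _ [s us ->]; apply: fc.
have [_ [s us ->] hs] := sup_adherent e0 supE.
exists s => // t ut.
have -> : \sum_(j <- t) modulus (if j \in s then 0 else f j) =
   \sum_(j <- [seq j <- t | j \notin s]) modulus (f j).
  rewrite big_filter [RHS]big_mkcond /=; apply: eq_bigr => j _.
  by case: (j \in s); rewrite ?modulus0.
set t' := [seq _ <- _ | _].
have ut' : uniq (s ++ t').
  rewrite cat_uniq us filter_uniq // andbT /= -all_predC.
  by apply/allP => j; rewrite mem_filter => /andP[].
have : \sum_(j <- s ++ t') modulus (f j) <= sup E.
  by apply: ub_le_sup; [case: supE|exists (s ++ t')].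
rewrite big_cat /=; lra.
Qed.

End OneIndex.

(** The injectivity hypothesis covers tensor products, where [K] is [I * J], as
    well as their restrictions to a graph, such as the symplectic pairing. *)
Lemma sumle_prod (I J K : eqType) (p : K -> I) (q : K -> J) (f : I -> R[i])
    (g : J -> R[i]) a b : injective (fun k => (p k, q k)) ->
  sumle f a -> sumle g b -> sumle (fun k => f (p k) * g (q k)) (a * b).
Proof.
move=> ipq fa gb s us.
pose S := undup (map p s); pose T := undup (map q s).
apply: (@le_trans _ _ (\sum_(x <- [seq (i, j) | i <- S, j <- T])
   modulus (f x.1) * modulus (g x.2))).
  rewrite (_ : \sum_(j <- s) _ = \sum_(x <- map (fun k => (p k, q k)) s)
     modulus (f x.1) * modulus (g x.2)); last first.
    by rewrite big_map; apply: eq_bigr => k _; rewrite modulusM.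
  apply: ler_sum_sub.
  - by move=> x; rewrite mulr_ge0 ?modulus_ge0.
  - by rewrite map_inj_uniq.
  - move=> _ /mapP[k ks ->]; apply/allpairsP; exists (p k, q k) => /=.
    by split => //; rewrite mem_undup map_f.
rewrite big_allpairs_dep /=.
rewrite (_ : \sum_(i <- S) _ =
  (\sum_(i <- S) modulus (f i)) * \sum_(j <- T) modulus (g j)); last first.
  by rewrite mulr_suml; apply: eq_bigr => i _; rewrite mulr_sumr.
apply: ler_pM.
- by apply: sumr_ge0 => i _; apply: modulus_ge0.
- by apply: sumr_ge0 => i _; apply: modulus_ge0.
- by apply: fa; apply: undup_uniq.
- by apply: gb; apply: undup_uniq.
Qed.

End BoundedSums.

(** * Infinite sums *)

Section CSum.
Variable R : realType.

(** Convergence of the finite partial sums, in terms of which [csum] is computed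
    below. *)
Definition has_sum (I : eqType) (f : I -> R[i]) (l : R[i]) :=
  forall e : R, 0 < e -> exists2 s : seq I, uniq s &
    forall t, uniq t -> {subset s <= t} ->
      modulus (\sum_(j <- t) f j - l) <= e.

Lemma has_sum_csum (I : choiceType) (f : I -> R[i]) l :
  has_sum f l -> csum f = l.
Proof.
move=> H; rewrite /csum /summability.sum.
have FF := @summability.totally_filter I.
apply: (@norm_cvg_lim _ R[i]^o).
apply/(@cvgrPdist_le _ R[i]^o) => /= e; rewrite ltcE /= => /andP[/eqP e1 e2].
have [s us hs] := H _ e2.
exists [fset x in s]%fset => // B /= sB.
rewrite distrC -modulusE lecE /= e1 eqxx /=.
rewrite /summability.partial_sum -(big_seq_fsetE _ _ predT f) /=; apply: hs.
  exact: fset_uniq.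
by move=> x xs; move/fsubsetP: sB; apply; rewrite inE.
Qed.

Section Index.
Variable I : choiceType.
Implicit Types (f g : I -> R[i]) (l : R[i]).

Lemma has_sumD f g l k : has_sum f l -> has_sum g k ->
  has_sum (fun i => f i + g i) (l + k).
Proof.
move=> fl gk e e0; have e20 : 0 < e / 2 by rewrite divr_gt0.
have [s us hs] := fl _ e20; have [t ut ht] := gk _ e20.
exists (undup (s ++ t)); first exact: undup_uniq.
move=> u uu su.
have -> : \sum_(j <- u) (f j + g j) - (l + k) =
   (\sum_(j <- u) f j - l) + (\sum_(j <- u) g j - k).
  by rewrite big_split /=; ring.
rewrite (le_trans (modulusD _ _)) // (splitr e) lerD // ?hs ?ht // => x xs;
  by apply: su; rewrite mem_undup mem_cat xs ?orbT.
Qed.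

Lemma has_sumZ c f l : has_sum f l -> has_sum (fun i => c * f i) (c * l).
Proof.
move=> fl e e0; have c0 : 0 < modulus c + 1 by have := modulus_ge0 c; lra.
have [s us hs] := fl _ (divr_gt0 e0 c0); exists s => // t ut st.
rewrite -mulr_sumr -mulrBr modulusM.
apply: le_trans (_ : (modulus c + 1) * (e / (modulus c + 1)) <= _).
  by rewrite ler_pM ?modulus_ge0 ?hs //; lra.
by rewrite mulrC divfK // gt_eqF.
Qed.

Lemma has_sum_conj f l : has_sum f l -> has_sum (fun i => (f i)^*%C) (l^*%C).
Proof.
move=> fl e /fl[s us hs]; exists s => // t ut st.
rewrite -(modulus_conj) -[X in X <= _]modulus_conj.
rewrite -(rmorph_sum (@conjc _)) -rmorphB /= !modulus_conj; exact: hs.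
Qed.

Lemma has_sum_reindex (J : choiceType) (p : J -> I) (q : I -> J) f l :
  cancel p q -> cancel q p -> has_sum f l -> has_sum (f \o p) l.
Proof.
move=> pq qp fl e /fl[s us hs]; exists (map q s).
  by rewrite map_inj_uniq //; apply: can_inj qp.
move=> t ut st; have := hs (map p t); rewrite big_map; apply.
  by rewrite map_inj_uniq //; apply: can_inj pq.
by move=> x xs; apply/mapP; exists (q x); rewrite ?qp // st // map_f.
Qed.

Lemma has_sum_le f l c : has_sum f l ->
  (forall s, uniq s -> modulus (\sum_(j <- s) f j) <= c) -> modulus l <= c.
Proof.
move=> fl H; apply/ler_addgt0Pr => e /fl[s us hs].
have -> : l = (\sum_(j <- s) f j) - (\sum_(j <- s) f j - l) by ring.
by rewrite (le_trans (modulusB _ _)) // lerD ?H // hs.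
Qed.

(** A family of nonnegative reals with bounded finite sums is summed by the
    least upper bound of these; the other families follow by taking real and
    imaginary, positive and negative parts. *)
Lemma has_sum_nonneg (g : I -> R) c : (forall i, 0 <= g i) ->
  (forall s, uniq s -> \sum_(j <- s) g j <= c) ->
  exists S : R, has_sum (fun i => (g i)%:C%C) (S%:C%C).
Proof.
move=> g0 gc; pose E := [set x | exists2 s, uniq s & x = \sum_(j <- s) g j].
have supE : has_sup E.
  split; first by exists 0; exists [::] => //; rewrite big_nil.
  by exists c => _ [s us ->]; apply: gc.
exists (sup E) => e e0.
have [_ [s us ->] hs] := sup_adherent e0 supE.
exists s => // t ut st; have -> : \sum_(j <- t) (g j)%:C%C - (sup E)%:C%C =
    (\sum_(j <- t) g j - sup E)%:C%C.
  by rewrite rmorphB rmorph_sum.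
rewrite modulusR.
have h1 : \sum_(j <- s) g j <= \sum_(j <- t) g j by apply: ler_sum_sub.
have h2 : \sum_(j <- t) g j <= sup E.
  by apply: ub_le_sup; [case: supE|exists t].
by rewrite ler_norml; apply/andP; split; lra.
Qed.

Lemma has_sum_eq f g l : f =1 g -> has_sum g l -> has_sum f l.
Proof. by move=> /funext ->. Qed.

Lemma has_sum_real (g : I -> R) c :
  (forall s, uniq s -> \sum_(j <- s) `|g j| <= c) ->
  exists S : R, has_sum (fun i => (g i)%:C%C) (S%:C%C).
Proof.
move=> gc.
have [||S1 h1] := @has_sum_nonneg (fun i => Num.max (g i) 0) c.
- by move=> i; rewrite le_max lexx orbT.
- move=> s us; apply: le_trans (gc s us); apply: ler_sum => i _.
  by rewrite ge_max ler_norm normr_ge0.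
have [||S2 h2] := @has_sum_nonneg (fun i => Num.max (- g i) 0) c.
- by move=> i; rewrite le_max lexx orbT.
- move=> s us; apply: le_trans (gc s us); apply: ler_sum => i _.
  by rewrite ge_max -normrN ler_norm normr_ge0.
exists (S1 - S2); have := has_sumD h1 (has_sumZ (-1) h2).
rewrite mulN1r rmorphB; apply: has_sum_eq => i.
rewrite mulN1r -rmorphB /=; congr (_%:C%C).
by case: (ltrP (g i) 0) => gi; case: (ltrP (- g i) 0) => gi'; lra.
Qed.

Lemma csumP f c : sumle f c -> has_sum f (csum f).
Proof.
move=> fc.
have [|S1 h1] := @has_sum_real (fun i => complex.Re (f i)) c.
  move=> s us; apply: le_trans (fc s us); apply: ler_sum => i _.
  exact: ler_Re_modulus.
have [|S2 h2] := @has_sum_real (fun i => complex.Im (f i)) c.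
  move=> s us; apply: le_trans (fc s us); apply: ler_sum => i _.
  exact: ler_Im_modulus.
have h := has_sumD h1 (has_sumZ 'i%C h2).
have {h} : has_sum f (S1%:C%C + 'i%C * S2%:C%C).
  by apply: has_sum_eq h => i; rewrite -complexE.
by move=> h; rewrite (has_sum_csum h).
Qed.

Lemma csumD f g c d : sumle f c -> sumle g d ->
  csum (fun i => f i + g i) = csum f + csum g.
Proof.
by move=> fc gd; apply/has_sum_csum/has_sumD; apply: csumP; eassumption.
Qed.

Lemma csumZ u f c : sumle f c -> csum (fun i => u * f i) = u * csum f.
Proof. by move=> fc; apply/has_sum_csum/has_sumZ; apply: csumP fc. Qed.

Lemma csumB f g c d : sumle f c -> sumle g d ->
  csum (fun i => f i - g i) = csum f - csum g.
Proof.
move=> fc gd; rewrite -mulN1r -(csumZ _ gd).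
rewrite -(csumD fc (sumleZ (-1) gd)); congr csum; apply/funext => i.
by rewrite mulN1r.
Qed.

Lemma csum_le f c : sumle f c -> modulus (csum f) <= c.
Proof.
move=> fc; apply: (has_sum_le (csumP fc)) => s us.
by apply: le_trans (modulus_sum _ _ _) (fc s us).
Qed.

Lemma csum0 : csum (fun _ : I => 0 : R[i]) = 0.
Proof.
apply: has_sum_csum => e e0; exists [::] => // t _ _.
by rewrite big1 // subr0 modulus0 ltW.
Qed.

Lemma csum_sum (K : Type) (s : seq K) (p : pred K) (F : K -> I -> R[i])
    (c : K -> R) : (forall k, p k -> sumle (F k) (c k)) ->
  csum (fun i => \sum_(k <- s | p k) F k i) = \sum_(k <- s | p k) csum (F k).
Proof.
move=> H; elim: s => [|k s IH].
  rewrite big_nil -[RHS]csum0; congr csum; apply/funext => i.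
  by rewrite big_nil.
rewrite big_cons; case: ifP => pk; last first.
  by rewrite -IH; congr csum; apply/funext => i; rewrite big_cons pk.
rewrite -IH -(csumD (H k pk) (sumle_sum s H)); congr csum; apply/funext => i.
by rewrite big_cons pk.
Qed.

Lemma csum_conj f c : sumle f c -> csum (fun i => (f i)^*%C) = (csum f)^*%C.
Proof. by move=> fc; apply/has_sum_csum/has_sum_conj; apply: csumP fc. Qed.

Lemma csum_reindex (J : choiceType) (p : J -> I) (q : I -> J) f c :
  cancel p q -> cancel q p -> sumle f c -> csum (f \o p) = csum f.
Proof.
by move=> pq qp fc; apply/has_sum_csum/(has_sum_reindex pq qp)/(csumP fc).
Qed.

Lemma csum_Re_ge f c s : sumle f c -> (forall i, 0 <= complex.Re (f i)) ->
  uniq s -> \sum_(j <- s) complex.Re (f j) <= complex.Re (csum f).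
Proof.
move=> fc f0 us; apply/ler_addgt0Pr => e /(csumP fc)[t ut ht].
have sub : {subset t <= undup (s ++ t)}.
  by move=> x xt; rewrite mem_undup mem_cat xt orbT.
have h := ht _ (undup_uniq _) sub; have := le_trans (ler_Re_modulus _) h.
rewrite ReD ReN Re_sum ler_norml => /andP[_].
have : \sum_(j <- s) complex.Re (f j) <=
       \sum_(j <- undup (s ++ t)) complex.Re (f j).
  by apply: ler_sum_sub => // x xs; rewrite mem_undup mem_cat xs.
lra.
Qed.

Lemma csum_Re_le f c b : sumle f c ->
  (forall s, uniq s -> \sum_(j <- s) complex.Re (f j) <= b) ->
  complex.Re (csum f) <= b.
Proof.
move=> fc fb; apply/ler_addgt0Pr => e /(csumP fc)[t ut ht].
have := le_trans (ler_Re_modulus _) (ht t ut (fun x => id)).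
rewrite ReD ReN Re_sum ler_norml => /andP[+ _].
have := fb t ut; lra.
Qed.

End Index.
End CSum.

(** * Finite differences and the logarithm of the shift *)

Section Differences.
Variable V : zmodType.
Implicit Types (f g : nat -> V).

Definition fdiff (k : nat) f : nat -> V :=
  iter k (fun g n => g n.+1 - g n) f.

Arguments fdiff : simpl never.

Lemma fdiff0 f n : fdiff 0 f n = f n. Proof. by []. Qed.
Lemma fdiffS k f n : fdiff k.+1 f n = fdiff k f n.+1 - fdiff k f n. Proof. by []. Qed.
Lemma fdiffSr k f : fdiff k.+1 f = fdiff k (fun n => f n.+1 - f n).
Proof. by rewrite /fdiff iterSr. Qed.
Lemma fdiff_shift k f n : fdiff k f n.+1 = fdiff k f n + fdiff k.+1 f n.
Proof. by rewrite fdiffS addrC subrK. Qed.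

Lemma fdiffD k f g n : fdiff k (fun n => f n + g n) n = fdiff k f n + fdiff k g n.
Proof. by elim: k n => [//|k IH] n; rewrite !fdiffS !IH addrACA opprD. Qed.
Lemma fdiffN k f n : fdiff k (fun n => - f n) n = - fdiff k f n.
Proof. by elim: k n => [//|k IH] n; rewrite !fdiffS !IH opprD. Qed.
Lemma fdiffB k f g n : fdiff k (fun n => f n - g n) n = fdiff k f n - fdiff k g n.
Proof. by rewrite fdiffD fdiffN. Qed.
Lemma eq_fdiff k f g n : f =1 g -> fdiff k f n = fdiff k g n.
Proof. by move=> /funext ->. Qed.
Lemma fdiff_cst x k n : fdiff k.+1 (fun _ => x) n = 0.
Proof. by elim: k n => [|k IH] n; rewrite fdiffS ?IH subrr. Qed.
Lemma fdiff_iter k l f n : fdiff k (fdiff l f) n = fdiff (k + l) f n.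
Proof. by rewrite /fdiff iterD. Qed.
Lemma fdiff_suc k f n : fdiff k (fun n => f n.+1) n = fdiff k f n.+1.
Proof. by elim: k n => [//|k IH] n; rewrite !fdiffS !IH. Qed.
Lemma fdiff_sum (K : Type) (s : seq K) (p : pred K) (F : K -> nat -> V) k n :
  fdiff k (fun n => \sum_(x <- s | p x) F x n) n = \sum_(x <- s | p x) fdiff k (F x) n.
Proof.
elim: s n => [|x s IH] n.
  rewrite big_nil (@eq_fdiff _ _ (fun n => 0)) => [|m]; last by rewrite big_nil.
  by elim: k n => [//|k IHk] n; rewrite fdiffS !IHk subrr.
rewrite big_cons; case: ifP => px.
  rewrite -IH -fdiffD; apply: eq_fdiff => m; by rewrite big_cons px.
by rewrite -IH; apply: eq_fdiff => m; rewrite big_cons px.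
Qed.

End Differences.
Arguments fdiff : simpl never.

Section DifferencesRing.
Variable K : comPzRingType.
Implicit Types (f g : nat -> K).

Lemma fdiffZ k c f n : fdiff k (fun n => c * f n) n = c * fdiff k f n.
Proof. by elim: k n => [//|k IH] n; rewrite !fdiffS !IH mulrBr. Qed.

(** Leibniz rule.  The second factor is shifted, so that the orders of the two
    differences add up to exactly [k]. *)
Lemma fdiffM k f g n : fdiff k (fun n => f n * g n) n =
  \sum_(i < k.+1) 'C(k, i)%:R * (fdiff i f n * fdiff (k - i) g (n + i)%N).
Proof.
elim: k f g n => [|k IH] f g n.
  by rewrite big_ord_recl big_ord0 /= addr0 addn0 mul1r.
rewrite fdiffSr (@eq_fdiff _ _ _ (fun n => fdiff 1 f n * g n.+1 + f n * fdiff 1 g n));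
  last by move=> m; rewrite /fdiff /=; ring.
rewrite fdiffD (IH (fdiff 1 f)) (IH f (fdiff 1 g)) [in RHS]big_ord_recl /= !bin0 mul1r.
under eq_bigr => i _ do rewrite fdiff_iter addn1 (fdiff_suc _ g).
under [X in _ + X = _]eq_bigr => i _ do rewrite fdiff_iter.
rewrite [X in _ + X = _]big_ord_recl /= bin0 mul1r !addn0 !subn0 addn1.
rewrite addrCA; congr (_ + _).
transitivity (\sum_(i < k.+1) ('C(k, i)%:R * (fdiff i.+1 f n * fdiff (k - i) g (n + i).+1)
   + 'C(k, i.+1)%:R * (fdiff i.+1 f n * fdiff (k - i) g (n + i).+1)) : K).
  rewrite big_split /=; congr (_ + _).
  rewrite big_ord_recr /= bin_small // mul0r addr0.
  apply: eq_bigr => i _; rewrite /bump /= add1n addnS.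
  by rewrite addn0 -subSn // subSS addnS.
apply: eq_bigr => i _; rewrite /bump /= add1n addnS subSS binS natrD.
by rewrite -mulrDl addrC.
Qed.

End DifferencesRing.

Section LogShift.
Variable K : numFieldType.
Implicit Types (f g : nat -> K) (a : nat -> K).

(** The truncated logarithm of the shift by one, applied to a sequence: a
    numerical derivative that is exact on polynomials of degree at most [N]. *)
Definition dlog (N : nat) f (n : nat) : K :=
  \sum_(k < N) (-1) ^+ k / k.+1%:R * fdiff k.+1 f n.

Lemma alt_bin_step a i T :
  \sum_(t < T.+1) (-1) ^+ t * 'C(i + t, t)%:R * (a t + a t.+1) =
  \sum_(t < T.+1) (-1) ^+ t * 'C((i + t).-1, t)%:R * a t
  + (-1) ^+ T * 'C(i + T, T)%:R * a T.+1.
Proof.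
elim: T => [|T IH].
  by rewrite !big_ord_recl !big_ord0 /= !bin0; ring.
rewrite big_ord_recr /= IH [in RHS]big_ord_recr /= addnS /= binS natrD exprS.
ring.
Qed.

(** The expansion of [(1 + x)^-i] cut at degree [T], applied to the difference
    operator: shifting back by [i], up to differences of order [T + 1]. *)
Lemma unshift g i T n :
  \sum_(t < T.+1) (-1) ^+ t * 'C((i + t).-1, t)%:R * fdiff t g (n + i) =
  g n + \sum_(l < i) (-1) ^+ T * 'C(l + T, T)%:R * fdiff T.+1 g (n + l).
Proof.
elim: i => [|i IH].
  rewrite big_ord0 addr0 big_ord_recl /= !addn0 fdiff0 big1 ?addr0 ?mul1r // => t _.
  by rewrite /bump /= add1n bin_small // mulr0 mul0r.
rewrite [in RHS]big_ord_recr /= addrA -IH.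
rewrite -(alt_bin_step (fun t => fdiff t g (n + i))).
by apply: eq_bigr => t _; rewrite /= addnS fdiff_shift.
Qed.

(** The truncated logarithm inherits from the logarithm of the shift, which is an
    algebra morphism, the Leibniz rule up to products of differences of total
    order [N + 1].  Since ['C(k, i) / k] is ['C(k - 1, i - 1) / i], the terms of
    the Leibniz rule with [i] differences on [f] add up to the expansion of
    [unshift], which undoes the shift of [g]. *)
Lemma dlogM N f g n : dlog N (fun n => f n * g n) n =
  dlog N f n * g n + f n * dlog N g n
  + \sum_(i < N) \sum_(l < i.+1) (-1) ^+ i * (-1) ^+ (N - i.+1) / i.+1%:R
      * 'C(l + (N - i.+1), N - i.+1)%:R * (fdiff i.+1 f n * fdiff (N - i) g (n + l)).
Proof.
rewrite /dlog.
transitivity (\sum_(k < N) (f n * ((-1) ^+ k / k.+1%:R * fdiff k.+1 g n)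
  + \sum_(i < N) ((-1) ^+ k * 'C(k, i)%:R / i.+1%:R
      * (fdiff i.+1 f n * fdiff (k - i) g (n + i.+1))))).
  apply: eq_bigr => k _; rewrite fdiffM big_ord_recl /= bin0 mul1r addn0 subn0.
  rewrite mulrDr; congr (_ + _); first by rewrite mulrCA mulrA.
  rewrite mulr_sumr (bigID (fun i : 'I_N => (i < k.+1)%N)) /=.
  rewrite [X in _ = _ + X]big1 ?addr0 => [|i]; last first.
    by rewrite -leqNgt => ki; rewrite bin_small // mulr0 !mul0r.
  have kN : (k.+1 <= N)%N by [].
  rewrite (big_ord_widen _ (fun i : nat => (-1) ^+ k / k.+1%:R *
    ('C(k.+1, bump 0 i)%:R * (fdiff (bump 0 i) f n *
       fdiff (k.+1 - bump 0 i) g (n + bump 0 i)))) kN).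
  apply: eq_bigr => i _; rewrite /bump /= add1n subSS.
  rewrite [LHS]mulrA; congr (_ * _).
  have ek : k.+1%:R * 'C(k, i)%:R = i.+1%:R * 'C(k.+1, i.+1)%:R :> K.
    by rewrite -!natrM mul_bin_diag.
  have k0 : k.+1%:R != 0 :> K by rewrite pnatr_eq0.
  have i0 : i.+1%:R != 0 :> K by rewrite pnatr_eq0.
  move: k0 i0 ek; move: k.+1%:R i.+1%:R 'C(k, i)%:R 'C(k.+1, i.+1)%:R ((-1) ^+ k).
  move=> x y u v e x0 y0 ek; apply: (mulfI x0); apply: (mulfI y0).
  transitivity (e * (y * v)); first by field.
  by rewrite -ek; field.
rewrite big_split /= -mulr_sumr.
rewrite [X in _ = X + _]addrC -addrA; congr (_ + _).
rewrite exchange_big /= mulr_suml -big_split /=.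
apply: eq_bigr => i _.
transitivity ((-1) ^+ i / i.+1%:R * fdiff i.+1 f n *
  (\sum_(t < (N - i.+1).+1) (-1) ^+ t * 'C((i.+1 + t).-1, t)%:R
      * fdiff t g (n + i.+1))).
  rewrite mulr_sumr -subSn // subSS.
  rewrite -(big_mkord xpredT (fun k => (-1) ^+ k * 'C(k, i)%:R / i.+1%:R *
     (fdiff i.+1 f n * fdiff (k - i) g (n + i.+1)))).
  rewrite (big_cat_nat _ (n := i)) //=; last exact: ltnW.
  rewrite big_nat_cond big1 ?add0r => [|k]; last first.
    by rewrite andbT => ki; rewrite bin_small // mulr0 !mul0r.
  rewrite -{1}[nat_of_ord i]add0n big_addn big_mkord; apply: eq_bigr => t _.
  have -> : 'C(t + i, i) = 'C(i + t, t).
    by rewrite addnC -[in LHS](bin_sub (leq_addr t i)) addKn.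
  rewrite addnK /= exprD.
  move: ('C(i + t, t)%:R) ((-1) ^+ t) ((-1) ^+ i) i.+1%:R => x y z w; ring.
rewrite unshift mulrDr; congr (_ + _).
rewrite mulr_sumr; apply: eq_bigr => l _.
rewrite -subSn // subSS; ring.
Qed.

End LogShift.

Lemma hockey_stick i T : (\sum_(l < i) 'C(l + T, T) = 'C(i + T, T.+1))%N.
Proof.
elim: i => [|i IH]; first by rewrite big_ord0 add0n bin_small.
by rewrite big_ord_recr /= IH addSn binS addnC.
Qed.

(** * Sequences with analytic difference bounds *)

Section Tame.
Variable R : realType.

(** The discrete counterpart of a sequence with bounded analytic
    interpolation: differences grow like the Taylor coefficients of a function
    analytic at distance [1 / sg], up to order [K]. *)
Definition tame (K : nat) (sg c : R) (I : eqType) (f : nat -> I -> R[i]) :=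
  forall k n, (k <= K)%N ->
    sumle (fun i => fdiff k (f^~ i) n) (c * k`!%:R * sg ^+ k).

Section Facts.
Variables (K : nat) (sg : R).
Hypothesis sg0 : 0 <= sg.

Lemma tame_bnd c (I : eqType) (f : nat -> I -> R[i]) n :
  tame K sg c f -> sumle (f n) c.
Proof. by move=> /(_ 0%N n (leq0n _)); rewrite fact0 expr0 !mulr1. Qed.

Lemma tame_ge0 c (I : eqType) (f : nat -> I -> R[i]) : tame K sg c f -> 0 <= c.
Proof. by move=> /(tame_bnd 0) /sumle_ge0. Qed.

Lemma tame_const c (I : eqType) (f : I -> R[i]) : sumle f c ->
  tame K sg c (fun _ => f).
Proof.
move=> fc [|k] n _; first by rewrite fact0 expr0 !mulr1.
apply: (@sumle_weak _ _ _ 0).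
  by rewrite !mulr_ge0 ?exprn_ge0 ?ler0n ?(sumle_ge0 fc).
by apply: sumle_eq (@sumle0 R I) => i; rewrite fdiff_cst.
Qed.

(** Discrete Leibniz rule for products in separate variables; the factor
    [K + 1] counts the terms. *)
Lemma tame_prod (I J L : eqType) (p : L -> I) (q : L -> J)
    (f : nat -> I -> R[i]) (g : nat -> J -> R[i]) a b :
  injective (fun k => (p k, q k)) -> tame K sg a f -> tame K sg b g ->
  tame K sg (K.+1%:R * a * b) (fun n k => f n (p k) * g n (q k)).
Proof.
move=> ipq fa gb k n kK.
have a0 := tame_ge0 fa; have b0 := tame_ge0 gb.
apply: (@sumle_eq _ _ _ (fun x => \sum_(i < k.+1) 'C(k, i)%:R *
   (fdiff i (f^~ (p x)) n * fdiff (k - i) (g^~ (q x)) (n + i)))) => [x|].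
  by rewrite fdiffM.
apply: (@sumle_weak _ _ _ (\sum_(i < k.+1) a * b * k`!%:R * sg ^+ k)); last first.
  apply: sumle_sum => i _.
  have ik : (i <= k)%N by rewrite -ltnS.
  have := sumleZ ('C(k, i)%:R) (sumle_prod ipq (fa i n (leq_trans ik kK))
     (gb (k - i)%N (n + i)%N (leq_trans (leq_subr _ _) kK))).
  apply: sumle_weak; rewrite modulusn le_eqVlt; apply/orP; left; apply/eqP.
  have -> : k`!%:R = 'C(k, i)%:R * i`!%:R * (k - i)`!%:R :> R.
    by rewrite -!natrM -mulnA bin_fact.
  have -> : sg ^+ k = sg ^+ i * sg ^+ (k - i) by rewrite -exprD subnKC.
  ring.
rewrite sumr_const card_ord -[X in X <= _]mulr_natl -!mulrA ler_wpM2r ?ler_nat //.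
by rewrite !mulr_ge0 ?ler0n ?exprn_ge0.
Qed.

(** The binomial sums of [dlogM] recombine with the factorials of the two
    sequences into [N`!] for each of the [N] orders. *)
Lemma dlog_defect (I J L : eqType) (p : L -> I) (q : L -> J)
    (f : nat -> I -> R[i]) (g : nat -> J -> R[i]) a b N n :
  (N <= K)%N -> injective (fun k => (p k, q k)) ->
  tame K sg a f -> tame K sg b g ->
  sumle (fun x => dlog N (fun n => f n (p x) * g n (q x)) n
     - (dlog N (f^~ (p x)) n * g n (q x) + f n (p x) * dlog N (g^~ (q x)) n))
    (a * b * (N.+1)`!%:R * sg ^+ N.+1).
Proof.
move=> NK ipq fa gb.
have a0 := tame_ge0 fa; have b0 := tame_ge0 gb.
apply: (@sumle_eq _ _ _ (fun x => \sum_(i < N) \sum_(l < i.+1)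
   ((-1) ^+ i * (-1) ^+ (N - i.+1) / i.+1%:R * 'C(l + (N - i.+1), N - i.+1)%:R)
    * (fdiff i.+1 (f^~ (p x)) n * fdiff (N - i) (g^~ (q x)) (n + l)))) => [x|].
  by rewrite dlogM addrAC subrr add0r.
apply: (@sumle_weak _ _ _ (\sum_(i < N) a * b * N`!%:R * sg ^+ N.+1)).
  have -> : (N.+1)`!%:R = N.+1%:R * N`!%:R :> R by rewrite factS natrM.
  rewrite sumr_const card_ord -[X in X <= _]mulr_natl.
  have -> : a * b * (N.+1%:R * N`!%:R) * sg ^+ N.+1 =
     N.+1%:R * (a * b * N`!%:R * sg ^+ N.+1) by ring.
  by rewrite ler_wpM2r ?ler_nat // !mulr_ge0 ?ler0n ?exprn_ge0.
apply: sumle_sum => i _.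
have iN : (i < N)%N by [].
have iN' := ltnW iN.
apply: (@sumle_weak _ _ _ (\sum_(l < i.+1) (i.+1%:R^-1 *
   'C(l + (N - i.+1), N - i.+1)%:R) * ((a * (i.+1)`!%:R * sg ^+ i.+1)
    * (b * (N - i)`!%:R * sg ^+ (N - i))))); last first.
  apply: sumle_sum => l _.
  have := sumleZ ((-1) ^+ i * (-1) ^+ (N - i.+1) / i.+1%:R
     * 'C(l + (N - i.+1), N - i.+1)%:R)
    (sumle_prod ipq (fa i.+1 n (leq_trans iN NK))
     (gb (N - i)%N (n + l)%N (leq_trans (leq_subr _ _) NK))).
  apply: sumle_weak; rewrite !modulusM !modulusX modulusN modulus1 !expr1n.
  by rewrite !mul1r modulusV !modulusn.
rewrite -mulr_suml -mulr_sumr -natr_sum hockey_stick.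
have -> : (i.+1 + (N - i.+1) = N)%N by rewrite subnKC.
rewrite -subSn // subSS.
rewrite le_eqVlt; apply/orP; left; apply/eqP.
rewrite factS natrM.
have -> : N`!%:R = 'C(N, N - i)%:R * i`!%:R * (N - i)`!%:R :> R.
  rewrite -!natrM; congr (_%:R).
  by rewrite bin_sub // -mulnA bin_fact.
have -> : sg ^+ N.+1 = sg ^+ i.+1 * sg ^+ (N - i).
  by rewrite -exprD addSn subnKC.
have i0 : i.+1%:R != 0 :> R by rewrite pnatr_eq0.
by move: i0; move: i.+1%:R => x x0; field.
Qed.

End Facts.

Section SumsAlongSequences.
Variable I : choiceType.
Implicit Types (f : nat -> I -> R[i]).

Lemma sumle_fdiff (J : eqType) (f : nat -> J -> R[i]) c k n : (forall n, sumle (f n) c) ->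
  sumle (fun i => fdiff k (f^~ i) n) (2 ^+ k * c).
Proof.
move=> fc; elim: k n => [|k IH] n; first by rewrite expr0 mul1r; apply: fc.
rewrite exprS -mulrA mulr_natl mulr2n; apply: sumleB; exact: IH.
Qed.

Lemma csum_fdiff f c k n : (forall n, sumle (f n) c) ->
  fdiff k (fun n => csum (f n)) n = csum (fun i => fdiff k (f^~ i) n).
Proof.
move=> fc; elim: k n => [//|k IH] n.
by rewrite fdiffS !IH -(csumB (sumle_fdiff k n.+1 fc) (sumle_fdiff k n fc)).
Qed.

Lemma sumle_dlog (J : eqType) (f : nat -> J -> R[i]) c N n :
  (forall n, sumle (f n) c) ->
  sumle (fun i => dlog N (f^~ i) n)
   (\sum_(k < N) modulus ((-1) ^+ k / k.+1%:R) * (2 ^+ k.+1 * c)).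
Proof. by move=> fc; apply: sumle_sum => k _; apply/sumleZ/sumle_fdiff. Qed.

Lemma csum_dlog f c N n : (forall n, sumle (f n) c) ->
  dlog N (fun n => csum (f n)) n = csum (fun i => dlog N (f^~ i) n).
Proof.
move=> fc; rewrite /dlog.
have H (k : 'I_N) (_ : true) := sumleZ ((-1) ^+ k / k.+1%:R)
  (sumle_fdiff k.+1 n fc).
rewrite (csum_sum _ H).
by apply: eq_bigr => k _; rewrite (csum_fdiff _ _ fc) (csumZ _ (sumle_fdiff _ _ fc)).
Qed.

End SumsAlongSequences.
End Tame.

(** * Tensor powers of a phase *)

Section Tensors.
Variables (R : realType) (L : lattice) (d : nat).
Local Notation C := R[i].
Local Notation phase := (phase R L d).
Local Notation mode := (mode L d).
Implicit Types (f z w : phase) (G Q : seq mode -> C).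

Definition tens f G : seq mode -> C :=
  fun s => if s is j :: t then f j * G t else 0.

(** The tensor powers of [z], as families indexed by all words of modes and
    supported by the words of the given length. *)
Definition tpow z (l : nat) : seq mode -> C :=
  iter l (tens z) (fun s => (s == [::])%:R).

Arguments tpow : simpl never.

Lemma tpowS z l : tpow z l.+1 = tens z (tpow z l). Proof. by []. Qed.

Lemma tpow_monomial z (s : seq mode) : tpow z (size s) s = monomial z s.
Proof.
elim: s => [|j s IH]; first by rewrite /tpow /= /monomial big_nil.
by rewrite /= tpowS /= IH /monomial big_cons.
Qed.

Lemma sumle_cons (F : seq mode -> C) c : F [::] = 0 ->
  sumle (fun x : mode * seq mode => F (x.1 :: x.2)) c -> sumle F c.
Proof.
move=> F0 Fc s us.
pose u (s : seq mode) := if s is j :: t then Some (j, t) else None.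
have -> : \sum_(j <- s) modulus (F j) =
    \sum_(x <- pmap u s) modulus (F (x.1 :: x.2)).
  elim: s {us} => [|[|j t] s IH]; first by rewrite !big_nil.
    by rewrite big_cons F0 modulus0 add0r IH.
  by rewrite /= !big_cons IH.
apply: Fc; apply: (pmap_uniq (g := fun x => x.1 :: x.2)) => //.
by case.
Qed.

Lemma sumle_tens f G a b : sumle f a -> sumle G b -> sumle (tens f G) (a * b).
Proof.
move=> fa Gb; apply: sumle_cons => //=.
by apply: sumle_prod fa Gb; case=> [x y] [x' y'].
Qed.

Lemma sumle_tpow z a l : 0 <= a -> sumle z a -> sumle (tpow z l) (a ^+ l).
Proof.
move=> a0 za; elim: l => [|l IH]; last by rewrite exprS; apply: sumle_tens.
move=> s us; rewrite expr0 /tpow /=.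
have [ns|ns] := boolP ([::] \in s).
  rewrite (bigD1_seq [::]) //= modulusn big1 ?addr0 // => t.
  by move=> /negPf ->; rewrite modulus0.
rewrite big_seq big1 // => t ts; case: eqP => [t0|]; last by rewrite modulus0.
by rewrite -t0 ts in ns.
Qed.

Lemma tensB f f' G G' s :
  tens f G s - tens f' G' s = tens (fun j => f j - f' j) G s
    + tens f' (fun t => G t - G' t) s.
Proof. by case: s => [|j s] /=; rewrite ?subr0 ?addr0 //; ring. Qed.

Lemma tpow_lip z z' a e l : 1 <= a -> sumle z a -> sumle z' a ->
  sumle (fun j => z j - z' j) e ->
  sumle (fun s => tpow z l s - tpow z' l s) (l%:R * a ^+ l * e).
Proof.
move=> a1 za za' ze; have a0 : 0 <= a by lra.
elim: l => [|l IH].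
  by rewrite !mul0r; apply: sumle_eq (@sumle0 R _) => s; rewrite subrr.
apply: (sumle_eq (fun s => tensB _ _ _ _ s)).
apply: sumle_weak (sumleD (sumle_tens ze (sumle_tpow l a0 za))
  (sumle_tens za' IH)).
have e0 := sumle_ge0 ze.
rewrite exprS -natr1 !mulrDl mul1r addrC; apply: lerD; first by lra.
rewrite mulrC ler_wpM2r // ler_peMl ?exprn_ge0 //.
Qed.

Definition ins1 (i : nat) (w : mode -> C) Q : seq mode -> C :=
  fun s => if drop i s is j :: t then w j * Q (take i s ++ t) else 0.

(** Multiplication of [Q] by [w], a variable being inserted at each of the [l]
    places: for [Q] a tensor power of [z] this is the derivative of the next
    tensor power at [z] in the direction [w]. *)
Definition ins (l : nat) w Q : seq mode -> C :=
  fun s => \sum_(i < l) ins1 i w Q s.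

Definition dtpow (l : nat) w z := ins l w (tpow z l.-1).

Lemma dtpow0 w z s : dtpow 0 w z s = 0.
Proof. by rewrite /dtpow /ins big_ord0. Qed.

Lemma dtpowS l w z s : dtpow l.+1 w z s =
  tens w (tpow z l) s + tens z (dtpow l w z) s.
Proof.
rewrite /dtpow /ins big_ord_recl; congr (_ + _).
  by case: s => [|j s]; rewrite /ins1 //= take0 drop0.
case: s => [|j s] /=; first by rewrite big1.
rewrite mulr_sumr; apply: eq_bigr => i _.
case: l i => [[]//|l i]; rewrite /ins1 /bump /= add0n.
by case: (drop i s) => [|k t]; rewrite ?mulr0 // tpowS /=; ring.
Qed.

Lemma ins1_lin i w w' Q u s :
  ins1 i (fun j => w j + u * w' j) Q s = ins1 i w Q s + u * ins1 i w' Q s.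
Proof. by rewrite /ins1; case: (drop i s) => [|j t]; ring. Qed.

Lemma ins1_linr i w Q Q' u s :
  ins1 i w (fun t => Q t + u * Q' t) s = ins1 i w Q s + u * ins1 i w Q' s.
Proof. by rewrite /ins1; case: (drop i s) => [|j t]; ring. Qed.

Lemma tpow_taylor z e a (u : C) l : 1 <= a -> sumle z a ->
  sumle (fun j => z j + u * e j) a -> sumle e 1 ->
  sumle (fun s => tpow (fun j => z j + u * e j) l s - tpow z l s
      - u * dtpow l e z s) (l%:R ^+ 2 * a ^+ l * modulus u ^+ 2).
Proof.
move=> a1 za za' e1; have a0 : 0 <= a by lra.
have u0 := modulus_ge0 u.
elim: l => [|l IH].
  rewrite expr0n /= !mul0r; apply: sumle_eq (@sumle0 R _) => s.
  by rewrite dtpow0 mulr0 !subrr.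
pose z' (j : mode) := z j + u * e j.
have ze : sumle (fun j => z' j - z j) (modulus u).
  rewrite -[modulus u]mulr1; apply: sumle_eq (sumleZ u e1) => j.
  by rewrite /z'; ring.
apply: (@sumle_eq _ _ _ (fun s => tens z (fun s => tpow z' l s - tpow z l s
   - u * dtpow l e z s) s + u * tens e (fun s => tpow z' l s - tpow z l s) s)).
  by case=> [|j s]; rewrite !tpowS dtpowS /= /z'; ring.
apply: sumle_weak (sumleD (sumle_tens za IH)
  (sumleZ u (sumle_tens e1 (tpow_lip l a1 za' za ze)))).
rewrite mul1r -natr1 (exprS a l).
set A := a ^+ l; have A0 : 0 <= A by rewrite exprn_ge0.
have l0 : 0 <= l%:R :> R by [].
have -> : (l%:R + 1) ^+ 2 * (a * A) * modulus u ^+ 2 =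
  a * (l%:R ^+ 2 * A * modulus u ^+ 2)
  + modulus u * (l%:R * A * modulus u) * a
  + (l%:R * a + a) * A * modulus u ^+ 2 by ring.
rewrite -addrA lerD2l -[X in X <= _]addr0 lerD //.
  by rewrite ler_peMr // !mulr_ge0.
by rewrite !mulr_ge0 ?addr_ge0 ?mulr_ge0 ?exprn_ge0.
Qed.

End Tensors.

(** * Polynomial Hamiltonians with zero momentum *)

Section L1.
Variables (R : realType) (L : lattice) (d : nat).

Lemma esum_le_iff (I : choiceType) (D : set I) (f : I -> R) (c : R) :
  (forall i, 0 <= f i) ->
  (\esum_(i in D) (f i)%:E <= c%:E)%E <->
  (forall s, uniq s -> (forall i, i \in s -> D i) -> \sum_(i <- s) f i <= c).
Proof.
move=> f0; split => [h s us sD|h].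
  rewrite -lee_fin; apply: le_trans h; apply: esum_ge.
  exists [set` s]; first by split => //= i; exact: sD.
  by rewrite -fsbig_seq //= sumEFin.
rewrite /esum; apply/ereal_supP => _ /= [X [finX XD] <-].
rewrite fsbig_finite //= sumEFin lee_fin; apply: h.
  exact: fset_uniq.
by move=> i; rewrite in_fset_set // inE => /XD.
Qed.

Lemma l1norm_le (z : phase R L d) c : (l1norm z <= c%:E)%E <-> sumle z c.
Proof.
rewrite /l1norm esum_le_iff; last by move=> j; apply: modulus_ge0.
by split => h s us; [apply: h|move=> _; apply: h].
Qed.

Lemma in_l1P (z : phase R L d) : in_l1 z <-> exists c, sumle z c.
Proof.
split => [|[c /l1norm_le zc]]; last first.
  by apply: le_lt_trans zc _; rewrite ltry.
rewrite /in_l1 => zoo; exists (fine (l1norm z)); apply/l1norm_le.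
rewrite fineK // ge0_fin_numE //; apply: esum_ge0 => j _.
by rewrite lee_fin modulus_ge0.
Qed.

End L1.

Section Polynomials.
Variables (R : realType) (L : lattice) (d : nat).
Local Notation C := R[i].
Local Notation phase := (phase R L d).
Local Notation mode := (mode L d).
Implicit Types (z w : mode -> C) (F : seq mode -> C) (Q : nat -> seq mode -> C).

Variables (r : nat) (a : seq mode -> C) (B : R).
Hypothesis B0 : 0 <= B.
Hypothesis aB : forall js, (2 <= size js <= r)%N -> momentum js = 0 ->
  modulus (a js) <= B.

Definition zmval l (js : zero_momentum L d l) : seq mode := tval (val js).

Lemma zmval_inj l : injective (@zmval l).
Proof. by move=> x y /val_inj /val_inj. Qed.

Lemma momentum_zmval l (js : zero_momentum L d l) : momentum (zmval js) = 0.
Proof. by apply/eqP; case: js. Qed.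

Lemma size_zmval l (js : zero_momentum L d l) : size (zmval js) = l.
Proof. exact: size_tuple. Qed.

Definition pairing l F : C :=
  csum (fun js : zero_momentum L d l => a (zmval js) * F (zmval js)).

Lemma pairing_sumle l F c : (2 <= l <= r)%N -> sumle (F \o @zmval l) c ->
  sumle (fun js : zero_momentum L d l => a (zmval js) * F (zmval js)) (B * c).
Proof.
move=> lr Fc; apply: sumleM Fc => // js; apply: aB; first by rewrite size_zmval.
exact: momentum_zmval.
Qed.

Lemma pairing_le l F c : (2 <= l <= r)%N -> sumle (F \o @zmval l) c ->
  modulus (pairing l F) <= B * c.
Proof. by move=> lr Fc; apply/csum_le/pairing_sumle. Qed.

Lemma pairing_lin l F G u c e : (2 <= l <= r)%N ->
  sumle (F \o @zmval l) c -> sumle (G \o @zmval l) e ->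
  pairing l (fun s => F s + u * G s) = pairing l F + u * pairing l G.
Proof.
move=> lr Fc Ge; rewrite -(csumZ u (pairing_sumle lr Ge)).
rewrite -(csumD (pairing_sumle lr Fc) (sumleZ u (pairing_sumle lr Ge))).
by congr csum; apply/funext => js; ring.
Qed.

Lemma eq_pairing l F G : (forall js, F (@zmval l js) = G (zmval js)) ->
  pairing l F = pairing l G.
Proof. by move=> FG; congr csum; apply/funext => js; rewrite FG. Qed.

Lemma zm_sumle l F c : sumle F c -> sumle (F \o @zmval l) c.
Proof. exact/sumle_image/zmval_inj. Qed.

Lemma momentum_cat (s t : seq mode) :
  momentum (s ++ t) = momentum s + momentum t.
Proof. by rewrite /momentum big_cat. Qed.

Lemma momentum_cons (j : mode) s :
  momentum (j :: s) = (if j.2 then val j.1 else - val j.1) + momentum s.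
Proof. by rewrite /momentum big_cons. Qed.

(** A zero-momentum word is determined by the word left when one letter is
    removed, together with the sign of that letter: this is why inserting a
    merely bounded variable keeps the sum over zero-momentum words finite. *)
Lemma ins1_sumle l i w F b c : (i < l)%N -> 0 <= b ->
  (forall j, modulus (w j) <= b) -> sumle F c ->
  sumle (ins1 i w F \o @zmval l) (b * (c * 2)).
Proof.
move=> il b0 wb Fc.
pose p (js : zero_momentum L d l) := take i (zmval js) ++ drop i.+1 (zmval js).
pose q (js : zero_momentum L d l) :=
  if drop i (zmval js) is j :: _ then j.2 else true.
have split js : exists j, [/\ q js = j.2,
    zmval js = take i (zmval js) ++ j :: drop i.+1 (zmval js) &
    ins1 i w F (zmval js) = w j * F (p js)].
  have ijs : (i < size (zmval js))%N by rewrite size_zmval.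
  have x0 : mode by case: (zmval js) ijs => [|j s].
  exists (nth x0 (zmval js) i).
  rewrite /q /ins1 /p (drop_nth x0 ijs); split => //.
  by rewrite -(drop_nth x0 ijs) cat_take_drop.
have ipq : injective (fun js => (p js, q js)).
  move=> x y [pxy qxy].
  have [j [qj ej _]] := split x; have [k [qk ek _]] := split y.
  have [et ed] : take i (zmval x) = take i (zmval y) /\
                 drop i.+1 (zmval x) = drop i.+1 (zmval y).
    move/eqP: pxy; rewrite /p eqseq_cat; last first.
      by rewrite !size_takel // size_zmval ltnW.
    by move=> /andP[/eqP -> /eqP ->].
  apply: zmval_inj; rewrite ej ek et ed; congr (_ ++ _ :: _).
  have := momentum_zmval x; have := momentum_zmval y.
  rewrite ej ek et ed !momentum_cat !momentum_cons => hk hj.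
  have hjk : (if j.2 then val j.1 else - val j.1) =
     (if k.2 then val k.1 else - val k.1).
    by move: hk; rewrite -hj => /addrI /addIr ->.
  have ejk : j.2 = k.2 by rewrite -qj -qk qxy.
  clear -hjk ejk; move: hjk ejk; case: j k => [j1 j2] [k1 k2] /= + e.
  by rewrite e; case: k2 {e} => [/val_inj -> //|/oppr_inj/val_inj -> //].
have two : sumle (fun _ : bool => 1 : C) 2.
  move=> s us; rewrite (eq_bigr (fun=> 1)) => [|t _]; last by rewrite modulus1.
  rewrite big_const_seq count_predT iter_addr_0 ler_nat.
  by have /card_uniqP <- := us; rewrite (leq_trans (max_card _)) // card_bool.
have := sumle_prod ipq Fc two => h s us; apply: le_trans (ler_wpM2l b0 (h s us)).
rewrite mulr_sumr; apply: ler_sum => js _ /=.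
have [j [_ _ ->]] := split js; rewrite mulr1 modulusM.
by rewrite ler_wpM2r ?modulus_ge0 ?wb.
Qed.

Lemma ins_sumle l w F b c : 0 <= b -> (forall j, modulus (w j) <= b) ->
  sumle F c -> sumle (ins l w F \o @zmval l) (l%:R * (b * (c * 2))).
Proof.
move=> b0 wb Fc.
have : sumle (fun js => \sum_(i < l) ins1 i w F (@zmval l js))
   (\sum_(i < l) b * (c * 2)).
  by apply: sumle_sum => i _; apply: ins1_sumle.
by rewrite sumr_const card_ord -[X in sumle _ X -> _]mulr_natl.
Qed.

Definition ham z : C := \sum_(2 <= l < r.+1) pairing l (tpow z l).

(** The derivative of [ham]: [Q l] stands for the tensor power of order [l] of
    the base point, and is kept arbitrary so that finite differences of tensor
    powers can be substituted for it. *)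
Definition dham Q w : C := \sum_(2 <= l < r.+1) pairing l (ins l w (Q l.-1)).

Definition dham_const : R := \sum_(2 <= l < r.+1) B * (l%:R * 2).

Lemma dham_const_ge0 : 0 <= dham_const.
Proof. by apply: sumr_ge0 => l _; rewrite !mulr_ge0. Qed.

Lemma dham_le Q w b c : 0 <= b -> (forall j, modulus (w j) <= b) ->
  (forall l, (l < r)%N -> sumle (Q l) c) -> modulus (dham Q w) <= dham_const * (b * c).
Proof.
move=> b0 wb Qc; apply: le_trans (modulus_sum _ _ _) _.
rewrite /dham_const mulr_suml big_nat_cond [X in _ <= X]big_nat_cond.
apply: ler_sum => l /andP[lr _]; rewrite ltnS in lr.
have lr' : (l.-1 < r)%N by lia.
apply: le_trans (pairing_le lr (ins_sumle b0 wb (Qc _ lr'))) _.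
by rewrite -!mulrA ler_wpM2l // le_eqVlt; apply/orP; left; apply/eqP; ring.
Qed.

Lemma dham_linr Q w w' u b b' c : (forall j, modulus (w j) <= b) ->
  (forall j, modulus (w' j) <= b') -> (forall l, (l < r)%N -> sumle (Q l) c) ->
  0 <= b -> 0 <= b' ->
  dham Q (fun j => w j + u * w' j) = dham Q w + u * dham Q w'.
Proof.
move=> wb wb' Qc b0 b0'; rewrite /dham mulr_sumr -big_split /=.
apply: eq_big_nat => l lr; rewrite ltnS in lr.
have lr' : (l.-1 < r)%N by lia.
rewrite -(pairing_lin u lr (ins_sumle b0 wb (Qc _ lr'))
  (ins_sumle b0' wb' (Qc _ lr'))).
apply: eq_pairing => js; rewrite /ins mulr_sumr -big_split /=.
by apply: eq_bigr => i _; rewrite ins1_lin.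
Qed.

Lemma dham_linl Q Q' w u b c c' : 0 <= b -> (forall j, modulus (w j) <= b) ->
  (forall l, (l < r)%N -> sumle (Q l) c) ->
  (forall l, (l < r)%N -> sumle (Q' l) c') ->
  dham (fun l s => Q l s + u * Q' l s) w = dham Q w + u * dham Q' w.
Proof.
move=> b0 wb Qc Qc'; rewrite /dham mulr_sumr -big_split /=.
apply: eq_big_nat => l lr; rewrite ltnS in lr.
have lr' : (l.-1 < r)%N by lia.
rewrite -(pairing_lin u lr (ins_sumle b0 wb (Qc _ lr'))
  (ins_sumle b0 wb (Qc' _ lr'))).
apply: eq_pairing => js; rewrite /ins mulr_sumr -big_split /=.
by apply: eq_bigr => i _; rewrite ins1_linr.
Qed.

Definition delta (j : mode) : mode -> C := fun k => (k == j)%:R.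

Lemma delta_le j k : modulus (delta j k) <= 1.
Proof. by rewrite modulusn /delta; case: (k == j); rewrite ?ler_nat. Qed.

Lemma delta_sumle j : sumle (delta j) 1.
Proof.
move=> s us; have [js|js] := boolP (j \in s).
  rewrite (bigD1_seq j) //= {1}/delta eqxx modulus1 big1 ?addr0 // => k.
  by rewrite /delta => /negPf ->; rewrite modulus0.
rewrite big_seq big1 // => k ks; rewrite /delta; case: eqP => [kj|]; last first.
  by rewrite modulus0.
by rewrite -kj ks in js.
Qed.

Lemma dham_fin Q u b c (s : seq mode) : uniq s -> 0 <= b ->
  (forall j, modulus (u j) <= b) -> (forall l, (l < r)%N -> sumle (Q l) c) ->
  dham Q (fun k => if k \in s then u k else 0) =
  \sum_(j <- s) u j * dham Q (delta j).
Proof.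
move=> us b0 ub Qc; elim: s us => [_|j s IH /= /andP[js us]].
  rewrite big_nil (_ : (fun k => _) = (fun k => 0 + (-1) * 0 : C)); last first.
    by apply/funext => k; rewrite mulr0 addr0.
  have z0 (k : mode) : modulus (0 : C) <= 0 by rewrite modulus0.
  by rewrite (dham_linr (-1) z0 z0 Qc) // mulN1r subrr.
rewrite big_cons -(IH us) addrC.
have h (k : mode) : modulus (if k \in s then u k else 0) <= b.
  by case: ifP => _; rewrite ?modulus0.
rewrite -(dham_linr (u j) h (delta_le j) Qc b0 ler01); congr dham.
apply/funext => k; rewrite inE /delta; case: eqP => [->|_] /=.
  by rewrite (negPf js) add0r mulr1.
by rewrite mulr0 addr0.
Qed.

(** Testing against unimodular coefficients turns the l^1 norm of the gradient
    into a single value of the differential, in a bounded direction. *)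
Lemma gradient_sumle Q c : (forall l, (l < r)%N -> sumle (Q l) c) ->
  sumle (fun j => dham Q (delta j)) (dham_const * c).
Proof.
move=> Qc s us.
have [|u u1] := @choice _ _ (fun (j : mode) (v : C) => modulus v = 1 /\
    (modulus (dham Q (delta j)))%:C%C = v * dham Q (delta j)).
  by move=> j; have [v v1 v2] := unimodular (dham Q (delta j)); exists v.
have e : (\sum_(j <- s) modulus (dham Q (delta j)))%:C%C =
    dham Q (fun k => if k \in s then u k else 0).
  rewrite (dham_fin us ler01 _ Qc) => [|j]; last by rewrite (u1 j).1.
  transitivity (\sum_(j <- s) (modulus (dham Q (delta j)))%:C%C).
    by rewrite rmorph_sum.
  by apply: eq_bigr => j _; rewrite (u1 j).2.
have := @dham_le Q (fun k => if k \in s then u k else 0) 1 c ler01 _ Qc.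
rewrite -e modulusR mul1r => h.
apply: le_trans (ler_norm _) _; apply: h => k.
by case: ifP => _; rewrite ?modulus0 ?(u1 k).1.
Qed.

(** The gradient represents the differential: the directions [w] cut off to
    finite sets converge to [w] uniformly. *)
Lemma dham_csum Q w b c : sumle w b -> (forall l, (l < r)%N -> sumle (Q l) c) ->
  has_sum (fun j => w j * dham Q (delta j)) (dham Q w).
Proof.
move=> wb Qc e e0; have b0 := sumle_ge0 wb.
have [r0|r0] := leqP r 0.
  exists [::] => // t _ _; rewrite big1 => [|j _].
    by rewrite /dham big_geq ?subr0 ?modulus0 ?ltW // ltnW // ltnS (leq_trans r0).
  by rewrite /dham big_geq ?mulr0 // ltnW // ltnS (leq_trans r0).
have c0 : 0 <= c by exact: sumle_ge0 (Qc _ r0).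
have k0 : 0 < dham_const * c + 1 by have := mulr_ge0 dham_const_ge0 c0; lra.
have [s us hs] := sumle_tail (divr_gt0 e0 k0) wb.
exists s => // t ut st.
have bw j : modulus (w j) <= b := sumle_bnd j wb.
rewrite -(dham_fin ut b0 bw Qc) modulusBC.
have h1 (k : mode) : modulus (if k \in t then w k else 0) <= b.
  by case: ifP => _; rewrite ?modulus0.
have -> : dham Q w - dham Q (fun k => if k \in t then w k else 0) =
   dham Q (fun k => w k + (-1) * (if k \in t then w k else 0)).
  by rewrite (dham_linr (-1) bw h1 Qc) // mulN1r.
have e1 : 0 <= e / (dham_const * c + 1) by rewrite divr_ge0 // ltW.
apply: le_trans (dham_le e1 _ Qc) _ => [j|].
  case: ifP => jt; first by rewrite mulN1r subrr modulus0.
  rewrite mulr0 addr0; have := sumle_bnd j hs.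
  by case: ifP => // js; rewrite st in jt.
rewrite [X in X <= _](_ : _ = dham_const * c * e / (dham_const * c + 1)); last by ring.
by rewrite ler_pdivrMr // mulrDr mulr1 mulrC lerDl ltW.
Qed.

End Polynomials.

(** * Tensor powers along sequences *)

Section LogShiftFacts.
Variable K : numFieldType.

Lemma dlogZ (c : K) f N n : dlog N (fun n => c * f n) n = c * dlog N f n.
Proof. by rewrite /dlog mulr_sumr; apply: eq_bigr => k _; rewrite fdiffZ; ring. Qed.

Lemma dlog_sum (I : Type) (s : seq I) (p : pred I) (F : I -> nat -> K) N n :
  dlog N (fun n => \sum_(x <- s | p x) F x n) n =
  \sum_(x <- s | p x) dlog N (F x) n.
Proof.
rewrite /dlog exchange_big /=; apply: eq_bigr => k _.
by rewrite fdiff_sum mulr_sumr.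
Qed.

Lemma dlog_cst (c : K) N n : dlog N (fun=> c) n = 0.
Proof. by rewrite /dlog big1 // => k _; rewrite fdiff_cst mulr0. Qed.

End LogShiftFacts.

Section TameTensors.
Variables (R : realType) (L : lattice) (d : nat).
Local Notation C := R[i].
Local Notation phase := (phase R L d).
Local Notation mode := (mode L d).
Variables (K : nat) (sg : R).
Hypothesis sg0 : 0 <= sg.

Definition dlogv (I : Type) (N : nat) (f : nat -> I -> C) n : I -> C :=
  fun i => dlog N (f^~ i) n.

Lemma cons_inj : injective (fun k : mode * seq mode => (k.1, k.2)).
Proof. by case=> [a b] [c e]. Qed.

Lemma tame_tens (f : nat -> phase) (G : nat -> seq mode -> C) a b :
  tame K sg a f -> tame K sg b G ->
  tame K sg (K.+1%:R * a * b) (fun n => tens (f n) (G n)).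
Proof.
move=> fa Gb k n kK; apply: sumle_cons.
  by case: k kK => [//|k] kK /=; rewrite fdiff_cst.
exact: (tame_prod sg0 cons_inj fa Gb).
Qed.

Lemma dlogv_tens (f : nat -> phase) (G : nat -> seq mode -> C) a b N n :
  (N <= K)%N -> tame K sg a f -> tame K sg b G ->
  sumle (fun s => dlog N (fun n => tens (f n) (G n) s) n
     - (tens (dlogv N f n) (G n) s + tens (f n) (dlogv N G n) s))
    (a * b * (N.+1)`!%:R * sg ^+ N.+1).
Proof.
move=> NK fa Gb; apply: sumle_cons; first by rewrite /= dlog_cst addr0 subr0.
exact: (dlog_defect sg0 n NK cons_inj fa Gb).
Qed.

Variables (v : nat -> phase) (A : R).
Hypothesis A1 : 1 <= A.
Hypothesis vA : tame K sg A v.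

(** With this constant the tensor powers of order [l] are tame with bound
    [tensor_const ^+ l]: one factor [A] for the size of the sequence and one factor
    [K + 1] for the terms of the Leibniz rule. *)
Definition tensor_const := K.+1%:R * A.

Lemma tensor_const_ge : A <= tensor_const.
Proof. by rewrite /tensor_const ler_peMl ?(le_trans ler01 A1) // ler1n. Qed.

Lemma tensor_const_ge1 : 1 <= tensor_const.
Proof. exact: le_trans A1 tensor_const_ge. Qed.

Lemma tame_tpow l : tame K sg (tensor_const ^+ l) (fun n => tpow (v n) l).
Proof.
elim: l => [|l IH]; last by rewrite exprS; apply: tame_tens.
have h := @sumle_tpow R L d (fun _ => 0) 0 0 (lexx 0) (@sumle0 R _).
by rewrite expr0 in h; rewrite expr0; exact: (tame_const sg0 h).
Qed.

Lemma tpow_bnd l n : sumle (tpow (v n) l) (tensor_const ^+ l).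
Proof. exact: tame_bnd (tame_tpow l). Qed.

(** Chain rule for the approximate derivation, one factor of the tensor power at
    a time. *)
Lemma dlogv_tpow l N n : (N <= K)%N ->
  sumle (fun s => dlog N (fun n => tpow (v n) l s) n
     - dtpow l (dlogv N v n) (v n) s)
    (l%:R * tensor_const ^+ l * ((N.+1)`!%:R * sg ^+ N.+1)).
Proof.
move=> NK; elim: l => [|l IH].
  rewrite !mul0r; apply: sumle_eq (@sumle0 R _) => s.
  by rewrite dtpow0 dlog_cst subrr.
have vn : sumle (v n) A by exact: tame_bnd vA.
apply: (sumle_eq (g := fun s =>
   (dlog N (fun n => tens (v n) (tpow (v n) l) s) n
   - (tens (dlogv N v n) (tpow (v n) l) s
       + tens (v n) (dlogv N (fun n => tpow (v n) l) n) s))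
   + tens (v n) (fun s => dlog N (fun n => tpow (v n) l s) n
     - dtpow l (dlogv N v n) (v n) s) s)).
  move=> s; rewrite dtpowS; case: s => [|j s] /=; first by ring.
  rewrite /dlogv; ring.
apply: sumle_weak (sumleD (dlogv_tens n NK vA (tame_tpow l))
   (sumle_tens vn IH)).
have E0 : 0 <= (N.+1)`!%:R * sg ^+ N.+1 by rewrite mulr_ge0 ?exprn_ge0.
have G0 : 0 <= tensor_const ^+ l by rewrite exprn_ge0 // (le_trans _ tensor_const_ge1).
rewrite (exprS tensor_const) -natr1.
rewrite [X in X <= _](_ : _ = A * ((l%:R + 1) * tensor_const ^+ l *
   ((N.+1)`!%:R * sg ^+ N.+1))); last by ring.
rewrite [X in _ <= X](_ : _ = tensor_const * ((l%:R + 1) * tensor_const ^+ l *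
   ((N.+1)`!%:R * sg ^+ N.+1))); last by ring.
by rewrite ler_wpM2r ?tensor_const_ge // mulr_ge0 // mulr_ge0 // addr_ge0.
Qed.

End TameTensors.

(** * Estimates on the Hamiltonian *)

Section Hamiltonian.
Variables (R : realType) (L : lattice) (d : nat).
Local Notation C := R[i].
Local Notation phase := (phase R L d).
Local Notation mode := (mode L d).
Variables (r : nat) (a : seq mode -> C) (B : R).
Hypothesis B0 : 0 <= B.
Hypothesis aB : forall js, (2 <= size js <= r)%N -> momentum js = 0 ->
  modulus (a js) <= B.

Local Notation pairH := (pairing a).
Local Notation hamH := (ham r a).
Local Notation dhamH := (dham r a).
Local Notation chH := (dham_const r B).

Lemma sum_pairing_le (F : nat -> seq mode -> C) (c : R) : 0 <= c ->
  (forall l, (2 <= l <= r)%N -> sumle (F l \o @zmval L d l) (l%:R * 2 * c)) ->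
  modulus (\sum_(2 <= l < r.+1) pairH l (F l)) <= chH * c.
Proof.
move=> c0 Fc; apply: le_trans (modulus_sum _ _ _) _.
rewrite /dham_const mulr_suml big_nat_cond [X in _ <= X]big_nat_cond.
apply: ler_sum => l /andP[lr _]; rewrite ltnS in lr.
by apply: le_trans (pairing_le B0 aB lr (Fc _ lr)) _; rewrite !mulrA.
Qed.

Lemma tpow_sumle_le z (A : R) l : 1 <= A -> sumle z A -> (l <= r)%N ->
  sumle (@tpow R L d z l) (A ^+ r).
Proof.
move=> A1 zA lr; have A0 : 0 <= A by lra.
by apply: sumle_weak (sumle_tpow l A0 zA); rewrite ler_weXn2l.
Qed.

Lemma one_le_l2 l (c : R) : (2 <= l)%N -> 0 <= c -> c <= l%:R * 2 * c.
Proof.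
move=> l2 c0; rewrite ler_peMl //.
have : 2 <= l%:R :> R by rewrite ler_nat.
lra.
Qed.

Lemma ham_le z A : 1 <= A -> sumle z A -> modulus (hamH z) <= chH * A ^+ r.
Proof.
move=> A1 zA; apply: sum_pairing_le => [|l /andP[l2 lr]].
  by rewrite exprn_ge0 //; lra.
apply: zm_sumle; apply: sumle_weak (tpow_sumle_le A1 zA lr).
by apply: one_le_l2; rewrite // exprn_ge0 //; lra.
Qed.

Lemma ham_lip z z' A e : 1 <= A -> sumle z A -> sumle z' A ->
  sumle (fun j => z j - z' j) e ->
  modulus (hamH z - hamH z') <= chH * (r%:R * A ^+ r * e).
Proof.
move=> A1 zA zA' ze; have e0 := sumle_ge0 ze.
have A0 : 0 <= A by lra.
have -> : hamH z - hamH z' =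
   \sum_(2 <= l < r.+1) pairH l (fun s => tpow z l s + (-1) * tpow z' l s).
  rewrite /ham -sumrB; apply: eq_big_nat => l lr; rewrite ltnS in lr.
  rewrite (pairing_lin B0 aB _ lr (zm_sumle (sumle_tpow l A0 zA))
     (zm_sumle (sumle_tpow l A0 zA'))).
  by rewrite mulN1r.
apply: sum_pairing_le => [|l /andP[l2 lr]]; first by rewrite !mulr_ge0 ?exprn_ge0.
apply: zm_sumle; apply: (sumle_eq (g := fun s => tpow z l s - tpow z' l s)).
  by move=> s; rewrite mulN1r.
apply: sumle_weak (tpow_lip l A1 zA zA' ze).
apply: le_trans (one_le_l2 l2 _); last by rewrite !mulr_ge0 ?exprn_ge0.
rewrite ler_wpM2r // ler_pM ?exprn_ge0 ?ler_nat //.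
by rewrite ler_weXn2l.
Qed.

Lemma ham_taylor z e A (u : C) : 1 <= A -> sumle z A ->
  sumle (fun j => z j + u * e j) A -> sumle e 1 ->
  modulus (hamH (fun j => z j + u * e j) - hamH z - u * dhamH (tpow z) e) <=
  chH * (r%:R ^+ 2 * A ^+ r * modulus u ^+ 2).
Proof.
move=> A1 zA zA' e1; have A0 : 0 <= A by lra.
set z' := fun j => _ in zA' *.
have eb j : modulus (e j) <= 1 := sumle_bnd j e1.
have -> : hamH z' - hamH z - u * dhamH (tpow z) e =
   \sum_(2 <= l < r.+1) pairH l (fun s => tpow z' l s - tpow z l s
      - u * dtpow l e z s).
  rewrite /ham /dham mulr_sumr -!sumrB; apply: eq_big_nat => l lr.
  rewrite ltnS in lr.
  have s1 := zm_sumle (l := l) (sumle_tpow l A0 zA').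
  have s2 := zm_sumle (l := l) (sumle_tpow l A0 zA).
  have s3 := ins_sumle (l := l) ler01 eb (sumle_tpow l.-1 A0 zA).
  have s12 := sumleD s1 (sumleZ (-1) s2).
  rewrite [RHS](_ : _ = pairH l (fun s => (tpow z' l s + (-1) * tpow z l s)
      + (- u) * dtpow l e z s)); last first.
    by apply: eq_pairing => js; ring.
  rewrite (pairing_lin B0 aB (- u) lr s12 s3) (pairing_lin B0 aB _ lr s1 s2).
  by rewrite mulN1r mulNr.
apply: sum_pairing_le => [|l /andP[l2 lr]].
  by rewrite !mulr_ge0 ?exprn_ge0 ?modulus_ge0.
apply: zm_sumle; apply: sumle_weak (tpow_taylor l A1 zA zA' e1).
apply: le_trans (one_le_l2 l2 _); last first.
  by rewrite !mulr_ge0 ?exprn_ge0 ?modulus_ge0.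
rewrite ler_wpM2r ?exprn_ge0 ?modulus_ge0 // ler_pM ?exprn_ge0 //.
  by rewrite lerXn2r ?nnegrE ?ler_nat.
by rewrite ler_weXn2l.
Qed.

End Hamiltonian.

(** * The symplectic form *)

Section Symplectic.
Variables (R : realType) (L : lattice) (d : nat).
Local Notation C := R[i].
Local Notation phase := (phase R L d).
Local Notation mode := (mode L d).
Implicit Types (f g w : mode -> C).

Definition stame (K : nat) (sg c : R) (f : nat -> C) :=
  forall k n, (k <= K)%N -> modulus (fdiff k f n) <= c * k`!%:R * sg ^+ k.

Lemma barK : involutive (@bar L d).
Proof. by case=> a b; rewrite /bar /= negbK. Qed.

Definition bterm f g : mode -> C := fun j => if j.2 then f (bar j) * g j else 0.

(** The Liouville one-form [p dq] of the Hamiltonian structure, with momenta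
    [i eta] and positions [xi]: its value at [f] on the tangent vector [g]. *)
Definition bform f g : C := 'i%C * csum (bterm f g).

Lemma ibar : injective (fun j : mode => (bar j, j)).
Proof. by move=> x y [_ _ ->]. Qed.

Lemma bterm_sumle f g a b : sumle f a -> sumle g b -> sumle (bterm f g) (a * b).
Proof.
move=> fa gb.
apply: sumle_le (sumle_prod ibar fa gb) => // j.
by rewrite /bterm; case: ifP => // _; rewrite modulus0 modulus_ge0.
Qed.

Lemma bform_le f g a b : sumle f a -> sumle g b -> modulus (bform f g) <= a * b.
Proof.
move=> fa gb; rewrite modulusM modulusi mul1r.
by apply: csum_le; apply: bterm_sumle.
Qed.

Lemma bformDl f f' g u a a' b : sumle f a -> sumle f' a' -> sumle g b ->
  bform (fun j => f j + u * f' j) g = bform f g + u * bform f' g.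
Proof.
move=> fa fa' gb; rewrite /bform mulrCA -mulrDr; congr (_ * _).
rewrite -(csumZ u (bterm_sumle fa' gb)).
rewrite -(csumD (bterm_sumle fa gb) (sumleZ u (bterm_sumle fa' gb))).
congr csum; apply/funext => j; rewrite /bterm; case: ifP => _; ring.
Qed.

Lemma bformDr f g g' u a b b' : sumle f a -> sumle g b -> sumle g' b' ->
  bform f (fun j => g j + u * g' j) = bform f g + u * bform f g'.
Proof.
move=> fa gb gb'; rewrite /bform mulrCA -mulrDr; congr (_ * _).
rewrite -(csumZ u (bterm_sumle fa gb')).
rewrite -(csumD (bterm_sumle fa gb) (sumleZ u (bterm_sumle fa gb'))).
congr csum; apply/funext => j; rewrite /bterm; case: ifP => _; ring.
Qed.

Lemma bformBl f f' g a a' b : sumle f a -> sumle f' a' -> sumle g b ->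
  bform (fun j => f j - f' j) g = bform f g - bform f' g.
Proof.
move=> fa fa' gb; rewrite -mulN1r -(bformDl (-1) fa fa' gb); congr bform.
by apply/funext => j; rewrite mulN1r.
Qed.

Lemma bformBr f g g' a b b' : sumle f a -> sumle g b -> sumle g' b' ->
  bform f (fun j => g j - g' j) = bform f g - bform f g'.
Proof.
move=> fa gb gb'; rewrite -mulN1r -(bformDr (-1) fa gb gb'); congr bform.
by apply/funext => j; rewrite mulN1r.
Qed.

Section Sequences.
Variables (K : nat) (sg : R).
Hypothesis sg0 : 0 <= sg.
Variables (f g : nat -> mode -> C) (a b : R).
Hypotheses (fa : tame K sg a f) (gb : tame K sg b g).

Let bnd n : sumle (bterm (f n) (g n)) (a * b).
Proof. exact: bterm_sumle (tame_bnd n fa) (tame_bnd n gb). Qed.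

Lemma stame_bform : stame K sg (K.+1%:R * a * b) (fun n => bform (f n) (g n)).
Proof.
move=> k n kK; rewrite [X in modulus X](fdiffZ k 'i%C (fun n => csum (bterm (f n) (g n)))) modulusM modulusi mul1r (@csum_fdiff R _ (fun n => bterm (f n) (g n)) _ k n bnd).
apply: csum_le; apply: sumle_le (tame_prod sg0 ibar fa gb n kK) => // j.
rewrite /bterm; case: (j.2) => //; case: k {kK} => [|k].
  by rewrite modulus0 modulus_ge0.
by rewrite fdiff_cst modulus0 modulus_ge0.
Qed.

Lemma dlog_bform N n : (N <= K)%N ->
  modulus (dlog N (fun n => bform (f n) (g n)) n
    - (bform (dlogv N f n) (g n) + bform (f n) (dlogv N g n)))
  <= a * b * (N.+1)`!%:R * sg ^+ N.+1.
Proof.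
move=> NK.
have fn := tame_bnd n fa; have gn := tame_bnd n gb.
have Df := sumle_dlog N n (fun m => tame_bnd m fa).
have Dg := sumle_dlog N n (fun m => tame_bnd m gb).
have s1 := bterm_sumle Df gn; have s2 := bterm_sumle fn Dg.
have s0 := @sumle_dlog R _ (fun n => bterm (f n) (g n)) _ N n bnd.
rewrite [X in X - _](dlogZ 'i%C (fun n => csum (bterm (f n) (g n)))) (@csum_dlog R _ (fun n => bterm (f n) (g n)) _ N n bnd) /bform -mulrDr -mulrBr.
rewrite modulusM modulusi mul1r.
rewrite -(csumD s1 s2) -(csumB s0 (sumleD s1 s2)).
apply: csum_le; apply: sumle_le (dlog_defect sg0 n NK ibar fa gb) => // j.
rewrite /bterm /dlogv; case: (j.2) => //.
by rewrite dlog_cst addr0 subr0 modulus0 modulus_ge0.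
Qed.

End Sequences.
End Symplectic.

(** * The Hamiltonian vector field *)

Section HamiltonianField.
Variables (R : realType) (L : lattice) (d : nat).
Local Notation C := R[i].
Local Notation phase := (phase R L d).
Local Notation mode := (mode L d).
Variables (r : nat) (a : seq mode -> C) (B : R).
Hypothesis B0 : 0 <= B.
Hypothesis aB : forall js, (2 <= size js <= r)%N -> momentum js = 0 ->
  modulus (a js) <= B.
Implicit Types (Q : nat -> seq mode -> C) (w : mode -> C).

Lemma poly_eval_ham z : poly_eval r a z = ham r a z.
Proof.
rewrite /poly_eval /ham; apply: eq_bigr => l _; congr csum.
apply/funext => js; rewrite -[tval (val js)]/(zmval js).
by rewrite -tpow_monomial size_zmval.
Qed.

Lemma partial_ham (P : phase -> C) z A (j : mode) :
  (forall z, in_l1 z -> P z = poly_eval r a z) -> sumle z A ->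
  partial P j z = dham r a (tpow z) (delta R j).
Proof.
move=> PE zA; have A0 := sumle_ge0 zA.
have e1 := @delta_sumle R L d j.
have shift (u : C) : (fun k => if k == j then z k + u else z k) =
    (fun k => z k + u * delta R j k).
  apply/funext => k; rewrite /delta; case: (k == j).
    by rewrite mulr1.
  by rewrite mulr0 addr0.
have zu (u : C) : modulus u <= 1 ->
    sumle (fun k => z k + u * delta R j k) (A + 1).
  move=> u1; apply: sumle_weak (sumleD zA (sumleZ u e1)).
  by rewrite lerD2l mulr1.
have zA1 : sumle z (A + 1) by apply: sumle_weak zA; lra.
have A1 : 1 <= A + 1 by lra.
pose k0 := dham_const r B * (r%:R ^+ 2 * (A + 1) ^+ r) + 1.
have k0p : 0 < k0.
  have : 0 <= dham_const r B * (r%:R ^+ 2 * (A + 1) ^+ r).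
    by rewrite !mulr_ge0 ?dham_const_ge0 ?exprn_ge0 //; lra.
  by rewrite /k0; lra.
pose CF : numFieldType := R[i].
have FF := Proper_dnbhs_regular_numFieldType (0 : C^o).
rewrite /partial /derive1.
apply: (@norm_cvg_lim _ R[i]^o).
apply/(@cvgrPdist_le _ R[i]^o) => /= e; rewrite ltcE /= => /andP[/eqP e1' e2].
have dp : (0 : C) < (Num.min 1 (complex.Re e / k0))%:C%C.
  by rewrite ltcR lt_min ltr01 divr_gt0.
near=> u.
have u0 : u != 0 by near: u; exact: (@nbhs_dnbhs_neq CF (0 : CF)).
have ud : `|u| <= (Num.min 1 (complex.Re e / k0))%:C%C.
  by near: u; exact: (@dnbhs0_le CF CF _ dp).
move: ud; rewrite -modulusE lecR le_min => /andP[u1 ue].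
rewrite -modulusE lecE /= e1' eqxx /=.
rewrite !addr0 !shift.
have PEz (x : C) : modulus x <= 1 -> P (fun k => z k + x * delta R j k) =
    ham r a (fun k => z k + x * delta R j k).
  by move=> x1; rewrite PE ?poly_eval_ham //; apply/in_l1P; exists (A + 1); apply: zu.
rewrite (PEz u u1) (PEz 0) ?modulus0 //.
rewrite (_ : (fun k => z k + 0 * _) = z); last first.
  by apply/funext => k; rewrite mul0r addr0.
have um : 0 < modulus u.
  by rewrite lt_def modulus_ge0 andbT; apply: contraNneq u0 => /modulus_eq0 ->.
have := ham_taylor B0 aB A1 zA1 (zu u u1) e1.
set H1 := ham _ _ _; set H0 := ham _ _ z; set D := dham _ _ _ _ => hT.
rewrite modulusBC (_ : _ - D = u^-1 * (H1 - H0 - u * D)); last first.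
  by rewrite -[_ *: _]/(_ * _); field.
rewrite modulusM modulusV mulrC ler_pdivrMr //.
apply: le_trans hT _.
rewrite (_ : dham_const r B * _ = (k0 - 1) * modulus u * modulus u); last first.
  by rewrite /k0; ring.
rewrite ler_wpM2r ?modulus_ge0 //.
move: ue; rewrite ler_pdivlMr // => ue.
have := modulus_ge0 u; nra.
Unshelve. all: by end_near.
Qed.

End HamiltonianField.

Section HamiltonianField2.
Variables (R : realType) (L : lattice) (d : nat).
Local Notation C := R[i].
Local Notation phase := (phase R L d).
Local Notation mode := (mode L d).
Variables (r : nat) (a : seq mode -> C) (B : R).
Hypothesis B0 : 0 <= B.
Hypothesis aB : forall js, (2 <= size js <= r)%N -> momentum js = 0 ->
  modulus (a js) <= B.
Implicit Types (Q : nat -> seq mode -> C) (w : mode -> C).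

Definition jsign (j : mode) : C := if j.2 then - 'i%C else 'i%C.

Lemma jsign_modulus j : modulus (jsign j) = 1.
Proof. by rewrite /jsign; case: ifP; rewrite ?modulusN modulusi. Qed.

(** The Hamiltonian vector field of [ham], with the same convention on [Q] as
    for [dham]. *)
Definition hfield Q : phase :=
  fun j => jsign j * dham r a Q (delta R (bar j)).

Lemma vector_field_ham (P : phase -> C) z A :
  (forall z, in_l1 z -> P z = poly_eval r a z) -> sumle z A ->
  vector_field P z = hfield (tpow z).
Proof.
move=> PE zA; apply/funext => j; rewrite /vector_field /hfield /jsign.
by rewrite (partial_ham B0 aB (bar j) PE zA); case: (j.2).
Qed.

Lemma hfield_sumle Q c : (forall l, (l < r)%N -> sumle (Q l) c) ->
  sumle (hfield Q) (dham_const r B * c).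
Proof.
move=> Qc; apply: sumle_le (sumle_image (inv_inj (@barK L d))
  (gradient_sumle B0 aB Qc)) => // j.
by rewrite /hfield modulusM jsign_modulus mul1r.
Qed.

Lemma dhamBl Q Q' c c' b w : 0 <= b -> (forall j, modulus (w j) <= b) ->
  (forall l, (l < r)%N -> sumle (Q l) c) ->
  (forall l, (l < r)%N -> sumle (Q' l) c') ->
  dham r a (fun l s => Q l s - Q' l s) w = dham r a Q w - dham r a Q' w.
Proof.
move=> b0 wb Qc Qc'; rewrite -mulN1r -(dham_linl B0 aB (-1) b0 wb Qc Qc').
congr (dham r a _ w); apply/funext => l; apply/funext => s; by rewrite mulN1r.
Qed.

Lemma dham_fdiff (Q : nat -> nat -> seq mode -> C) c b w k n : 0 <= b ->
  (forall j, modulus (w j) <= b) ->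
  (forall n l, (l < r)%N -> sumle (Q n l) c) ->
  fdiff k (fun n => dham r a (Q n) w) n =
  dham r a (fun l s => fdiff k (fun n => Q n l s) n) w.
Proof.
move=> b0 wb Qc; elim: k n => [//|k IH] n.
have h m l (lr : (l < r)%N) : sumle (fun s => fdiff k (fun n => Q n l s) m)
    (2 ^+ k * c).
  by apply: (sumle_fdiff (f := fun n => Q n l)) => p; apply: Qc.
by rewrite fdiffS !IH -(dhamBl b0 wb (h n.+1) (h n)).
Qed.

Lemma hfieldB Q Q' c c' j :
  (forall l, (l < r)%N -> sumle (Q l) c) ->
  (forall l, (l < r)%N -> sumle (Q' l) c') ->
  hfield Q j - hfield Q' j = hfield (fun l s => Q l s - Q' l s) j.
Proof.
move=> Qc Qc'; rewrite /hfield -mulrBr.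
by rewrite (dhamBl ler01 (delta_le R (bar j)) Qc Qc').
Qed.

Lemma hfield_lip z z' A e : 1 <= A -> sumle z A -> sumle z' A ->
  sumle (fun j => z j - z' j) e ->
  sumle (fun j => hfield (tpow z) j - hfield (tpow z') j)
    (dham_const r B * (r%:R * A ^+ r * e)).
Proof.
move=> A1 zA zA' ze; have A0 : 0 <= A by lra.
have e0 := sumle_ge0 ze.
have s1 l (lr : (l < r)%N) := tpow_sumle_le A1 zA (ltnW lr).
have s2 l (lr : (l < r)%N) := tpow_sumle_le A1 zA' (ltnW lr).
apply: (sumle_eq (fun j => hfieldB j s1 s2)).
apply: hfield_sumle => l lr; apply: sumle_weak (tpow_lip l A1 zA zA' ze).
rewrite ler_wpM2r // ler_pM ?exprn_ge0 ?ler_nat 1?ltnW //.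
by rewrite ler_weXn2l // ltnW.
Qed.

(** Hamilton's equations: contracting the symplectic form with the vector field
    gives minus the differential. *)
Lemma bform_hfield Q w b c : sumle w b ->
  (forall l, (l < r)%N -> sumle (Q l) c) ->
  bform (hfield Q) w - bform w (hfield Q) = - dham r a Q w.
Proof.
move=> wb Qc.
have Xc := hfield_sumle Qc.
pose D j := dham r a Q (delta R j).
have Dc : sumle D (dham_const r B * c) := gradient_sumle B0 aB Qc.
have D1 j : modulus (w j) <= b := sumle_bnd j wb.
have b0 := sumle_ge0 wb.
have wD : sumle (fun j => w j * D j) (b * (dham_const r B * c)).
  exact: sumleM.
pose p1 (j : mode) := if j.2 then w j * D j else 0.
pose p2 (j : mode) := if j.2 then 0 else w j * D j.
have h1 : sumle p1 (b * (dham_const r B * c)).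
  apply: sumle_le wD => // j; rewrite /p1; case: ifP => // _.
  by rewrite modulus0 modulus_ge0.
have h2 : sumle p2 (b * (dham_const r B * c)).
  apply: sumle_le wD => // j; rewrite /p2; case: ifP => // _.
  by rewrite modulus0 modulus_ge0.
have -> : dham r a Q w = csum p1 + csum p2.
  rewrite -(has_sum_csum (dham_csum B0 aB wb Qc)) -(csumD h1 h2).
  congr csum; apply/funext => j; rewrite /p1 /p2.
  by case: ifP => _; rewrite ?addr0 ?add0r.
have ii : 'i%C * 'i%C = -1 :> C by rewrite -expr2 sqr_i.
have -> : bform (hfield Q) w = - csum p1.
  rewrite /bform -(csumZ _ (bterm_sumle Xc wb)) -mulN1r -(csumZ _ h1).
  congr csum; apply/funext => j; rewrite /bterm /p1 /hfield.
  case: j => x [] /=; rewrite ?mulr0 // /jsign /= !mulrA ii.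
  by rewrite (barK (x, true)) mulrAC.
suff -> : bform w (hfield Q) = csum p2 by rewrite opprD.
rewrite -(csum_reindex (@barK L d) (@barK L d) h2).
rewrite /bform -(csumZ _ (bterm_sumle wb Xc)).
congr csum; apply/funext => j; rewrite /bterm /p2 /hfield /=.
case: j => x [] /=; rewrite ?mulr0 // /jsign /=.
by rewrite mulrCA; congr (_ * _); rewrite mulrA mulrN ii opprK mul1r.
Qed.

Section Sequences.
Variables (K : nat) (sg A : R) (v : nat -> phase).
Hypotheses (sg0 : 0 <= sg) (A1 : 1 <= A) (vA : tame K sg A v).
Local Notation G := (tensor_const K A).

Let Gr k n l : (k <= K)%N -> (l <= r)%N ->
  sumle (fun s => fdiff k (fun n => tpow (v n) l s) n)
    (G ^+ r * (k`!%:R * sg ^+ k)).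
Proof.
move=> kK lr; apply: sumle_weak (tame_tpow sg0 vA l n kK).
rewrite -mulrA ler_wpM2r ?mulr_ge0 ?exprn_ge0 //.
by rewrite ler_weXn2l // tensor_const_ge1.
Qed.

Let bndT n l (lr : (l < r)%N) : sumle (tpow (v n) l) (G ^+ r).
Proof.
by have := Gr n (leq0n K) (ltnW lr); rewrite fact0 expr0 !mulr1.
Qed.

Lemma tame_hfield : tame K sg (dham_const r B * G ^+ r) (fun n => hfield (tpow (v n))).
Proof.
move=> k n kK.
apply: (sumle_eq (g := hfield (fun l s => fdiff k (fun n => tpow (v n) l s) n))).
  move=> j; rewrite /hfield fdiffZ; congr (_ * _).
  exact: (dham_fdiff k n ler01 (delta_le R (bar j)) bndT).
rewrite -!mulrA; apply: hfield_sumle => l lr.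
by apply: Gr => //; apply: ltnW.
Qed.

Let bndH l n (lr : (2 <= l <= r)%N) :
  sumle (fun js : zero_momentum L d l => a (zmval js) * tpow (v n) l (zmval js))
   (B * G ^+ l).
Proof. by apply: (pairing_sumle B0 aB lr); apply/zm_sumle/(tpow_bnd sg0 vA). Qed.

Lemma stame_ham : stame K sg (dham_const r B * G ^+ r) (fun n => ham r a (v n)).
Proof.
move=> k n kK; rewrite fdiff_sum -!mulrA.
rewrite (_ : \sum_(2 <= l < r.+1) _ = \sum_(2 <= l < r.+1)
   pairing a l (fun s => fdiff k (fun n => tpow (v n) l s) n)).
  apply: (sum_pairing_le B0 aB) => [|l /andP[l2 lr]].
    by rewrite !mulr_ge0 ?exprn_ge0 // (le_trans ler01) ?tensor_const_ge1.
  apply: zm_sumle; apply: sumle_weak (Gr n kK lr).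
  apply: one_le_l2 => //.
  by rewrite !mulr_ge0 ?exprn_ge0 // (le_trans ler01) ?tensor_const_ge1.
apply: eq_big_nat => l lr; rewrite ltnS in lr.
rewrite /pairing (@csum_fdiff R _ (fun n js => a (zmval js) *
   tpow (v n) l (zmval js)) _ k n (fun n => bndH n lr)).
by congr csum; apply/funext => js; rewrite fdiffZ.
Qed.

Lemma dlog_ham N n : (N <= K)%N ->
  modulus (dlog N (fun n => ham r a (v n)) n
     - dham r a (tpow (v n)) (dlogv N v n))
  <= dham_const r B * (G ^+ r * ((N.+1)`!%:R * sg ^+ N.+1)).
Proof.
move=> NK.
have Dv := sumle_dlog N n (fun m => tame_bnd m vA).
have Dv0 := sumle_ge0 Dv.
rewrite dlog_sum /dham -sumrB.
rewrite (_ : \sum_(2 <= l < r.+1) _ = \sum_(2 <= l < r.+1)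
   pairing a l (fun s => dlog N (fun n => tpow (v n) l s) n
     - dtpow l (dlogv N v n) (v n) s)).
  apply: (sum_pairing_le B0 aB) => [|l /andP[l2 lr]].
    by rewrite !mulr_ge0 ?exprn_ge0 // (le_trans ler01) ?tensor_const_ge1.
  apply: zm_sumle; apply: sumle_weak (dlogv_tpow sg0 A1 vA l n NK).
  have G1 : 1 <= G by rewrite tensor_const_ge1.
  rewrite -!mulrA ler_wpM2l // !mulrA ler_wpM2r ?exprn_ge0 // ler_wpM2r //.
  rewrite -[X in X <= _]mul1r ler_pM ?exprn_ge0 //; [lra| |].
    by rewrite ler1n.
  by rewrite ler_weXn2l.
apply: eq_big_nat => l lr; rewrite ltnS in lr.
have lr' : (l.-1 < r)%N by lia.
have s1 := @sumle_dlog R _ (fun n s => tpow (v n) l s) _ N n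
   (fun n => tpow_bnd sg0 vA l n).
have s2 := ins_sumle (l := l) Dv0 (fun j => sumle_bnd j Dv) (bndT n lr').
have := pairing_lin B0 aB (-1) lr (zm_sumle (l := l) s1) s2.
rewrite mulN1r => e; rewrite [RHS](_ : _ = pairing a l (fun s =>
  dlog N (fun n => tpow (v n) l s) n + (-1) * dtpow l (dlogv N v n) (v n) s)).
  rewrite e; congr (_ - _).
  rewrite /pairing (@csum_dlog R _ (fun n js => a (zmval js) *
     tpow (v n) l (zmval js)) _ N n (fun n => bndH n lr)).
  by congr csum; apply/funext => js; rewrite dlogZ.
by apply: eq_pairing => js; rewrite mulN1r.
Qed.

End Sequences.

Section Conjugation.
Hypothesis aC : forall js, (2 <= size js <= r)%N -> momentum js = 0 ->
  a (map bar js) = (a js)^*%C.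

(** The real phases are the fixed points of this involution. *)
Definition cbar (z : mode -> C) : mode -> C := fun j => (z (bar j))^*%C.

Definition cbars (F : seq mode -> C) : seq mode -> C :=
  fun s => (F (map bar s))^*%C.

Lemma conjM (x y : C) : conjc (x * y) = conjc x * conjc y.
Proof. exact: rmorphM. Qed.

Lemma tpow_cbar z l s : tpow (cbar z) l s = cbars (tpow z l) s.
Proof.
elim: l s => [|l IH] s.
  have -> : cbars (tpow z 0) s = ((map bar s == [::])%:R^*)%C by [].
  by rewrite (rmorph_nat (@conjc R)); case: s.
rewrite /cbars !tpowS; case: s => [|j s] /=.
  exact/esym/(rmorph0 (@conjc R)).
by rewrite IH /cbars conjM.
Qed.

Lemma ins_cbar l w F s : ins l (cbar w) (cbars F) s = cbars (ins l w F) s.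
Proof.
rewrite /cbars /ins (rmorph_sum (@conjc R)); apply: eq_bigr => i _.
rewrite /ins1 -map_drop; case: (drop i s) => [|j t] /=.
  exact/esym/(rmorph0 (@conjc R)).
by rewrite conjM map_cat map_take.
Qed.

Lemma momentum_bar (s : seq mode) : momentum (map bar s) = - momentum s.
Proof.
rewrite /momentum big_map -sumrN; apply: eq_bigr => j _.
by case: j => x [] /=; rewrite ?opprK.
Qed.

Lemma zmbar_proof l (js : zero_momentum L d l) :
  momentum (map_tuple bar (val js)) == 0.
Proof. by rewrite momentum_bar momentum_zmval oppr0. Qed.

Definition zmbar l (js : zero_momentum L d l) : zero_momentum L d l :=
  exist (fun js : l.-tuple mode => is_true (momentum js == 0)) _
    (zmbar_proof js).

Lemma zmbarK l : involutive (@zmbar l).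
Proof.
move=> js; apply: zmval_inj; rewrite /zmval /= -map_comp map_id_in // => j _.
exact: barK.
Qed.

Lemma pairing_cbar l F c : (2 <= l <= r)%N -> sumle (F \o @zmval L d l) c ->
  pairing a l (cbars F) = (pairing a l F)^*%C.
Proof.
move=> lr Fc; have s := pairing_sumle B0 aB lr Fc.
rewrite /pairing -(csum_conj s).
have sc : sumle (fun js : zero_momentum L d l =>
   ((a (zmval js) * F (zmval js))^*)%C) (B * c).
  by apply: sumle_le s => // js; rewrite modulus_conj.
rewrite -(csum_reindex (@zmbarK l) (@zmbarK l) sc).
congr csum; apply/funext => js /=.
rewrite -[zmval (zmbar js)]/(map bar (zmval js)) conjM; congr (_ * _).
by rewrite aC ?size_zmval ?momentum_zmval // conjcK.
Qed.

Lemma dham_cbar Q w b c : 0 <= b -> (forall j, modulus (w j) <= b) ->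
  (forall l, (l < r)%N -> sumle (Q l) c) ->
  dham r a (fun l => cbars (Q l)) (cbar w) = (dham r a Q w)^*%C.
Proof.
move=> b0 wb Qc; rewrite /dham.
transitivity (\sum_(2 <= l < r.+1) conjc (pairing a l (ins l w (Q l.-1))));
  last by rewrite (rmorph_sum (@conjc R)).
apply: eq_big_nat => l lr; rewrite ltnS in lr.
have lr' : (l.-1 < r)%N by lia.
rewrite -(pairing_cbar lr (ins_sumle b0 wb (Qc _ lr'))).
by apply: eq_pairing => js; rewrite ins_cbar.
Qed.

Lemma hfield_cbar z A : 1 <= A -> sumle z A ->
  hfield (tpow (cbar z)) = cbar (hfield (tpow z)).
Proof.
move=> A1 zA; apply/funext => j.
have zl l (lr : (l < r)%N) := tpow_sumle_le A1 zA (ltnW lr).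
rewrite /hfield /cbar conjM barK -(dham_cbar ler01 (delta_le R j) zl).
congr (_ * _); first by case: j => x []; rewrite /jsign /=; simpc.
have -> : tpow (cbar z) = (fun l => cbars (tpow z l)).
  by apply/funext => l; apply/funext => s; rewrite tpow_cbar.
have -> // : delta R (bar j) = cbar (delta R j).
apply/funext => k; rewrite /cbar /delta (inv_eq (@barK L d)).
by rewrite (rmorph_nat (@conjc R)).
Qed.

End Conjugation.
End HamiltonianField2.

(** * Differential calculus in l^1 *)

Section Calculus.
Variable R : realType.
Local Notation C := R[i].

(** Induction along an interval: the greatest time up to which [Q] holds can be
    neither missed nor passed. *)
Lemma real_induction (h : R) (Q : R -> Prop) : 0 <= h -> Q 0 ->
  (forall t, 0 <= t < h -> (forall s, 0 <= s <= t -> Q s) ->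
     exists2 e, 0 < e & forall s, t < s <= t + e -> s <= h -> Q s) ->
  (forall t, 0 < t <= h -> (forall s, 0 <= s < t -> Q s) -> Q t) ->
  forall t, 0 <= t <= h -> Q t.
Proof.
move=> h0 Q0 Qstep Qlim.
pose E := [set t | 0 <= t <= h /\ forall s, 0 <= s <= t -> Q s].
have E0 : E 0.
  split; first by rewrite lexx.
  by move=> s s0; have -> : s = 0 by lra.
have supE : has_sup E by split; [exists 0 | exists h => t [/andP[]]].
have m0 : 0 <= sup E by apply: ub_le_sup; [case: supE|].
have mh : sup E <= h.
  by apply: ge_sup; [exists 0|move=> t [/andP[]]].
have Qlt s : 0 <= s < sup E -> Q s.
  move=> /andP[s0 sm]; have e0 : 0 < sup E - s by lra.
  have [t [t1 t2] st] := sup_adherent e0 supE.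
  by apply: t2; rewrite s0 /=; lra.
have Qm : Q (sup E).
  have [->//|m1] := eqVneq (sup E) 0.
  by apply: Qlim => //; rewrite mh andbT lt_def m1.
have Qle s : 0 <= s <= sup E -> Q s.
  move=> /andP[s0]; rewrite le_eqVlt => /orP[/eqP -> //|sm].
  by apply: Qlt; rewrite s0.
have [mh'|] := ltP (sup E) h; last first.
  by move=> hm t /andP[t0 th]; apply: Qle; rewrite t0 /=; lra.
have [|e e0 He] := Qstep (sup E) _ Qle; first by rewrite m0.
pose m' := Num.min (sup E + e) h.
have mm' : sup E < m' by rewrite lt_min mh' andbT; lra.
suff : E m' by move=> /(ub_le_sup (proj2 supE)); lra.
split; first by rewrite ge_min lexx orbT andbT; lra.
move=> s /andP[s0 sm']; have [sm|sm] := leP s (sup E).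
  by apply: Qle; rewrite s0.
by move: sm'; rewrite le_min => /andP[s1 s2]; apply: He; rewrite ?sm.
Qed.

(** Differentiability on [[0, h]], one-sided at the end points: for real
    functions, and in the l^1 norm for families. *)
Definition derR (h : R) (f g : R -> R) :=
  forall t, 0 <= t <= h -> forall e, 0 < e -> exists2 rad, 0 < rad &
    forall s, `|s| <= rad -> 0 <= t + s <= h ->
      `|f (t + s) - f t - s * g t| <= e * `|s|.

Definition derI (I : eqType) (h : R) (u g : R -> I -> C) :=
  forall t, 0 <= t <= h -> forall e, 0 < e -> exists2 rad, 0 < rad &
    forall s, `|s| <= rad -> 0 <= t + s <= h ->
      sumle (fun j => u (t + s) j - u t j - s%:C%C * g t j) (e * `|s|).

Lemma derR_mvt h f g c x y : derR h f g ->
  (forall t, 0 <= t <= h -> `|g t| <= c) -> 0 <= x <= y -> y <= h ->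
  `|f y - f x| <= c * (y - x).
Proof.
move=> fg gc /andP[x0 xy] yh.
apply/ler_addgt0Pr => e0 e0p.
have [exy|xy'] := eqVneq x y; first by rewrite exy !subrr normr0 mulr0 add0r ltW.
have yx : 0 < y - x by rewrite subr_gt0 lt_def eq_sym xy'.
pose e := e0 / (y - x); have ep : 0 < e by rewrite divr_gt0.
have c0 : 0 <= c by apply: le_trans (gc x _); rewrite ?normr_ge0 ?x0 //=; lra.
suff H : forall t, 0 <= t <= y - x -> `|f (x + t) - f x| <= (c + e) * t.
  have := H (y - x); rewrite lexx (ltW yx) => /(_ isT).
  rewrite (_ : x + (y - x) = y); last by ring.
  by rewrite mulrDl [e * _]divfK // gt_eqF.
apply: real_induction; first exact: ltW.
- by rewrite addr0 subrr normr0 mulr0.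
- move=> t /andP[t0 ty] Ht.
  have tx : 0 <= x + t <= h by apply/andP; split; lra.
  have [rad rad0 Hd] := fg _ tx _ ep.
  exists rad => // s /andP[ts sd] sy.
  have h1 : `|f (x + t) - f x| <= (c + e) * t by apply: Ht; rewrite t0 lexx.
  have d1 : `|s - t| <= rad by rewrite ger0_norm; lra.
  have d2 : 0 <= x + t + (s - t) <= h by apply/andP; split; lra.
  have h2 := Hd (s - t) d1 d2.
  have gt := gc _ tx.
  have st : 0 <= s - t by lra.
  move: h2; rewrite (_ : x + t + (s - t) = x + s); last by ring.
  rewrite (ger0_norm st) => h2.
  have -> : f (x + s) - f x = (f (x + s) - f (x + t) - (s - t) * g (x + t))
     + (s - t) * g (x + t) + (f (x + t) - f x) by ring.
  rewrite (le_trans (ler_normD _ _)) //.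
  have := ler_normD (f (x + s) - f (x + t) - (s - t) * g (x + t))
     ((s - t) * g (x + t)).
  have := ler_wpM2l st gt.
  rewrite normrM (ger0_norm st); lra.
- move=> t /andP[t0 ty] Ht.
  have tx : 0 <= x + t <= h by apply/andP; split; lra.
  apply/ler_addgt0Pr => k k0.
  have [rad rad0 Hd] := fg _ tx _ ep.
  pose s := Num.min (Num.min rad t) (k / (c + e)).
  have ce : 0 < c + e by lra.
  have s0 : 0 < s by rewrite !lt_min rad0 t0 divr_gt0.
  have [sd [st sk]] : s <= rad /\ s <= t /\ s <= k / (c + e).
    by rewrite /s !ge_min !lexx !orbT.
  have d1 : `|- s| <= rad by rewrite normrN ger0_norm; lra.
  have d2 : 0 <= x + t - s <= h by apply/andP; split; lra.
  have h2 := Hd (- s) d1 d2.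
  have h1 : `|f (x + (t - s)) - f x| <= (c + e) * (t - s).
    by apply: Ht; apply/andP; split; lra.
  move: h2; rewrite normrN (ger0_norm (ltW s0)).
  rewrite (_ : x + t - s = x + (t - s)); last by ring.
  move=> h2; have gt := gc _ tx.
  have -> : f (x + t) - f x = - (f (x + (t - s)) - f (x + t) - - s * g (x + t))
     + s * g (x + t) + (f (x + (t - s)) - f x) by ring.
  rewrite (le_trans (ler_normD _ _)) //.
  have := ler_normD (- (f (x + (t - s)) - f (x + t) - - s * g (x + t)))
     (s * g (x + t)).
  have := ler_wpM2l (ltW s0) gt.
  have : (c + e) * s <= k by rewrite mulrC -ler_pdivlMr.
  rewrite normrN normrM (ger0_norm (ltW s0)); lra.
Qed.

Section Families.
Variable I : eqType.
Implicit Types (u g w : R -> I -> C).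

Lemma derI_Re h u g (s : seq I) (c : I -> C) : derI h u g -> uniq s ->
  (forall j, modulus (c j) <= 1) ->
  derR h (fun t => complex.Re (\sum_(j <- s) c j * u t j))
         (fun t => complex.Re (\sum_(j <- s) c j * g t j)).
Proof.
move=> ug us c1 t th e e0; have [rad rad0 H] := ug t th e e0.
exists rad => // x xd xh; apply: le_trans (H x xd xh s us).
rewrite (_ : _ - _ = complex.Re (\sum_(j <- s) c j *
   (u (t + x) j - u t j - x%:C%C * g t j))); last first.
  rewrite -complex_ReZ -!ReN -!ReD mulr_sumr -!sumrB; congr complex.Re.
  by apply: eq_bigr => j _; ring.
apply: le_trans (ler_Re_modulus _) _; apply: le_trans (modulus_sum _ _ _) _.
apply: ler_sum => j _.
by rewrite modulusM ler_piMl ?modulus_ge0.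
Qed.

(** Reduced to the real case by testing the increment against unimodular
    coefficients on a finite set. *)
Lemma derI_mvt h u g c x y : derI h u g ->
  (forall t, 0 <= t <= h -> sumle (g t) c) -> 0 <= x <= y -> y <= h ->
  sumle (fun j => u y j - u x j) (c * (y - x)).
Proof.
move=> ug gc xy yh s us.
have [|th th1] := @choice _ _ (fun (j : I) (v : C) => modulus v = 1 /\
    (modulus (u y j - u x j))%:C%C = v * (u y j - u x j)).
  by move=> j; have [v v1 v2] := unimodular (u y j - u x j); exists v.
have t1 j : modulus (th j) <= 1 by rewrite (th1 j).1.
have -> : \sum_(j <- s) modulus (u y j - u x j) =
  complex.Re (\sum_(j <- s) th j * u y j) -
  complex.Re (\sum_(j <- s) th j * u x j).
  rewrite -ReN -ReD -sumrB Re_sum; apply: eq_bigr => j _.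
  by rewrite -mulrBr -(th1 j).2.
apply: le_trans (ler_norm _) _.
apply: (derR_mvt (derI_Re ug us t1)) => // t th0.
apply: le_trans (ler_Re_modulus _) _; apply: le_trans (modulus_sum _ _ _) _.
apply: le_trans (gc t th0 s us); apply: ler_sum => j _.
by rewrite modulusM (th1 j).1 mul1r.
Qed.

Lemma derI_lin h u u' g g' (k : C) : derI h u g -> derI h u' g' ->
  derI h (fun t j => u t j + k * u' t j) (fun t j => g t j + k * g' t j).
Proof.
move=> ug ug' t th e e0.
have k0 : 0 < modulus k + 1 by have := modulus_ge0 k; lra.
have e20 : 0 < e / 2 by rewrite divr_gt0.
have e2k : 0 < e / 2 / (modulus k + 1) by rewrite divr_gt0.
have [d1 d10 H1] := ug t th _ e20; have [d2 d20 H2] := ug' t th _ e2k.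
exists (Num.min d1 d2); first by rewrite lt_min d10.
move=> s; rewrite le_min => /andP[s1 s2] sh.
apply: (sumle_eq (g := fun j => (u (t + s) j - u t j - s%:C%C * g t j) +
   k * (u' (t + s) j - u' t j - s%:C%C * g' t j))).
  by move=> j; ring.
apply: sumle_weak (sumleD (H1 s s1 sh) (sumleZ k (H2 s s2 sh))).
have : modulus k * (e / 2 / (modulus k + 1)) <= e / 2.
  by rewrite mulrCA ger_pMr // ler_pdivrMr //; lra.
by have := normr_ge0 s; nra.
Qed.

Lemma derI_eq h u u' g g' : (forall t, u t =1 u' t) ->
  (forall t, 0 <= t <= h -> g t =1 g' t) -> derI h u g -> derI h u' g'.
Proof.
move=> uu gg ug t th e e0; have [rad rad0 H] := ug t th e e0.
exists rad => // s sd sh; apply: sumle_eq (H s sd sh) => j.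
by rewrite !uu gg.
Qed.

Lemma derI_fdiff h (u g : nat -> R -> I -> C) k n :
  (forall n, derI h (u n) (g n)) ->
  derI h (fun t j => fdiff k (fun n => u n t j) n)
         (fun t j => fdiff k (fun n => g n t j) n).
Proof.
move=> ug; elim: k n => [//|k IH] n.
by apply: derI_eq (derI_lin (-1) (IH n.+1) (IH n)) => [t j|t _ j];
  rewrite mulN1r.
Qed.

Lemma derI0 h : derI h (fun (_ : R) (_ : I) => 0) (fun _ _ => 0).
Proof.
move=> t th e e0; exists 1 => // s _ _.
apply: sumle_weak (sumle_eq _ (@sumle0 R I)) => [|j].
  by rewrite mulr_ge0 // ltW.
by rewrite mulr0 !subrr.
Qed.

Lemma derI_sum h (K : Type) (s : seq K) (c : K -> C) (u g : K -> R -> I -> C) :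
  (forall k, derI h (u k) (g k)) ->
  derI h (fun t j => \sum_(k <- s) c k * u k t j)
         (fun t j => \sum_(k <- s) c k * g k t j).
Proof.
move=> ug; elim: s => [|k s IH].
  by apply: derI_eq (@derI0 h) => [t j|t _ j]; rewrite big_nil.
apply: derI_eq (derI_lin (c k) IH (ug k)) => [t j|t _ j];
  by rewrite big_cons addrC.
Qed.

Lemma derI_dlogv h (u g : nat -> R -> I -> C) N n :
  (forall n, derI h (u n) (g n)) ->
  derI h (fun t => dlogv N (fun n => u n t) n)
         (fun t => dlogv N (fun n => g n t) n).
Proof. by move=> ug; apply: derI_sum => k; apply: derI_fdiff. Qed.

Lemma derI_shrink h h' u g : h' <= h -> derI h u g -> derI h' u g.
Proof.
move=> hh ug t /andP[t0 th] e e0.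
have [|rad rad0 H] := ug t _ e e0; first by rewrite t0 /=; lra.
by exists rad => // s sd /andP[s0 sh]; apply: H => //; rewrite s0 /=; lra.
Qed.

End Families.

Lemma derRB h f f' g g' : derR h f g -> derR h f' g' ->
  derR h (fun t => f t - f' t) (fun t => g t - g' t).
Proof.
move=> fg fg' t th e e0; have e20 : 0 < e / 2 by rewrite divr_gt0.
have [d1 d10 H1] := fg t th _ e20; have [d2 d20 H2] := fg' t th _ e20.
exists (Num.min d1 d2); first by rewrite lt_min d10.
move=> s; rewrite le_min => /andP[s1 s2] sh.
have h1 := H1 s s1 sh; have h2 := H2 s s2 sh.
rewrite (_ : _ - _ = (f (t + s) - f t - s * g t)
   - (f' (t + s) - f' t - s * g' t)); last by ring.
by rewrite (le_trans (ler_normB _ _)) //; lra.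
Qed.

Lemma derRZ h f g c : derR h f g -> derR h (fun t => c * f t) (fun t => c * g t).
Proof.
move=> fg t th e e0.
have c0 : 0 < `|c| + 1 by have := normr_ge0 c; lra.
have [rad rad0 H] := fg t th _ (divr_gt0 e0 c0).
exists rad => // s sd sh; have := H s sd sh.
rewrite (_ : _ - _ - s * (c * g t) = c * (f (t + s) - f t - s * g t));
  last by ring.
rewrite normrM => {}H; apply: le_trans (ler_wpM2l (normr_ge0 c) H) _.
rewrite mulrA ler_wpM2r // mulrCA ger_pMr // ler_pdivrMr //; lra.
Qed.

Lemma derR_eq h f f' g g' : f =1 f' -> (forall t, 0 <= t <= h -> g t = g' t) ->
  derR h f g -> derR h f' g'.
Proof.
move=> /funext -> gg fg t th e e0; have [rad rad0 H] := fg t th e e0.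
by exists rad => // s sd sh; rewrite -gg // H.
Qed.

Lemma derR_fdiff h (f g : nat -> R -> R) k n : (forall n, derR h (f n) (g n)) ->
  derR h (fun t => fdiff k (fun n => f n t) n) (fun t => fdiff k (fun n => g n t) n).
Proof.
move=> fg; elim: k n => [|k IH] n; first exact: fg.
exact: (derRB (IH n.+1) (IH n)).
Qed.

Lemma derR_dlog h (f g : nat -> R -> R) N n : (forall n, derR h (f n) (g n)) ->
  derR h (fun t => dlog N (fun n => f n t) n)
         (fun t => dlog N (fun n => g n t) n).
Proof.
move=> fg; rewrite /dlog.
have H k : derR h (fun t => - ((-1) ^+ k / k.+1%:R * fdiff k.+1 (fun n => f n t) n))
   (fun t => - ((-1) ^+ k / k.+1%:R * fdiff k.+1 (fun n => g n t) n)).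
  have := derRZ (- ((-1) ^+ k / k.+1%:R)) (derR_fdiff k.+1 n fg).
  by apply: derR_eq => [t|t _]; rewrite mulNr.
elim: N => [|N IH].
  move=> t th e e0; exists 1 => // s _ _.
  by rewrite !big_ord0 mulr0 !subrr normr0 mulr_ge0 // ltW.
by apply: derR_eq (derRB IH (H N)) => [t|t _]; rewrite big_ord_recr /= opprK.
Qed.

End Calculus.

Section Antiderivative.
Variable R : realType.

(** The function is extended by constants beyond the interval, so that the
    fundamental theorem of calculus also applies at the end points. *)
Lemma antiderivative (h k : R) (f : R -> R) : 0 <= h -> 0 <= k ->
  (forall x y, 0 <= x <= y -> y <= h -> `|f y - f x| <= k * (y - x)) ->
  exists2 G, G 0 = 0 & derR h G f.
Proof.
move=> h0 k0 lipf.
pose cl (t : R) := Num.max 0 (Num.min h t).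
pose g t := f (cl t).
have clE t : 0 <= t <= h -> cl t = t.
  by move=> /andP[t0 th]; rewrite /cl (min_idPr th) (max_idPr t0).
have cl_in t : 0 <= cl t <= h.
  by rewrite /cl le_max lexx ge_max h0 ge_min lexx.
have cl0 t : t <= 0 -> cl t = 0.
  by move=> t0; rewrite /cl; apply/max_idPl; rewrite ge_min t0 orbT.
have clh t : h <= t -> cl t = h.
  by move=> ht; rewrite /cl (min_idPl ht); apply/max_idPr.
have lipcl x y : x <= y -> 0 <= cl y - cl x <= y - x.
  move=> xy; have [x0|x0] := leP x 0; have [y0|y0] := leP y 0.
  - by rewrite !cl0 //; apply/andP; split; lra.
  - rewrite (cl0 _ x0); have [yh|yh] := leP h y.
      by rewrite (clh _ yh); apply/andP; split; lra.
    by rewrite clE; apply/andP; split; lra.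
  - lra.
  have [xh|xh] := leP h x; have [yh|yh] := leP h y.
  - by rewrite !clh //; apply/andP; split; lra.
  - lra.
  - by rewrite (clh _ yh) clE; apply/andP; split; lra.
  - by rewrite !clE; apply/andP; split; lra.
have lipg x y : x <= y -> `|g y - g x| <= k * (y - x).
  move=> xy; have /andP[c1 c2] := lipcl x y xy.
  have /andP[x0 xh] := cl_in x; have /andP[y0 yh] := cl_in y.
  apply: le_trans (lipf (cl x) (cl y) _ yh) _; first by rewrite x0 /=; lra.
  by rewrite ler_wpM2l.
have lipg' x y : `|g x - g y| <= k * `|x - y|.
  have [xy|/ltW xy] := leP x y.
    by rewrite distrC (distrC x y) (ger0_norm (_ : 0 <= y - x)) ?subr_ge0 // lipg.
  by rewrite (ger0_norm (_ : 0 <= x - y)) ?subr_ge0 // lipg.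
have cg : continuous g.
  move=> x; apply/cvgrPdist_le => e e0.
  have k1 : 0 < k + 1 by lra.
  near=> y; apply: le_trans (lipg' x y) _.
  have : `|x - y| <= e / (k + 1).
    near: y; have /cvgrPdist_le := @cvg_id _ (nbhs x); apply.
    by rewrite divr_gt0.
  rewrite ler_pdivlMr // mulrC; have := normr_ge0 (x - y); nra.
pose mu := @lebesgue_measure R.
have intg : mu.-integrable `[(-1 : R), h + 2] (EFin \o g).
  apply: continuous_compact_integrable; first exact: segment_compact.
  exact: continuous_subspaceT.
pose F x := (\int[mu]_(t in [set` `[(-1 : R), x]]) (g t))%R.
have dF x : 0 <= x <= h -> derivable F x 1 /\ derive1 F x = g x.
  move=> /andP[x0 xh].
  apply: (@continuous_FTC1_closed _ g (-1) x (h + 2)) => //; try lra.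
  exact: cg.
exists (fun x => F x - F 0); first by rewrite subrr.
move=> t th e e0; have [dFt Ft] := dF t th.
have : z^-1 *: (F (z + t) - F t) @[z --> 0^'] --> g t.
  rewrite -Ft /derive1; move: dFt; rewrite /derivable /=.
  set f1 := (fun _ : R => _ *: (F (_ *: _ + _) - _)).
  set f2 := (fun _ : R => _ *: (F (_ + _) - _)).
  suff -> : f1 = f2 by [].
  by apply/funext => z; rewrite /f1 /f2 [_%:A]mulr1.
move=> /cvgrPdist_le /(_ e e0) [/= rad rad0 H].
exists (rad / 2); first by rewrite divr_gt0.
move=> s sd sh.
have [->|s0] := eqVneq s 0.
  by rewrite addr0 !subrr mul0r subrr normr0 mulr0.
have sdl : ball_ Num.norm 0 rad s by rewrite /ball_ /= sub0r normrN; lra.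
have {H} := H s sdl s0.
rewrite {1}/g clE // (addrC s) -[_ *: _]/(_ * _) => H.
have sn : 0 < `|s| by rewrite normr_gt0.
rewrite (_ : _ - s * f t = - s * (f t - s^-1 * (F (t + s) - F t))); last by field.
by rewrite normrM normrN mulrC ler_wpM2r.
Unshelve. all: by end_near.
Qed.
End Antiderivative.

Section FlowCalculus.
Variables (R : realType) (L : lattice) (d : nat).
Local Notation C := R[i].
Local Notation phase := (phase R L d).
Local Notation mode := (mode L d).

Lemma derR_bform (h a b c e : R) (u w g f : R -> mode -> C) :
  derI h u g -> derI h w f ->
  (forall t, 0 <= t <= h -> sumle (u t) a) ->
  (forall t, 0 <= t <= h -> sumle (w t) b) ->
  (forall t, 0 <= t <= h -> sumle (g t) c) ->
  (forall t, 0 <= t <= h -> sumle (f t) e) ->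
  derR h (fun t => complex.Re (bform (u t) (w t)))
         (fun t => complex.Re (bform (g t) (w t) + bform (u t) (f t))).
Proof.
move=> ug wf ua wb gc fe t th k k0.
have a0 := sumle_ge0 (ua t th); have b0 := sumle_ge0 (wb t th).
have c0 := sumle_ge0 (gc t th); have e0 := sumle_ge0 (fe t th).
pose k1 := k / (2 * (a + b + c + 1)).
have s0 : 0 < 2 * (a + b + c + 1) by lra.
have k10 : 0 < k1 by rewrite divr_gt0.
have ce0 : 0 < 2 * (c * e + 1) by have := mulr_ge0 c0 e0; lra.
pose k2 := k / (2 * (c * e + 1)).
have k20 : 0 < k2 by rewrite divr_gt0.
have [d1 d10 H1] := ug t th _ k10; have [d2 d20 H2] := wf t th _ k10.
exists (Num.min (Num.min d1 d2) (Num.min 1 k2)).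
  by rewrite !lt_min d10 d20 k20 ltr01.
move=> s; rewrite !le_min => /andP[/andP[s1 s2] /andP[s3 s4]] sh.
have ru := H1 s s1 sh; have rw := H2 s s2 sh.
set Ru := fun j => _ in ru; set Rw := fun j => _ in rw.
have wd : sumle (fun j => w (t + s) j - w t j) (k1 * `|s| + `|s| * e).
  apply: (sumle_eq (g := fun j => Rw j + s%:C%C * f t j)) => [j|].
    by rewrite /Rw; ring.
  by apply: sumleD rw _; rewrite -modulusR; apply/sumleZ/fe.
have ewd : bform (u t) (fun j => w (t + s) j - w t j) =
   bform (u t) Rw + s%:C%C * bform (u t) (f t).
  rewrite -(bformDr _ (ua t th) rw (fe t th)); congr (bform (u t) _).
  by apply/funext => j; rewrite /Rw; ring.
have eud : bform (fun j => u (t + s) j - u t j) (w (t + s)) =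
   bform Ru (w (t + s)) + s%:C%C * bform (g t) (w (t + s)).
  rewrite -(bformDl _ ru (gc t th) (wb _ sh)).
  rewrite (_ : (fun j => u (t + s) j - u t j) = (fun j => Ru j + s%:C%C * g t j)) //.
  by apply/funext => j; rewrite /Ru; ring.
rewrite (bformBl (ua _ sh) (ua t th) (wb _ sh)) in eud.
rewrite (bformBr (ua t th) (wb _ sh) (wb t th)) in ewd.
rewrite -complex_ReZ -!ReN -!ReD; apply: le_trans (ler_Re_modulus _) _.
rewrite (_ : _ - _ = bform Ru (w (t + s)) + bform (u t) Rw
    + s%:C%C * bform (g t) (fun j => w (t + s) j - w t j)); last first.
  rewrite (bformBr (gc t th) (wb _ sh) (wb t th)).
  transitivity ((bform (u (t + s)) (w (t + s)) - bform (u t) (w (t + s)))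
    + (bform (u t) (w (t + s)) - bform (u t) (w t))
    - s%:C%C * (bform (g t) (w t) + bform (u t) (f t))); first by ring.
  by rewrite eud ewd; ring.
have m1 := bform_le ru (wb _ sh); have m2 := bform_le (ua t th) rw.
have m3 := bform_le (gc t th) wd.
apply: le_trans (modulusD _ _) _.
rewrite modulusM modulusR.
have m4 := modulusD (bform Ru (w (t + s))) (bform (u t) Rw).
have m5 := ler_wpM2l (normr_ge0 s) m3.
have n0 := normr_ge0 s.
have q1 : k1 * (a + b + c) <= k / 2.
  rewrite /k1 mulrAC ler_pdivrMr //; nra.
have q2 : `|s| * (c * e) <= k / 2.
  have := ler_wpM2r (mulr_ge0 c0 e0) s4.
  have : k2 * (c * e) <= k / 2.
    rewrite /k2 mulrAC ler_pdivrMr //; have := mulr_ge0 c0 e0; nra.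
  lra.
have q3 : `|s| * (`|s| * k1) * c <= `|s| * k1 * c.
  rewrite ler_wpM2r // ler_piMl // mulr_ge0 // ltW //.
have q4 := ler_wpM2l n0 q1; have q5 := ler_wpM2l n0 q2.
lra.
Qed.

Lemma ham_flow_derI (P : phase -> C) h x y : ham_flow P h x y ->
  exists u : R -> phase, [/\ u 0 = x, u h = y,
    forall t, 0 <= t <= h -> in_l1 (u t) &
    derI h u (fun t => vector_field P (u t))].
Proof.
move=> [u [u0 uh ul1 uder]]; exists u; split => // t th e e0.
have [/= rad rad0 H] := uder t th e e0.
exists (rad / 2); first by rewrite divr_gt0.
move=> s sd sh; have [->|s0] := eqVneq s 0.
  rewrite normr0 mulr0; apply: sumle_eq (@sumle0 R _) => j.
  by rewrite addr0 mul0r !subrr.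
have sdl : ball_ Num.norm 0 rad s by rewrite /ball_ /= sub0r normrN; lra.
have /l1norm_le := H s sdl s0 sh; move=> /(sumleZ (s%:C%C)).
rewrite modulusR mulrC; apply: sumle_eq => j.
rewrite mulrBr mulrA -rmorphM divff // mul1r //.
Qed.

End FlowCalculus.

(** * The flow of the Hamiltonian *)

Section Flow.
Variables (R : realType) (L : lattice) (d : nat).
Local Notation C := R[i].
Local Notation phase := (phase R L d).
Local Notation mode := (mode L d).
Variables (r : nat) (a : seq mode -> C) (B : R).
Hypothesis B0 : 0 <= B.
Hypothesis aB : forall js, (2 <= size js <= r)%N -> momentum js = 0 ->
  modulus (a js) <= B.

Lemma hfield_le z A : 1 <= A -> sumle z A ->
  sumle (hfield r a (tpow z)) (dham_const r B * A ^+ r).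
Proof.
move=> A1 zA; apply: (hfield_sumle B0 aB) => l lr.
exact: (tpow_sumle_le A1 zA (ltnW lr)).
Qed.

(** A continuity argument: as long as the trajectory stays in the ball of radius
    [2 m0], its speed is bounded, so that it cannot leave this ball early. *)
Lemma flow_bounded (h m0 : R) (u : R -> phase) : 0 <= h -> 1 <= m0 ->
  sumle (u 0) m0 -> (forall t, 0 <= t <= h -> exists c, sumle (u t) c) ->
  derI h u (fun t => hfield r a (tpow (u t))) ->
  h * (dham_const r B * (2 * m0) ^+ r) <= m0 / 2 ->
  forall t, 0 <= t <= h -> sumle (u t) (2 * m0).
Proof.
move=> h0 m1 u0 ul1 uder hh.
have A1 : 1 <= 2 * m0 by lra.
set c := dham_const r B * (2 * m0) ^+ r in hh.
have c0 : 0 <= c by rewrite mulr_ge0 ?dham_const_ge0 ?exprn_ge0 //; lra.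
apply: (@real_induction R) => //; first by apply: sumle_weak u0; lra.
- move=> t /andP[t0 th] Ht.
  have tt : 0 <= t <= h by rewrite t0 ltW.
  have fb s : 0 <= s <= t -> sumle (hfield r a (tpow (u s))) c.
    by move=> /Ht; apply: hfield_le.
  have t00 : 0 <= (0 : R) <= t by rewrite lexx.
  have D := derI_mvt (derI_shrink (ltW th) uder) fb t00 (lexx t).
  have ct : c * (t - 0) <= m0 / 2.
    by rewrite subr0; apply: le_trans hh; rewrite mulrC ler_wpM2r // ltW.
  have ut : sumle (u t) (m0 + m0 / 2).
    apply: (sumle_eq (g := fun j => u 0 j + (u t j - u 0 j))).
      by move=> j; rewrite addrC subrK.
    by apply: sumle_weak (sumleD u0 D); rewrite lerD2l.
  have [rad rad0 Hd] := uder t tt 1 ltr01.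
  pose e := Num.min rad (m0 / 2 / (1 + c)).
  have e0 : 0 < e by rewrite lt_min rad0 !divr_gt0 //; lra.
  exists e => // s /andP[ts se] sh.
  have st0 : 0 <= s - t by lra.
  have ed : e <= rad by rewrite ge_min lexx.
  have em : e * (1 + c) <= m0 / 2.
    by rewrite -ler_pdivlMr ?ge_min ?lexx ?orbT //; lra.
  have n1 : `|s - t| <= rad by rewrite ger0_norm //; lra.
  have n2 : 0 <= t + (s - t) <= h by apply/andP; split; lra.
  have := Hd (s - t) n1 n2; rewrite (_ : t + (s - t) = s); last by ring.
  move=> Hs; apply: (sumle_eq (g := fun j =>
    (u s j - u t j - (s - t)%:C%C * hfield r a (tpow (u t)) j)
    + (s - t)%:C%C * hfield r a (tpow (u t)) j + u t j)).
    by move=> j; ring.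
  have tt' : 0 <= t <= t by rewrite t0 lexx.
  apply: sumle_weak (sumleD (sumleD Hs (sumleZ _ (fb t tt'))) ut).
  rewrite modulusR ger0_norm // mul1r.
  have : (s - t) * (1 + c) <= e * (1 + c) by rewrite ler_wpM2r //; lra.
  lra.
- move=> t /andP[t0 th] Ht.
  have tt : 0 <= t <= h by rewrite th ltW.
  have [c1 uc1] := ul1 t tt.
  have c10 := sumle_ge0 uc1.
  have uc2 : sumle (u t) (c1 + 1) by apply: sumle_weak uc1; lra.
  have fb : sumle (hfield r a (tpow (u t))) (dham_const r B * (c1 + 1) ^+ r).
    by apply: hfield_le uc2; lra.
  set c2 := dham_const r B * _ in fb; have c20 := sumle_ge0 fb.
  apply: sumle_closed => e e0.
  have [rad rad0 Hd] := uder t tt 1 ltr01.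
  pose s := Num.min (Num.min rad t) (e / (1 + c2)).
  have s0 : 0 < s by rewrite !lt_min rad0 t0 divr_gt0 //; lra.
  have sd : s <= rad by rewrite /s !ge_min lexx.
  have st : s <= t by rewrite /s !ge_min lexx orbT.
  have se : s * (1 + c2) <= e.
    by rewrite -ler_pdivlMr ?ge_min ?lexx ?orbT //; lra.
  have n1 : `|- s| <= rad by rewrite normrN gtr0_norm.
  have n2 : 0 <= t - s <= h by apply/andP; split; lra.
  have Hs := Hd (- s) n1 n2.
  have uts : sumle (u (t - s)) (2 * m0) by apply: Ht; apply/andP; split; lra.
  apply: (sumle_eq (g := fun j => u (t - s) j
    - (u (t - s) j - u t j - (- s)%:C%C * hfield r a (tpow (u t)) j)
    - (- s)%:C%C * hfield r a (tpow (u t)) j)).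
    by move=> j; ring.
  apply: sumle_weak (sumleB (sumleB uts Hs) (sumleZ _ fb)).
  rewrite modulusR normrN (gtr0_norm s0); lra.
Qed.

Hypothesis aC : forall js, (2 <= size js <= r)%N -> momentum js = 0 ->
  a (map bar js) = (a js)^*%C.

Lemma sumle_cbar (z : mode -> C) c : sumle z c -> sumle (cbar z) c.
Proof.
move=> zc; apply: sumle_le (sumle_image (inv_inj (@barK L d)) zc) => // j.
by rewrite /cbar modulus_conj.
Qed.

(** By uniqueness, the flow of a real Hamiltonian preserves real phases. *)
Lemma flow_real (h A : R) (u : R -> phase) : 0 <= h -> 1 <= A ->
  cbar (u 0) = u 0 ->
  (forall t, 0 <= t <= h -> sumle (u t) A) ->
  derI h u (fun t => hfield r a (tpow (u t))) ->
  h * (dham_const r B * (r%:R * A ^+ r)) <= 2^-1 ->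
  forall t, 0 <= t <= h -> cbar (u t) = u t.
Proof.
move=> h0 A1 u0 uA uder hh.
have cder : derI h (fun t => cbar (u t)) (fun t => cbar (hfield r a (tpow (u t)))).
  move=> t th e e0; have [rad rad0 H] := uder t th e e0.
  exists rad => // s sd sh; apply: sumle_eq (sumle_cbar (H s sd sh)) => j.
  have cs : conjc (s%:C%C : C) = s%:C%C by rewrite /conjc /= oppr0.
  by rewrite /cbar -{1}cs -conjM -!(rmorphB (@conjc R)).
have D := derI_lin (-1) uder cder.
pose w t j := u t j - cbar (u t) j.
have W k t : 0 <= t <= h -> sumle (w t) (2^-1 ^+ k * (A + A)).
  elim: k t => [|k IH] t th.
    by rewrite expr0 mul1r; apply: sumleB; [|apply: sumle_cbar]; apply: uA.
  set e := _ * _ in IH.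
  have fb s : 0 <= s <= h -> sumle (fun j => hfield r a (tpow (u s)) j
     + -1 * cbar (hfield r a (tpow (u s))) j) (dham_const r B * (r%:R * A ^+ r * e)).
    move=> sh; have us := uA s sh; have cs := sumle_cbar us.
    apply: sumle_eq (hfield_lip B0 aB A1 us cs (IH s sh)) => j.
    by rewrite (hfield_cbar B0 aB aC A1 us) mulN1r.
  have /andP[t0 th'] := th.
  have t00 : 0 <= (0 : R) <= t by rewrite lexx.
  apply: sumle_weak (sumle_eq _ (derI_mvt D fb t00 th')) => [|j]; last first.
    by rewrite /w !mulN1r u0 subrr subr0.
  have e0 : 0 <= e by apply: sumle_ge0 (IH t th).
  rewrite subr0 (_ : _ ^+ k.+1 * _ = 2^-1 * e); last by rewrite /e exprS mulrA.
  apply: le_trans (_ : h * (dham_const r B * (r%:R * A ^+ r)) * e <= _).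
    rewrite [X in X <= _](_ : _ = t * (dham_const r B * (r%:R * A ^+ r)) * e);
      last by ring.
    rewrite ler_wpM2r // ler_wpM2r //.
    by rewrite !mulr_ge0 ?dham_const_ge0 ?exprn_ge0 //; lra.
  by rewrite ler_wpM2r.
move=> t th; apply/funext => j; apply/esym/subr0_eq/modulus_eq0/le_anti.
rewrite modulus_ge0 andbT; apply/ler_addgt0Pr => e e0; rewrite add0r.
have A20 : 0 < A + A by lra.
have [k _ Hk] : exists2 k, True & (2^-1) ^+ k * (A + A) <= e.
  have : (fun k => (2^-1 : R) ^+ k) @ \oo --> 0.
    by apply: cvg_expr; rewrite ger0_norm ?invr_ge0 // invf_lt1 // ltr1n.
  move=> /cvgrPdist_le /(_ _ (divr_gt0 e0 A20)) [k _ /(_ k (leqnn k))] /=.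
  rewrite sub0r normrN ger0_norm ?exprn_ge0 ?invr_ge0 // => H; exists k => //.
  by rewrite -ler_pdivlMr.
exact: le_trans (sumle_bnd j (W k t th)) Hk.
Qed.

End Flow.

(** * Trigonometric bounds *)

Section Trigonometry.
Variable R : realType.
Implicit Types x y : R.

Lemma mvt_total (f df : R -> R) x y : x <= y ->
  (forall z : R, is_derive z 1 f (df z)) ->
  exists2 c, x <= c <= y & f y - f x = df c * (y - x).
Proof.
move=> xy fd; have [|c] := MVT_segment xy (fun z _ => fd z).
  apply: derivable_within_continuous => z _; exact: ex_derive.
by rewrite in_itv /= => cxy e; exists c.
Qed.

Lemma norm_sin_le x : `|sin x| <= `|x|.
Proof.
wlog x0 : x / 0 <= x.
  move=> H; have [/H //|/ltW x0] := leP 0 x.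
  by rewrite -normrN -sinN -(normrN x) H // oppr_ge0.
have [c _] := mvt_total x0 (@is_derive_sin R); rewrite sin0 !subr0 => ->.
by rewrite normrM ler_piMl // ler_norml cos_geN1 cos_le1.
Qed.

Lemma norm_cosB1_le x : `|cos x - 1| <= `|x|.
Proof.
wlog x0 : x / 0 <= x.
  move=> H; have [/H //|/ltW x0] := leP 0 x.
  by rewrite -cosN -(normrN x) H // oppr_ge0.
have [c _] := mvt_total x0 (@is_derive_cos R); rewrite cos0 subr0 => ->.
by rewrite normrM ler_piMl // normrN ler_norml sin_geN1 sin_le1.
Qed.

Lemma sin_le_id x : 0 <= x -> sin x <= x.
Proof.
move=> x0; rewrite -[X in _ <= X](ger0_norm x0).
exact: le_trans (ler_norm _) (norm_sin_le x).
Qed.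

Lemma sin_ge_half x : 0 <= x <= 2^-1 -> x / 2 <= sin x.
Proof.
move=> /andP[x0 x1]; have [c /andP[c0 cx]] := mvt_total x0 (@is_derive_sin R).
rewrite sin0 !subr0 => ->; rewrite mulrC ler_wpM2r //.
have := norm_cosB1_le c; rewrite (ger0_norm c0) ler_norml => /andP[]; lra.
Qed.

Lemma atan_le_id x : 0 <= x -> atan x <= x.
Proof.
move=> x0; have [c _] := mvt_total x0 (@is_derive1_atan R).
rewrite atan0 !subr0 => ->; rewrite ler_piMl // invf_le1.
  by rewrite lerDl sqr_ge0.
by rewrite ltr_pwDl // sqr_ge0.
Qed.

Lemma atan_ge_half x : 0 <= x <= 1 -> x / 2 <= atan x.
Proof.
move=> /andP[x0 x1]; have [c /andP[c0 cx]] := mvt_total x0 (@is_derive1_atan R).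
rewrite atan0 !subr0 => ->; rewrite mulrC ler_wpM2r //.
rewrite lef_pV2 ?posrE ?ltr_pwDl ?sqr_ge0 //.
have : c ^+ 2 <= 1 by rewrite expr_le1 //; lra.
lra.
Qed.

Lemma atan_ge0 x : 0 <= x -> 0 <= atan x.
Proof. by move=> x0; rewrite -(atan0 R) le_atan. Qed.

Lemma atan_le2 x : atan x <= 2.
Proof. exact: le_trans (ltW (atan_ltpi2 x)) (ltW (pihalf_lt2 R)). Qed.

Lemma modulus_cis x : modulus (cis x) = 1.
Proof. by rewrite /modulus /cis /Normc.normc cos2Dsin2 sqrtr1. Qed.

Lemma cis_near1 x : modulus (cis x - 1) <= 2 * `|x|.
Proof.
apply: le_trans (modulus_ReIm _) _; rewrite ReD ImD ReN ImN /= subr0.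
have := norm_sin_le x; have := norm_cosB1_le x; lra.
Qed.

Lemma cis_mulN x : cis x * cis (- x) = 1.
Proof.
rewrite /cis cosN sinN; apply/eqP; rewrite eq_complex /=.
rewrite mulrN opprK -!expr2 cos2Dsin2 eqxx /=.
by rewrite mulrN mulrC addrC subrr.
Qed.

End Trigonometry.

(** * Orbits of the splitting method *)

Section Orbit.
Variables (R : realType) (L : lattice) (d : nat).
Local Notation C := R[i].
Local Notation phase := (phase R L d).
Local Notation mode := (mode L d).

Definition lphase (lam : site L d -> R) (j : mode) : R :=
  - (if j.2 then lam j.1 else - lam j.1).

Lemma linear_flowE lam (z : phase) j : linear_flow lam z j = cis (lphase lam j) * z j.
Proof. by []. Qed.

Lemma linear_flow_sumle lam (z : phase) c : sumle z c -> sumle (linear_flow lam z) c.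
Proof.
by apply: sumle_le => // j; rewrite linear_flowE modulusM modulus_cis mul1r.
Qed.

Lemma lphase_bar lam j : lphase lam (bar j) = - lphase lam j.
Proof. by case: j => x [] /=; rewrite /lphase /= ?opprK. Qed.

(** Each pair of conjugate modes is rotated in opposite directions: this is why
    the linear flow does not contribute to the balance of [noether]. *)
Lemma bform_linear_flow lam (z w : phase) :
  bform (linear_flow lam z) (linear_flow lam w) = bform z w.
Proof.
rewrite /bform; congr (_ * csum _); apply/funext => j; rewrite /bterm.
case: ifP => // _; rewrite !linear_flowE lphase_bar.
by rewrite mulrACA [cis _ * cis _]mulrC cis_mulN mul1r.
Qed.

Lemma real_linear_flow lam (z : phase) : cbar z = z ->
  cbar (linear_flow lam z) = linear_flow lam z.
Proof.
move=> zr; apply/funext => j; rewrite /cbar !linear_flowE lphase_bar conjM.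
rewrite -[in RHS]zr /cbar; congr (_ * _).
by rewrite /cis /= cosN sinN opprK.
Qed.

Variables (r : nat) (a : seq mode -> C) (B : R).
Hypothesis B0 : 0 <= B.
Hypothesis aB : forall js, (2 <= size js <= r)%N -> momentum js = 0 ->
  modulus (a js) <= B.

Variables (h A eta : R) (lam : site L d -> R) (v : nat -> R -> phase).
Hypotheses (h0 : 0 <= h) (A1 : 1 <= A) (eta0 : 0 <= eta).
Hypothesis lame : forall x, `|lam x| <= eta.
Hypothesis vA : forall n t, 0 <= t <= h -> sumle (v n t) A.
Hypothesis vder : forall n, derI h (v n) (fun t => hfield r a (tpow (v n t))).
Hypothesis vglue : forall n, v n.+1 0 = linear_flow lam (v n h).

(** The geometric rate of the finite differences of an orbit: it is of the order
    of one step, namely of [eta] for the linear flow and of [h] for the other. *)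
Definition rate K : R := 2 * eta + h * (dham_const r B * tensor_const K A ^+ r).

Lemma rate_ge0 K : 0 <= rate K.
Proof.
rewrite addr_ge0 ?mulr_ge0 ?exprn_ge0 //; first exact: (dham_const_ge0 r B0).
by apply: le_trans ler01 (tensor_const_ge1 K A1).
Qed.

(** Every finite difference in the number of steps gains the size of one step:
    the difference equation bounds the differences of order [k + 1] by those of
    order [k], as a differential equation does for derivatives. *)
Lemma tame_orbit K t : 0 <= t <= h -> tame K (rate K) A (fun n => v n t).
Proof.
set sg := rate K; have sg0 : 0 <= sg by apply: rate_ge0.
suff H k : (k <= K)%N -> forall t, 0 <= t <= h ->
    tame k sg A (fun n => v n t) by move=> th; apply: H.
elim: k => [_ {}t th [|//] n _|k IH kK {}t th].
  by rewrite fact0 expr0 !mulr1; apply: vA.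
have Ik := IH (ltnW kK).
move=> k' n; rewrite leq_eqVlt => /orP[/eqP ->{k'}|]; last by apply: Ik.
set c := dham_const r B * tensor_const K A ^+ r.
have c0 : 0 <= c.
  rewrite mulr_ge0 ?exprn_ge0 //; first exact: (dham_const_ge0 r B0).
  by apply: le_trans ler01 (tensor_const_ge1 K A1).
set f := k`!%:R * sg ^+ k; have f0 : 0 <= f by rewrite mulr_ge0 ?exprn_ge0.
have Xb s m : 0 <= s <= h ->
    sumle (fun j => fdiff k (fun n => hfield r a (tpow (v n s)) j) m) (c * f).
  move=> sh; apply: sumle_weak (tame_hfield B0 aB sg0 A1 (Ik s sh) m (leqnn k)).
  rewrite -mulrA ler_wpM2r // ler_wpM2l ?(dham_const_ge0 r B0) //.
  rewrite lerXn2r ?nnegrE ?(le_trans ler01 (tensor_const_ge1 _ A1)) //.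
  by rewrite ler_wpM2r ?ler_nat ?(le_trans ler01 A1) // ltnS ltnW.
have Dk m := derI_fdiff k m vder.
have /andP[t0 th'] := th.
have h00 : 0 <= (0 : R) <= t by rewrite lexx.
have M1 := derI_mvt (Dk n.+1) (fun s sh => Xb s n.+1 sh) h00 th'.
have M2 := derI_mvt (Dk n) (fun s sh => Xb s n sh) th (lexx h).
have Vb := Ik t th k n (leqnn k).
apply: (sumle_eq (g := fun j =>
   (fdiff k (fun n => v n t j) n.+1 - fdiff k (fun n => v n 0 j) n.+1)
   + (cis (lphase lam j) * (fdiff k (fun n => v n h j) n - fdiff k (fun n => v n t j) n)
   + (cis (lphase lam j) - 1) * fdiff k (fun n => v n t j) n))).
  move=> j; rewrite fdiffS.
  have -> : fdiff k (fun n => v n 0 j) n.+1 =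
      cis (lphase lam j) * fdiff k (fun n => v n h j) n.
    rewrite -fdiff_suc -fdiffZ; apply: eq_fdiff => m; by rewrite vglue.
  by ring.
have C1 : sumle (fun j => cis (lphase lam j) *
     (fdiff k (fun n => v n h j) n - fdiff k (fun n => v n t j) n)) (1 * (c * f * (h - t))).
  by apply: sumleM M2 => // j; rewrite modulus_cis.
have C2 : sumle (fun j => (cis (lphase lam j) - 1) * fdiff k (fun n => v n t j) n)
    ((2 * eta) * (A * k`!%:R * sg ^+ k)).
  apply: sumleM Vb => [|j]; first by rewrite mulr_ge0.
  apply: le_trans (cis_near1 _) _; rewrite ler_wpM2l //.
  by rewrite /lphase normrN; case: ifP => _; rewrite ?normrN lame.
apply: sumle_weak (sumleD M1 (sumleD C1 C2)).
rewrite [X in X <= _](_ : _ = (h * c + 2 * eta * A) * f); last first.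
  by rewrite /f; ring.
apply: le_trans (_ : A * sg * f <= _).
  rewrite ler_wpM2r // /sg /rate -/c mulrDr addrC.
  rewrite [A * (2 * eta)]mulrC lerD2l ler_peMl // mulr_ge0 //.
have -> : A * (k.+1)`!%:R * sg ^+ k.+1 = k.+1%:R * (A * sg * f).
  by rewrite factS natrM exprS /f; ring.
have A0 : 0 <= A := le_trans ler01 A1.
by rewrite ler_peMl ?ler1n // mulr_ge0 // mulr_ge0.
Qed.

End Orbit.

(** * The almost invariant *)

Section RealParts.
Variable R : realType.
Implicit Types f : nat -> R[i].

Lemma fdiff_Re f k n : fdiff k (fun n => complex.Re (f n)) n = complex.Re (fdiff k f n).
Proof. by elim: k n => [//|k IH] n; rewrite !fdiffS !IH ReD ReN. Qed.

Lemma dlog_Re f N n :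
  dlog N (fun n => complex.Re (f n)) n = complex.Re (dlog N f n).
Proof.
rewrite /dlog Re_sum; apply: eq_bigr => k _; rewrite fdiff_Re -complex_ReZ.
congr (complex.Re (_ * _)).
by rewrite rmorphM fmorphV rmorph_nat rmorphXn rmorphN1.
Qed.

Lemma dlogB (g g' : nat -> R) N n :
  dlog N (fun n => g n - g' n) n = dlog N g n - dlog N g' n.
Proof.
by rewrite /dlog -sumrB; apply: eq_bigr => k _; rewrite fdiffB mulrBr.
Qed.

Lemma fdiff_zero k n : fdiff k (fun=> 0 : R) n = 0.
Proof. by case: k => [//|k]; rewrite fdiff_cst. Qed.

(** Below order [K] the factorials are absorbed by the geometric factor. *)
Lemma fact_geom (K k : nat) (sg : R) : 0 <= sg -> K%:R * sg <= 2^-1 ->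
  (k < K)%N -> (k.+1)`!%:R * sg ^+ k.+1 <= sg * 2^-1 ^+ k.
Proof.
move=> sg0 Ksg; elim: k => [|k IH] kK.
  by rewrite (_ : 1`! = 1)%N // expr1 expr0 mul1r mulr1.
have -> : (k.+2)`!%:R * sg ^+ k.+2 =
    (k.+2%:R * sg) * ((k.+1)`!%:R * sg ^+ k.+1).
  by rewrite (factS k.+1) natrM (exprS sg k.+1); ring.
rewrite (exprS 2^-1 k) (mulrCA sg); apply: ler_pM.
- by rewrite mulr_ge0.
- by rewrite mulr_ge0 ?exprn_ge0.
- by apply: le_trans Ksg; rewrite ler_wpM2r ?ler_nat.
- exact/IH/ltnW.
Qed.

Lemma sum_ord_recl (V : zmodType) (F : nat -> V) n : (0 < n)%N ->
  \sum_(k < n) F k = F 0%N + \sum_(k < n.-1) F k.+1.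
Proof. by case: n => // n _; rewrite big_ord_recl. Qed.

Lemma sum_geom n : \sum_(k < n) (2^-1 : R) ^+ k <= 2.
Proof.
have -> : \sum_(k < n) (2^-1 : R) ^+ k = 2 * (1 - 2^-1 ^+ n).
  elim: n => [|n IH]; first by rewrite big_ord0 expr0 subrr mulr0.
  by rewrite big_ord_recr /= IH exprS; field.
have : 0 <= (2^-1 : R) ^+ n by rewrite exprn_ge0 ?invr_ge0.
lra.
Qed.

End RealParts.

Section Energy.
Variables (R : realType) (L : lattice) (d : nat).
Local Notation C := R[i].
Local Notation phase := (phase R L d).
Local Notation mode := (mode L d).
Variables (r : nat) (a : seq mode -> C) (B : R).
Hypothesis B0 : 0 <= B.
Hypothesis aB : forall js, (2 <= size js <= r)%N -> momentum js = 0 ->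
  modulus (a js) <= B.

Variables (h A eta : R) (lam : site L d -> R) (v : nat -> R -> phase).
Hypotheses (h0 : 0 <= h) (A1 : 1 <= A) (eta0 : 0 <= eta).
Hypothesis lame : forall x, `|lam x| <= eta.
Hypothesis vA : forall n t, 0 <= t <= h -> sumle (v n t) A.
Hypothesis vder : forall n, derI h (v n) (fun t => hfield r a (tpow (v n t))).
Hypothesis vglue : forall n, v n.+1 0 = linear_flow lam (v n h).

Variable N : nat.
Local Notation K := N.+1.
Local Notation sg := (rate r B h A eta K).
Local Notation G := (tensor_const K A).
Local Notation c1 := (dham_const r B).
Local Notation VX n t := (hfield r a (tpow (v n t))).
Local Notation VD n t := (dlogv N (fun m => v m t) n).

Let sg0 : 0 <= sg. Proof. exact: rate_ge0. Qed.
Let c10 : 0 <= c1. Proof. exact: dham_const_ge0. Qed.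
Let A0 : 0 <= A. Proof. exact: le_trans ler01 A1. Qed.
Let G1 : 1 <= G. Proof. exact: tensor_const_ge1. Qed.
Let G0 : 0 <= G. Proof. exact: le_trans ler01 G1. Qed.

Let tv t (th : 0 <= t <= h) : tame K sg A (fun n => v n t).
Proof. exact: (tame_orbit B0 aB h0 A1 eta0 lame vA vder vglue). Qed.

Let tX t (th : 0 <= t <= h) : tame K sg (c1 * G ^+ r) (fun n => VX n t).
Proof. exact: (tame_hfield B0 aB sg0 A1 (tv th)). Qed.

Let XA n t (th : 0 <= t <= h) : sumle (VX n t) (c1 * A ^+ r).
Proof. exact: (hfield_le B0 aB A1 (vA n th)). Qed.

(** The Lagrangian of the flow of [ham], evaluated along the trajectories. *)
Definition lagrangian n t : R :=
  complex.Re (bform (v n t) (VX n t)) - complex.Re (ham r a (v n t)).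

Lemma lagrangian_lip : exists2 k, 0 <= k & forall n x y, 0 <= x <= y -> y <= h ->
  `|lagrangian n y - lagrangian n x| <= k * (y - x).
Proof.
pose c := c1 * A ^+ r; have cp : 0 <= c by rewrite mulr_ge0 ?exprn_ge0.
exists (c * c + A * (c1 * (r%:R * A ^+ r * c)) + c1 * (r%:R * A ^+ r * c)).
  by rewrite !addr_ge0 // ?mulr_ge0 ?exprn_ge0.
move=> n x y xy yh; have /andP[x0 xy'] := xy.
have xh : 0 <= x <= h by rewrite x0 (le_trans xy').
have yh' : 0 <= y <= h by rewrite yh (le_trans x0).
have V := derI_mvt (vder n) (fun t th => XA n th) xy yh.
have vx := vA n xh; have vy := vA n yh'.
have Xx := XA n xh; have Xy := XA n yh'.
have HX := hfield_lip B0 aB A1 vy vx V.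
have HH := ham_lip B0 aB A1 vy vx V.
rewrite (_ : lagrangian n y - lagrangian n x = complex.Re
  ((bform (v n y) (VX n y) - bform (v n x) (VX n x))
   - (ham r a (v n y) - ham r a (v n x)))); last first.
  rewrite /lagrangian; move: (bform _ _) (bform _ _) (ham _ _ _) (ham _ _ _).
  by move=> p q s t; rewrite !(ReD, ReN); ring.
apply: le_trans (ler_Re_modulus _) _.
apply: le_trans (modulusB _ _) _.
rewrite -[X in modulus X + _](subrKA (bform (v n x) (VX n y))).
rewrite -(bformBl vy vx Xy) -(bformBr vx Xy Xx).
have m1 := bform_le V Xy; have m2 := bform_le vx HX.
have m3 := modulusD (bform (fun j => v n y j - v n x j) (VX n y))
   (bform (v n x) (fun j => VX n y j - VX n x j)).
apply: le_trans (lerD m3 HH) _.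
apply: (@le_trans _ _ (c * (y - x) * c
  + A * (c1 * (r%:R * A ^+ r * (c * (y - x))))
  + c1 * (r%:R * A ^+ r * (c * (y - x))))).
  by rewrite lerD2r lerD.
by rewrite le_eqVlt; apply/orP; left; apply/eqP; ring.
Qed.

Lemma lagrangian_le n t : 0 <= t <= h -> `|lagrangian n t| <= (A + 1) * (c1 * A ^+ r).
Proof.
move=> th; rewrite /lagrangian -ReN -ReD; apply: le_trans (ler_Re_modulus _) _.
apply: le_trans (modulusB _ _) _; rewrite mulrDl mul1r lerD //.
  exact: bform_le (vA n th) (XA n th).
exact: (ham_le B0 aB A1 (vA n th)).
Qed.

Lemma lagrangian_fdiff k n t : (k <= K)%N -> 0 <= t <= h ->
  `|fdiff k (fun n => lagrangian n t) n| <= (G + 1) * (c1 * G ^+ r) * k`!%:R * sg ^+ k.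
Proof.
move=> kK th; rewrite fdiffB !fdiff_Re -ReN -ReD; apply: le_trans (ler_Re_modulus _) _.
apply: le_trans (modulusB _ _) _.
have s1 := stame_bform sg0 (tv th) (tX th) n kK.
have s2 := stame_ham B0 aB sg0 A1 (tv th) n kK.
apply: le_trans (lerD s1 s2) _.
by rewrite le_eqVlt; apply/orP; left; apply/eqP; rewrite /tensor_const; ring.
Qed.

Definition defect : R := (A + 1) * (c1 * G ^+ r) * ((N.+1)`!%:R * sg ^+ N.+1).

(** Noether's argument.  Shifting the index [n] is a symmetry of the family of
    trajectories, generated by the derivation [dlog]: the momentum [bform v D]
    varies along the flow at the rate given by the shift of the Lagrangian, up
    to the defect of [dlog]. *)
Lemma noether n t : 0 <= t <= h ->
  `|complex.Re (bform (VX n t) (VD n t)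
      + bform (v n t) (dlogv N (fun n => VX n t) n))
    - dlog N (fun n => lagrangian n t) n| <= defect.
Proof.
move=> th.
have Dv := sumle_dlog N n (fun m => vA m th).
have d1 := dlog_bform sg0 (tv th) (tX th) n (leqnSn N).
have d2 := dlog_ham B0 aB sg0 A1 (tv th) n (leqnSn N).
have hm := bform_hfield B0 aB Dv
   (fun l lr => tpow_sumle_le A1 (vA n th) (ltnW lr)).
rewrite dlogB !dlog_Re.
move: d1 d2 hm; set b1 := bform (VX n t) _; set b2 := bform (v n t) _.
set b3 := bform (VD n t) _; set d1 := dlog N _ n; set d2 := dlog N _ n.
set d3 := dham _ _ _ _; move: b1 b2 b3 d1 d2 d3 => b1 b2 b3 d1 d2 d3 e1 e2 e3.
rewrite (_ : _ - _ = complex.Re ((d2 - d3) - (d1 - (b3 + b2)))); last first.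
  have e4 : d3 = b3 - b1 by rewrite -[d3]opprK -e3; ring.
  rewrite (_ : d2 - d3 - (d1 - (b3 + b2)) = b1 + b2 - (d1 - d2)).
    by rewrite [RHS]ReD [complex.Re (- _)]ReN [complex.Re (d1 - _)]ReD ReN.
  by rewrite e4; ring.
apply: le_trans (ler_Re_modulus _) _; apply: le_trans (modulusB _ _) _.
apply: le_trans (lerD e2 e1) _.
by rewrite le_eqVlt; apply/orP; left; apply/eqP; rewrite /defect; ring.
Qed.

Let hh : 0 <= h <= h. Proof. by rewrite h0 lexx. Qed.
Let h00 : 0 <= (0 : R) <= h. Proof. by rewrite lexx h0. Qed.

Definition noether_charge n : R := complex.Re (bform (v n 0) (VD n 0)).

Lemma glue_D n : bform (v n h) (VD n h) = bform (v n.+1 0) (VD n.+1 0).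
Proof.
have -> : VD n.+1 0 = linear_flow lam (VD n h).
  apply/funext => j; rewrite linear_flowE /dlogv /dlog mulr_sumr.
  apply: eq_bigr => k _; rewrite mulrCA; congr (_ * _).
  by rewrite -fdiff_suc -fdiffZ; apply: eq_fdiff => m; rewrite vglue.
by rewrite vglue bform_linear_flow.
Qed.

(** The balance of [noether] integrated over one step.  Since [dlog] is the
    difference operator composed with another polynomial in it, the right-hand
    side is itself a difference, and an almost conserved quantity appears. *)
Lemma almost_invariant : exists F : nat -> R,
  [/\ forall n, `|noether_charge n.+1 - noether_charge n - dlog N F n| <= defect * h,
      forall n, `|F n| <= (A + 1) * (c1 * A ^+ r) * h &
      forall k n, (k <= K)%N ->
        `|fdiff k F n| <= (G + 1) * (c1 * G ^+ r) * k`!%:R * sg ^+ k * h].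
Proof.
have [k k0 lip] := lagrangian_lip.
have [|Gs HG] := @choice _ _ (fun n (g : R -> R) => g 0 = 0 /\ derR h g (lagrangian n)).
  by move=> n; have [g g0 gd] := antiderivative h0 k0 (lip n); exists g.
have Gd n : derR h (Gs n) (lagrangian n) := (HG n).2.
exists (fun n => Gs n h); split => [n|n|l n lK].
- have Db t (th : 0 <= t <= h) := sumle_dlog N n (fun m => vA m th).
  have DXb t (th : 0 <= t <= h) := sumle_dlog N n (fun m => XA m th).
  have der1 := derR_bform (vder n) (derI_dlogv N n vder)
     (fun t th => vA n th) Db (fun t th => XA n th) DXb.
  have der := derRB der1 (derR_dlog N n Gd).
  have := derR_mvt der (fun t th => noether n th) h00 (lexx h).
  rewrite subr0 glue_D.
  have -> : dlog N (fun n => Gs n 0) n = 0.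
    rewrite /dlog big1 // => i _; rewrite (@eq_fdiff _ _ _ (fun=> 0)).
      by rewrite fdiff_zero mulr0.
    by move=> m; rewrite (HG m).1.
  by rewrite subr0 addrAC.
- have := derR_mvt (Gd n) (fun t th => lagrangian_le n th) h00 (lexx h).
  by rewrite (HG n).1 !subr0.
- have := derR_mvt (derR_fdiff l n Gd) (fun t th => lagrangian_fdiff n lK th) h00 (lexx h).
  rewrite (@eq_fdiff _ l (fun n => Gs n 0) (fun=> 0)) => [|m]; last by rewrite (HG m).1.
  by rewrite fdiff_zero !subr0.
Qed.

Hypothesis N0 : (0 < N)%N.
Hypothesis Ksg : K%:R * sg <= 2^-1.

(** The part of the momentum that comes from the linear flow alone. *)
Definition lin_energy n : R :=
  complex.Re (bform (v n 0) (fun j => (cis (lphase lam j) - 1) * v n 0 j)).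

(** In [dlog] the first difference dominates, and it is due to the linear flow up
    to the size [h] of the other one. *)
Lemma noether_charge_approx n :
  `|noether_charge n - lin_energy n| <= A * (h * (c1 * A ^+ r) + 2 * A * sg ^+ 2).
Proof.
have V := derI_mvt (vder n) (fun t th => XA n th) h00 (lexx h).
have v0 := vA n h00.
pose E j := cis (lphase lam j) * (v n h j - v n 0 j).
have Eb : sumle E (h * (c1 * A ^+ r)).
  have -> : h * (c1 * A ^+ r) = 1 * (c1 * A ^+ r * (h - 0)) by ring.
  by apply: sumleM V => // j; rewrite modulus_cis.
pose T j := \sum_(k < N.-1) (-1) ^+ k.+1 / k.+2%:R
  * fdiff k.+2 (fun n => v n 0 j) n.
have Tb : sumle T (2 * A * sg ^+ 2).
  apply: (@sumle_weak _ _ _ (\sum_(k < N.-1) A * sg ^+ 2 * 2^-1 ^+ k)); last first.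
    apply: sumle_sum => k _.
    have kN : (k.+1 < N)%N by rewrite -ltn_predRL.
    have kK : (k.+2 <= K)%N by rewrite ltnS ltnW.
    apply: sumle_weak (sumleZ _ (tv h00 n kK)).
    rewrite modulusM modulusX modulusN modulus1 expr1n mul1r modulusV modulusn.
    have -> : k.+2%:R^-1 * (A * (k.+2)`!%:R * sg ^+ k.+2) =
        A * sg * ((k.+1)`!%:R * sg ^+ k.+1).
      rewrite (factS k.+1) natrM (exprS sg k.+1).
      have : k.+2%:R != 0 :> R by rewrite pnatr_eq0.
      by move: k.+2%:R => x x0; field.
    rewrite (_ : A * sg ^+ 2 * 2^-1 ^+ k = A * sg * (sg * 2^-1 ^+ k)); last by ring.
    rewrite ler_wpM2l ?mulr_ge0 //; apply: (fact_geom sg0 Ksg).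
    by rewrite ltnS; apply: ltnW (ltnW kN).
  rewrite -mulr_sumr (_ : 2 * A * sg ^+ 2 = A * sg ^+ 2 * 2); last by ring.
  by rewrite ler_wpM2l ?sum_geom // mulr_ge0 // sqr_ge0.
have Lb : sumle (fun j => (cis (lphase lam j) - 1) * v n 0 j) (2 * A).
  apply: sumleM v0 => // j; apply: le_trans (modulusB _ _) _.
  by rewrite modulus_cis modulus1.
have -> : noether_charge n = complex.Re (bform (v n 0)
    (fun j => (cis (lphase lam j) - 1) * v n 0 j + 1 * (E j + T j))).
  rewrite /noether_charge; have -> // : VD n 0 =
    (fun j => (cis (lphase lam j) - 1) * v n 0 j + 1 * (E j + T j)).
  apply/funext => j; rewrite /dlogv /dlog.
  rewrite (sum_ord_recl (fun k => (-1) ^+ k / k.+1%:R *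
    fdiff k.+1 (fun n => v n 0 j) n) N0).
  rewrite expr0 divr1 mul1r fdiffS !fdiff0 vglue linear_flowE.
  by rewrite (_ : \sum_(i < _) _ = T j) // /E; ring.
rewrite (bformDr 1 v0 Lb (sumleD Eb Tb)) mul1r ReD addrAC subrr add0r.
apply: le_trans (ler_Re_modulus _) _.
exact: bform_le v0 (sumleD Eb Tb).
Qed.

Definition drift : R :=
  ((A + 1) * (c1 * A ^+ r) + 2 * ((G + 1) * (c1 * G ^+ r) * sg)
   + A * (c1 * A ^+ r)) * h + 2 * A ^+ 2 * sg ^+ 2.

(** The almost conserved quantity is [En]: its increment over one step is the
    increment of the momentum minus [dlog N F], because [S] is the quotient of
    [dlog] by the difference operator applied to [F]. *)
Lemma energy_drift n :
  `|lin_energy n - lin_energy 0| <= n%:R * (defect * h) + 2 * drift.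
Proof.
have [F [F1 F2 F3]] := almost_invariant.
pose S n := \sum_(k < N) (-1) ^+ k / k.+1%:R * fdiff k F n : R.
pose En n := noether_charge n - S n.
have dS m : S m.+1 - S m = dlog N F m.
  by rewrite /S -sumrB; apply: eq_bigr => k _; rewrite fdiffS mulrBr.
have EnS m : `|En m.+1 - En m| <= defect * h.
  rewrite (_ : _ - _ = noether_charge m.+1 - noether_charge m - dlog N F m) ?F1 //.
  by rewrite /En -dS; ring.
have Edrift : `|En n - En 0| <= n%:R * (defect * h).
  elim: n => [|m IH]; first by rewrite subrr normr0 mul0r.
  rewrite (_ : _ - _ = (En m.+1 - En m) + (En m - En 0)); last by ring.
  by rewrite (le_trans (ler_normD _ _)) // -natr1 mulrDl mul1r addrC lerD.
have Sb m : `|S m| <= (A + 1) * (c1 * A ^+ r) * h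
    + 2 * ((G + 1) * (c1 * G ^+ r) * sg) * h.
  have -> : S m = F m + \sum_(k < N.-1) (-1) ^+ k.+1 / k.+2%:R * fdiff k.+1 F m.
    rewrite /S (sum_ord_recl (fun k => (-1) ^+ k / k.+1%:R * fdiff k F m) N0).
    by rewrite expr0 divr1 mul1r fdiff0.
  apply: le_trans (ler_normD _ _) _; rewrite lerD //.
  apply: le_trans (ler_norm_sum _ _ _) _.
  set q := (G + 1) * (c1 * G ^+ r).
  have q0 : 0 <= q by rewrite !mulr_ge0 ?addr_ge0 ?exprn_ge0.
  apply: le_trans (_ : \sum_(k < N.-1) q * sg * h * 2^-1 ^+ k <= _).
    apply: ler_sum => k _.
    have kN : (k.+1 < N)%N by rewrite -ltn_predRL.
    have kK : (k.+1 <= K)%N by rewrite ltnW // ltnS ltnW.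
    rewrite normrM normrM normrX normrN1 expr1n mul1r normfV normr_nat.
    apply: le_trans (ler_wpM2l _ (F3 k.+1 m kK)) _; first by rewrite invr_ge0.
    apply: le_trans (_ : 1 * (q * (k.+1)`!%:R * sg ^+ k.+1 * h) <= _).
      rewrite ler_wpM2r //.
        by rewrite mulr_ge0 // mulr_ge0 ?exprn_ge0 // mulr_ge0.
      by rewrite invf_le1 ?ltr0n // ler1n.
    rewrite mul1r (_ : q * _ * _ * h = q * h * ((k.+1)`!%:R * sg ^+ k.+1));
      last by ring.
    rewrite (_ : q * sg * h * _ = q * h * (sg * 2^-1 ^+ k)); last by ring.
    apply: ler_wpM2l; first exact: mulr_ge0 q0 h0.
    apply: (fact_geom sg0 Ksg).
    by rewrite ltnS; apply: ltnW (ltnW kN).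
  rewrite -mulr_sumr (_ : 2 * (q * sg) * h = q * sg * h * 2); last by ring.
  by rewrite ler_wpM2l ?sum_geom // mulr_ge0 // mulr_ge0.
have close m : `|lin_energy m - En m| <= drift.
  rewrite (_ : _ - _ = S m - (noether_charge m - lin_energy m)); last first.
    by rewrite /En; ring.
  apply: le_trans (ler_normB _ _) _; apply: le_trans (lerD (Sb m)
    (noether_charge_approx m)) _.
  by rewrite le_eqVlt; apply/orP; left; apply/eqP; rewrite /drift; ring.
rewrite (_ : _ - _ = (En n - En 0) + ((lin_energy n - En n)
   - (lin_energy 0 - En 0))); last by ring.
apply: le_trans (ler_normD _ _) _; rewrite lerD //.
apply: le_trans (ler_normB _ _) _; have := close n; have := close 0%N; lra.
Qed.

End Energy.

(** * Choice of the order *)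

Section Asymptotics.
(* The order [N] is the integer part of the large parameter [y], and the square
   root [s] of the step is [y ^- (2 * p)]: the powers of [y] in the constants are
   then dominated by those of [s]. *)
Variables (R : realType) (r N : nat) (B A y : R).
Hypotheses (B0 : 0 <= B) (A1 : 1 <= A).
Local Notation p := r.+1.
Local Notation K := N.+1.
Local Notation c1 := (dham_const r B).
Local Notation G := (tensor_const K A).

Definition rate_const : R := 4 + c1 * (3 * A) ^+ r.

Hypothesis y4 : 4 <= y.
Hypothesis yD : 2 * rate_const * expR 2 <= y.
Hypotheses (Ny : N%:R <= y) (yN : y < N.+1%:R).

Variables (s h : R).
Hypotheses (sE : s = (y ^+ (2 * p))^-1) (hE : h = s ^+ 2).
Local Notation sg := (rate r B h A (2 * s) K).

Let y0 : 0 < y. Proof. by apply: lt_le_trans y4. Qed.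
Let y1 : 1 <= y. Proof. by apply: le_trans y4; rewrite ler1n. Qed.
Let s0 : 0 < s. Proof. by rewrite sE invr_gt0 exprn_gt0. Qed.
Let h0 : 0 <= h. Proof. by rewrite hE sqr_ge0. Qed.
Let A0 : 0 <= A. Proof. exact: le_trans ler01 A1. Qed.
Let c10 : 0 <= c1. Proof. exact: dham_const_ge0. Qed.
Let D0 : 0 <= rate_const.
Proof. by rewrite addr_ge0 // mulr_ge0 // exprn_ge0 // mulr_ge0. Qed.

Lemma pow_step k : (k <= 2 * p)%N -> y ^+ k * s <= 1.
Proof.
move=> kp; rewrite sE ler_pdivrMr ?exprn_gt0 // mul1r.
by rewrite ler_weXn2l.
Qed.

Lemma tensor_const_le : 0 <= G <= 3 * A * y.
Proof.
rewrite /tensor_const mulr_ge0 //= [3 * A * y]mulrAC ler_wpM2r //.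
rewrite -(natr1 K) -(natr1 N) (_ : 3 * y = y + y + y); last by ring.
by rewrite !lerD.
Qed.

Lemma tensor_const_pow k : G ^+ k <= (3 * A) ^+ k * y ^+ k.
Proof.
have /andP[g0 g1] := tensor_const_le.
by rewrite -exprMn lerXn2r ?nnegrE // (le_trans g0).
Qed.

Let K3 k : 0 <= (3 * A) ^+ k. Proof. by rewrite exprn_ge0 // mulr_ge0. Qed.

Lemma rate_small : 0 <= sg <= rate_const * s.
Proof.
rewrite rate_ge0 //=; last by rewrite mulr_ge0 // ltW.
rewrite /rate /rate_const [X in _ <= X]mulrDl; apply: lerD.
  by rewrite mulrA -natrM.
apply: le_trans (_ : h * (c1 * ((3 * A) ^+ r * y ^+ r)) <= _).
  by rewrite ler_wpM2l // ler_wpM2l // tensor_const_pow.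
rewrite (_ : h * _ = c1 * (3 * A) ^+ r * s * (y ^+ r * s)); last first.
  by rewrite hE; ring.
rewrite ler_piMr ?mulr_ge0 ?(ltW s0) // pow_step //.
exact: leq_trans (leqnSn r) (leq_pmull _ _).
Qed.

Lemma rate_exp : K%:R * sg <= expR (- 2).
Proof.
have /andP[g0 g1] := rate_small.
have K2 : K%:R <= 2 * y 
    by rewrite -(natr1 N) mulr_natl mulr2n lerD.
apply: le_trans (_ : (2 * y) * (rate_const * s) <= _).
  by apply: ler_pM.
have ys : y * s <= y^-1.
  rewrite -[y^-1]mul1r ler_pdivlMr // mulrAC -expr2 pow_step //.
  exact: leq_pmulr.
apply: le_trans (_ : 2 * rate_const * y^-1 <= _).
  rewrite (_ : 2 * y * _ = 2 * rate_const * (y * s)); last by ring.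
  by rewrite ler_wpM2l // mulr_ge0.
by rewrite ler_pdivrMr // expRN -ler_pdivrMl ?invr_gt0 ?expR_gt0 // invrK mulrC.
Qed.

Lemma rate_half : K%:R * sg <= 2^-1.
Proof.
apply: le_trans rate_exp _; rewrite expRN lef_pV2 ?posrE ?expR_gt0 //.
apply: le_trans (expR_ge1Dx 2); lra.
Qed.

Lemma fact_le_pow k : (k`! <= k ^ k)%N.
Proof.
elim: k => // k IH; rewrite factS expnS leq_mul // (leq_trans IH) //.
by case: k {IH} => // k; rewrite leq_exp2r.
Qed.

Lemma fact_rate : (N.+1)`!%:R * sg ^+ N.+1 <= expR (- (2 * y)).
Proof.
have /andP[g0 _] := rate_small.
apply: le_trans (_ : (K%:R * sg) ^+ K <= _).
  rewrite exprMn ler_wpM2r ?exprn_ge0 // -natrX ler_nat; exact: fact_le_pow.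
apply: le_trans (_ : expR (- 2) ^+ K <= _).
  by rewrite lerXn2r ?nnegrE ?expR_ge0 ?mulr_ge0 ?rate_exp.
rewrite -expRM_natl ler_expR mulrN lerN2 [2 * y]mulrC ler_wpM2r //.
exact: ltW.
Qed.

(** The exponential smallness of the defect beats any power of the step. *)
Lemma exp_beats_pow k : y ^+ k * expR (- y) <= k.+1`!%:R.
Proof.
rewrite expRN ler_pdivrMr ?expR_gt0 //.
have := expR_ge1Dxn k (ltW y0) => H.
apply: le_trans (_ : y ^+ k.+1 <= _).
  by rewrite exprS ler_peMl // exprn_ge0 // ltW.
have f0 : 0 < (k.+1)`!%:R :> R by rewrite ltr0n fact_gt0.
rewrite -ler_pdivrMl //; rewrite mulrC; lra.
Qed.

Definition defect_const : R :=
  (A + 1) * (c1 * (3 * A) ^+ r) * (5 * p).+1`!%:R.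

Lemma defect_small n : n%:R * h <= expR y ->
  n%:R * (defect r B h A (2 * s) N * h) <= defect_const * h.
Proof.
move=> nh; rewrite /defect.
have /andP[g0 _] := rate_small.
have F0 : 0 <= (N.+1)`!%:R * sg ^+ N.+1 by rewrite mulr_ge0 // exprn_ge0.
rewrite (_ : n%:R * _ = (A + 1) * (c1 * G ^+ r)
   * ((n%:R * h) * ((N.+1)`!%:R * sg ^+ N.+1))); last by ring.
apply: le_trans (_ : (A + 1) * (c1 * ((3 * A) ^+ r * y ^+ r))
   * (expR y * expR (- (2 * y))) <= _).
  apply: ler_pM.
  - by have /andP[q _] := tensor_const_le; rewrite !mulr_ge0 ?addr_ge0 ?exprn_ge0.
  - by rewrite mulr_ge0 // mulr_ge0.
  - by rewrite ler_wpM2l ?addr_ge0 // ler_wpM2l // tensor_const_pow.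
  - by apply: ler_pM => //; [exact: mulr_ge0|exact: fact_rate].
rewrite -expRD (_ : y - 2 * y = - y); last by ring.
have hy : h * y ^+ (4 * p) = 1.
  rewrite hE sE exprVn -exprM (_ : (2 * p * 2 = 4 * p)%N); last by rewrite mulnAC.
  by rewrite mulVf // expf_neq0 // gt_eqF.
have e : y ^+ r * expR (- y) <= (5 * p).+1`!%:R * h.
  apply: le_trans (_ : y ^+ p * expR (- y) <= _).
    by rewrite ler_wpM2r ?expR_ge0 // ler_weXn2l.
  rewrite -[X in X <= _]mulr1 -{1}hy.
  rewrite (_ : _ * _ = y ^+ (5 * p) * expR (- y) * h).
    by rewrite ler_wpM2r // exp_beats_pow.
  by rewrite (mulSn 4) exprD; ring.
rewrite /defect_const (_ : (A + 1) * _ * expR _ =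
  (A + 1) * (c1 * (3 * A) ^+ r) * (y ^+ r * expR (- y))); last by ring.
rewrite -[X in _ <= X]mulrA ler_wpM2l //.
by rewrite mulr_ge0 ?addr_ge0 // mulr_ge0.
Qed.

Definition drift_const : R := (A + 1) * (c1 * A ^+ r)
  + 2 * (c1 * (2 * (3 * A) ^+ p) * rate_const) + A * (c1 * A ^+ r)
  + 2 * A ^+ 2 * rate_const ^+ 2.

Lemma drift_small : drift r B h A (2 * s) N <= drift_const * h.
Proof.
have /andP[g0 g1] := rate_small.
have G1 := tensor_const_ge1 K A1; have G0 := le_trans ler01 G1.
rewrite /drift /drift_const [X in _ <= X]mulrDl; apply: lerD.
  rewrite ler_wpM2r // lerD2r lerD2l ler_wpM2l //.
  apply: le_trans (_ : (2 * G) * (c1 * G ^+ r) * sg <= _).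
    by rewrite ler_wpM2r // ler_wpM2r ?mulr_ge0 ?exprn_ge0 //; lra.
  rewrite (_ : _ * sg = 2 * c1 * (G ^+ p * sg)); last by rewrite exprS; ring.
  rewrite (_ : c1 * _ * rate_const = 2 * c1 * ((3 * A) ^+ p * rate_const));
    last by ring.
  rewrite ler_wpM2l ?mulr_ge0 //.
  apply: le_trans (_ : ((3 * A) ^+ p * y ^+ p) * (rate_const * s) <= _).
    by apply: ler_pM; rewrite ?exprn_ge0 ?tensor_const_pow.
  rewrite (_ : _ * (rate_const * s) = (3 * A) ^+ p * rate_const * (y ^+ p * s));
    last by ring.
  by rewrite ler_piMr ?mulr_ge0 // pow_step // leq_pmull.
rewrite -[X in _ <= X]mulrA ler_wpM2l ?mulr_ge0 ?sqr_ge0 //.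
rewrite [X in _ <= _ * X]hE -exprMn; apply: lerXn2r => //; rewrite nnegrE //.
exact: le_trans g0 g1.
Qed.

End Asymptotics.

(** * Frequencies of the linear flow *)

Section Frequencies.
Variable R : realType.
Implicit Types s h w x b : R.

Lemma alpha_stepE s w : 0 < s -> alpha_step (s ^+ 2) (s ^+ 2 * w) = s * atan (s * w).
Proof.
move=> s0; rewrite /alpha_step sqrtr_sqr gtr0_norm //; congr (_ * atan _).
by field; rewrite gt_eqF.
Qed.

(** The arctangent saturates where [s * x] is of order one: below, the step
    frequency is comparable with [h * x], and above with [s]. *)
Lemma step_freq_ge s w x b : 0 < s -> 1 <= b -> 0 <= x -> x <= b * w ->
  Num.min (s ^+ 2 * x) s <= 2 * b * (s * atan (s * w)).
Proof.
move=> s0 b1 x0 xw.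
have b0 : 0 < b by apply: lt_le_trans b1.
have key t : 0 <= t <= 1 -> t <= s * x -> s * t <= 2 * b * (s * atan (s * w)).
  move=> /andP[t0 t1] tx.
  have tb : 0 <= t / b <= 1.
    by rewrite divr_ge0 ?(ltW b0) //= ler_pdivrMr // mul1r (le_trans t1).
  have h1 := atan_ge_half tb.
  have h2 : atan (t / b) <= atan (s * w).
    rewrite le_atan // ler_pdivrMr //; apply: le_trans tx _.
    by rewrite -mulrA ler_wpM2l ?(ltW s0) // mulrC.
  have -> : s * t = 2 * b * (s * (t / b / 2)) by field; rewrite gt_eqF.
  rewrite ler_wpM2l ?mulr_ge0 ?(ltW b0) // ler_wpM2l ?(ltW s0) //.
  exact: le_trans h1 h2.
have [sx|/ltW sx] := leP (s * x) 1.
  rewrite ge_min expr2 -mulrA key //.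
  by rewrite mulr_ge0 ?(ltW s0).
have := key 1; rewrite mulr1 ler01 lexx ge_min => -> //.
by rewrite orbT.
Qed.

Lemma step_freq_le s w : 0 < s -> 0 <= w ->
  0 <= s * atan (s * w) <= Num.min (2 * s) (s ^+ 2 * w).
Proof.
move=> s0 w0; have sw : 0 <= s * w by rewrite mulr_ge0 // ltW.
rewrite mulr_ge0 ?atan_ge0 ?(ltW s0) //= le_min [2 * s]mulrC.
rewrite ler_wpM2l ?(ltW s0) ?atan_le2 //= expr2 -mulrA ler_wpM2l ?(ltW s0) //.
exact: atan_le_id.
Qed.

End Frequencies.

Section LinearEnergy.
Variables (R : realType) (L : lattice) (d : nat).
Local Notation C := R[i].
Local Notation mode := (mode L d).
Variables (lam : site L d -> R) (z : mode -> C) (c : R).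
Hypothesis lam0 : forall x, 0 <= sin (lam x).
Hypothesis zc : sumle z c.
Hypothesis zreal : cbar z = z.

(** On a real phase, [E] is the sum of [sin lambda_a * |xi_a|^2], and each site
    appears twice in a sum over the modes. *)
Lemma lin_energy_bounds :
  let E := complex.Re (bform z (fun j => (cis (lphase lam j) - 1) * z j)) in
  (forall s : seq mode, uniq s ->
    \sum_(j <- s) sin (lam j.1) * modulus (z j) ^+ 2 <= 2 * E) /\
  (forall e, (forall s : seq mode, uniq s ->
    \sum_(j <- s) sin (lam j.1) * modulus (z j) ^+ 2 <= e) -> E <= e).
Proof.
set w := fun j => _; move=> E.
have wc : sumle w (2 * c).
  apply: sumleM zc => // j; apply: le_trans (modulusB _ _) _.
  by rewrite modulus_cis modulus1.
pose f j := 'i%C * bterm z w j.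
have fc : sumle f (modulus ('i%C : C) * (c * (2 * c))).
  by apply: sumleZ; apply: bterm_sumle.
have EE : E = complex.Re (csum f).
  by rewrite /E /bform -(csumZ _ (bterm_sumle zc wc)).
have fE j : complex.Re (f j) =
    if j.2 then sin (lam j.1) * modulus (z j) ^+ 2 else 0.
  rewrite /f /bterm; case: ifP => j2; last by rewrite mulr0.
  have -> : z (bar j) = ((z j)^*)%C by rewrite -{2}zreal /cbar conjcK.
  rewrite /w /lphase j2; case: (z j) => p q.
  rewrite /modulus /Normc.normc sqr_sqrtr ?addr_ge0 ?sqr_ge0 //.
  by rewrite /cis cosN sinN /=; ring.
have f0 j : 0 <= complex.Re (f j).
  by rewrite fE; case: ifP => _ //; exact: mulr_ge0 (lam0 _) (sqr_ge0 _).
have zb j : modulus (z (bar j)) = modulus (z j).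
  by rewrite -{1}zreal /cbar barK modulus_conj.
split => [s us|e He].
- have h1 := csum_Re_ge fc f0 us.
  have h2 := csum_Re_ge fc f0 (_ : uniq (map bar s)).
  rewrite (map_inj_uniq (inv_inj (@barK L d))) in h2; have {}h2 := h2 us.
  rewrite EE mulr2n mulrDl mul1r; apply: le_trans (lerD h1 h2).
  rewrite big_map -big_split /= le_eqVlt; apply/orP; left; apply/eqP.
  apply: eq_bigr => j _; rewrite !fE zb.
  by case: j => x [] /=; rewrite ?addr0 ?add0r.
- rewrite EE; apply: (csum_Re_le fc) => s us; apply: le_trans (He s us).
  apply: ler_sum => j _; rewrite fE; case: ifP => _ //.
  exact: mulr_ge0 (lam0 _) (sqr_ge0 _).
Qed.

End LinearEnergy.

(** * The energy bound *)

Section StepSize.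
Variable R : realType.

(** The step size in terms of the large parameter [y = h^-beta]. *)
Lemma step_param (h : R) (p : nat) : (0 < p)%N -> 0 < h ->
  let y := h `^ (- (4 * p)%:R^-1) in
  h = (y ^+ (2 * p))^-1 ^+ 2.
Proof.
move=> p0 h0 y.
have p0' : (4 * p)%:R != 0 :> R by rewrite pnatr_eq0 muln_eq0 -lt0n p0.
rewrite exprVn -exprM mulnAC (_ : 2 * 2 = 4)%N // /y -powR_mulrn ?powR_ge0 //.
rewrite -powRrM mulNr mulVf // powRN powRr1 ?(ltW h0) // invrK //.
Qed.

Lemma threshold_pow (h m : R) : 0 < h -> 0 < m ->
  (h `^ (- (2 * m)^-1)) `^ m = (Num.sqrt h)^-1.
Proof.
move=> h0 m0; rewrite -powRrM (_ : - (2 * m)^-1 * m = - 2^-1).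
  by rewrite powRN powR12_sqrt // ltW.
by field; rewrite gt_eqF.
Qed.

End StepSize.

Theorem corollary5p3 (R : realType) (d : nat) (L : lattice)
    (omega : site L d -> R) (m b : R) (r0 : nat)
    (P : phase R L d -> R[i]) (z0 : phase R L d) (M : R) :
  (1 <= d)%N -> 0 < m -> (3 <= r0)%N -> poly_hamiltonian r0 P ->
  1 <= b ->
  (forall a : site L d,
     b^-1 * site_norm R a `^ m <= omega a <= b * site_norm R a `^ m) ->
  real_phase z0 -> in_Hs (m / 2) z0 ->
  exists C alpha beta c h0 : R,
    [/\ 0 < C, 0 < alpha, 0 < beta, 0 < c & 0 < h0] /\
    forall h : R, 0 < h <= h0 ->
    forall z : nat -> phase R L d,
      z 0%N = z0 ->
      (forall n, ham_flow P h
         (linear_flow (fun a => alpha_step h (h * omega a)) (z n)) (z n.+1)) ->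
      (forall n, (l1norm (z n) <= M%:E)%E) ->
      forall n : nat, n%:R * h <= expR (c * h `^ (- beta)) ->
        ((\esum_(j in [set j | (mode_norm R j < alpha * h `^ (- (2 * m)^-1))%R])
             (mode_norm R j `^ m * modulus (z n j) ^+ 2)%:E)
         + ((Num.sqrt h)^-1)%:E *
           (\esum_(j in [set j | (alpha * h `^ (- (2 * m)^-1) <= mode_norm R j)%R])
             (modulus (z n j) ^+ 2)%:E)
         <= C%:E)%E.
Proof.
move=> d1 m0 r3 [PR [a [[B' aB'] aC PE]]] b1 wb z0r z0H.
pose B := `|B'|.
have B0 : 0 <= B by rewrite normr_ge0.
have aB js : (2 <= size js <= r0)%N -> momentum js = 0 -> modulus (a js) <= B.
  by move=> h1 h2; apply: le_trans (aB' js h1 h2) (ler_norm _).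
pose mm := `|M| + 1.
have mm1 : 1 <= mm by rewrite lerDr.
(* Twice the bound on the orbit, so as to bound the trajectories between its
   points. *)
pose A := 2 * mm; have A1 : 1 <= A by rewrite /A; lra.
have A0 : 0 <= A := le_trans ler01 A1.
pose c1 := dham_const r0 B; have c10 : 0 <= c1 by apply: dham_const_ge0.
pose k1 := 2 * rate_const r0 B A * expR 2.
pose k2 := 2 * (c1 * A ^+ r0); pose k3 := 2 * (c1 * (r0%:R * A ^+ r0)).
have k10 : 0 <= k1.
  rewrite !mulr_ge0 ?expR_ge0 // /rate_const addr_ge0 // mulr_ge0 //.
  by rewrite exprn_ge0 // mulr_ge0.
have k20 : 0 <= k2 by rewrite !mulr_ge0 ?exprn_ge0.
have k30 : 0 <= k3 by rewrite !mulr_ge0 ?exprn_ge0.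
pose Y := 4 + k1 + k2 + k3.
have Y0 : 0 < Y by rewrite /Y; lra.
pose p := r0.+1.
have b0 : 0 < b by apply: lt_le_trans b1.
pose H0 := fine (Hsnorm2 (m / 2) z0).
have H0E (t : seq (mode L d)) : uniq t ->
    \sum_(j <- t) mode_norm R j `^ m * modulus (z0 j) ^+ 2 <= H0.
  move=> ut; have t0 (j : mode L d) :
      0 <= mode_norm R j `^ (2 * (m / 2)) * modulus (z0 j) ^+ 2.
    by rewrite mulr_ge0 ?powR_ge0 ?sqr_ge0.
  have : (Hsnorm2 (m / 2) z0 <= H0%:E)%E.
    rewrite fineK // ge0_fin_numE //; apply: esum_ge0 => j _.
    by rewrite lee_fin.
  rewrite /Hsnorm2 => /(esum_le_iff _ _ t0) /(_ t ut (fun _ _ => I)).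
  by rewrite mulrC divfK.
have H00 : 0 <= H0 by have := H0E [::] isT; rewrite big_nil.
have dc0 : 0 <= defect_const r0 B A.
  rewrite /defect_const mulr_ge0 // mulr_ge0 ?addr_ge0 // mulr_ge0 //.
  by rewrite exprn_ge0 // mulr_ge0.
pose C3 := b * H0 + defect_const r0 B A + 2 * `|drift_const r0 B A|.
have bH0 : 0 <= b * H0 by rewrite mulr_ge0 // ltW.
have C30 : 0 <= C3.
  apply: addr_ge0; first exact: addr_ge0 bH0 dc0.
  exact: mulr_ge0.
(* The threshold with [alpha = 1] is where [sqrt h * |j|^m = 1], the place at
   which the arctangent saturates.  With this [beta] the parameter
   [y = h ^ (- beta)] satisfies [sqrt h = y ^- (2 * p)], and the last witness
   makes [y] at least [Y], which collects all smallness conditions. *)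
exists (16 * b * C3 + 1), 1, (4 * p)%:R^-1, 1, (Y ^+ (4 * p))^-1.
split.
  split => //; rewrite ?invr_gt0 ?exprn_gt0 ?ltr0n ?muln_gt0 //.
  by rewrite ltr_wpDl // !mulr_ge0 // ltW.
move=> h /andP[h0 hY] z z0E zflow zM n nh.
rewrite mul1r in nh; rewrite mul1r.
pose y := h `^ (- (4 * p)%:R^-1).
have y0 : 0 < y by rewrite powR_gt0.
have hE : h = (y ^+ (2 * p))^-1 ^+ 2 by apply: step_param.
have hy : y ^+ (4 * p) = h^-1.
  by rewrite hE exprVn invrK -exprM mulnAC.
have Yy : Y <= y.
  rewrite leNgt; apply/negP => yY.
  have : y ^+ (4 * p) < Y ^+ (4 * p).
    by rewrite ltrXn2r ?nnegrE ?(ltW y0) ?(ltW Y0) // muln_eq0.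
  rewrite hy; apply/negP; rewrite -leNgt.
  by rewrite -[Y ^+ _]invrK lef_pV2 ?posrE ?invr_gt0 ?exprn_gt0.
have y4 : 4 <= y by move: Yy; rewrite /Y; lra.
have yk1 : k1 <= y by move: Yy; rewrite /Y; lra.
have yk2 : k2 <= y by move: Yy; rewrite /Y; lra.
have yk3 : k3 <= y by move: Yy; rewrite /Y; lra.
have y1 : 1 <= y by lra.
have [s [s0 sE hs]] : exists s : R, [/\ 0 < s, s = (y ^+ (2 * p))^-1 & h = s ^+ 2].
  exists (y ^+ (2 * p))^-1; split => //.
  by rewrite invr_gt0 exprn_gt0.
have sy : s * y <= 1.
  rewrite sE mulrC ler_pdivrMr ?exprn_gt0 // mul1r.
  by rewrite -[X in X <= _]expr1 ler_weXn2l // muln_gt0.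
have s4 : s <= 4^-1.
  by rewrite -[4^-1]mul1r ler_pdivlMr //; apply: le_trans sy; rewrite ler_wpM2l // ltW.
have hsy : h * y <= 1.
  rewrite hs expr2 -mulrA; apply: le_trans (_ : s * 1 <= _).
    by rewrite ler_wpM2l // ltW.
  by rewrite mulr1; lra.
have sqh : Num.sqrt h = s by rewrite hs sqrtr_sqr gtr0_norm.
pose lam (x : site L d) := alpha_step h (h * omega x).
have w0 x : 0 <= omega x.
  have /andP[+ _] := wb x; apply: le_trans.
  by rewrite mulr_ge0 ?powR_ge0 // invr_ge0 ltW.
have lamE x : lam x = s * atan (s * omega x) by rewrite /lam hs alpha_stepE.
have lam_le x := step_freq_le s0 (w0 x).
have lam0 x : 0 <= lam x by rewrite lamE; case/andP: (lam_le x).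
have lam2s x : lam x <= 2 * s.
  by rewrite lamE; case/andP: (lam_le x) => _; rewrite le_min => /andP[].
have lamh x : lam x <= h * omega x.
  by rewrite lamE; case/andP: (lam_le x) => _; rewrite le_min hs => /andP[].
have sin_half x : lam x <= 2 * sin (lam x).
  have : lam x / 2 <= sin (lam x).
    by apply: sin_ge_half; rewrite lam0 /=; have := lam2s x; lra.
  lra.
have sin0 x : 0 <= sin (lam x) by have := sin_half x; have := lam0 x; lra.
have zmm k : sumle (z k) mm.
  move: (zM k) => /l1norm_le; apply: sumle_weak.
  by rewrite /mm; have := ler_norm M; lra.
have [v Hv] := choice (fun k => ham_flow_derI (zflow k)).
have v0E k : v k 0 = linear_flow lam (z k) by case: (Hv k).
have vhE k : v k h = z k.+1 by case: (Hv k).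
have h0' : 0 <= h := ltW h0.
have vder k : derI h (v k) (fun t => hfield r0 a (tpow (v k t))).
  have [_ _ vl1 vd] := Hv k; apply: derI_eq vd => // t th j.
  have /in_l1P[c vc] := vl1 t th.
  by rewrite (vector_field_ham B0 aB PE vc).
have vA k t : 0 <= t <= h -> sumle (v k t) A.
  apply: (flow_bounded B0 aB h0' mm1 _ _ (vder k)).
  - by rewrite v0E; apply: linear_flow_sumle.
  - by move=> t' th; apply/in_l1P; case: (Hv k) => _ _ + _; apply.
  - rewrite -/A -/c1; have : h * k2 <= 1.
      by apply: le_trans hsy; rewrite ler_wpM2l.
    rewrite /k2; lra.
have glue k : v k.+1 0 = linear_flow lam (v k h) by rewrite v0E vhE.
have zreal k : cbar (z k) = z k.
  elim: k => [|k IH].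
    by rewrite z0E; apply/funext => j; rewrite /cbar z0r conjcK.
  rewrite -vhE; apply: (flow_real B0 aB aC h0' A1 _ (vA k) (vder k)).
  - by rewrite v0E; apply: real_linear_flow.
  - rewrite -/c1; have : h * k3 <= 1.
      by apply: le_trans hsy; rewrite ler_wpM2l.
    rewrite /k3; lra.
  - by rewrite h0' lexx.
pose N := Num.truncn y.
have /andP[Ny yN] : N%:R <= y < N.+1%:R by apply: truncn_itv; apply: ltW.
have N0 : (0 < N)%N.
  rewrite lt0n; apply: contraTneq yN => ->; rewrite -leNgt; exact: y1.
have s20 : 0 <= 2 * s by rewrite mulr_ge0 // ltW.
have lame x : `|lam x| <= 2 * s by rewrite ger0_norm.
have Ksg := rate_half B0 A1 y4 yk1 Ny sE hs.
have drf := energy_drift B0 aB h0' A1 s20 lame vA vder glue N0 Ksg n.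
have dn := defect_small B0 A1 y4 yk1 Ny yN sE hs nh.
have dd := drift_small B0 A1 y4 Ny sE hs.
have h00 : 0 <= (0 : R) <= h by rewrite lexx.
have mod_v k j : modulus (v k 0 j) = modulus (z k j).
  by rewrite v0E linear_flowE modulusM modulus_cis mul1r.
have vreal k : cbar (v k 0) = v k 0 by rewrite v0E; apply: real_linear_flow.
have LB k := lin_energy_bounds sin0 (vA k 0 h00) (vreal k).
have E0 : lin_energy lam v 0 <= h * (b * H0).
  apply: (LB 0%N).2 => t ut.
  apply: le_trans (_ : \sum_(j <- t) h * b *
     (mode_norm R j `^ m * modulus (z0 j) ^+ 2) <= _).
    apply: ler_sum => j _; rewrite mod_v z0E mulrA ler_wpM2r ?sqr_ge0 //.
    apply: le_trans (sin_le_id (lam0 _)) _; apply: le_trans (lamh _) _.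
    rewrite -mulrA ler_wpM2l //; by case/andP: (wb j.1).
  by rewrite -mulr_sumr -!mulrA ler_wpM2l // ler_wpM2l ?(ltW b0) // H0E.
have En : lin_energy lam v n <= h * C3.
  have : lin_energy lam v n - lin_energy lam v 0 <=
      defect_const r0 B A * h + 2 * (`|drift_const r0 B A| * h).
    apply: le_trans (ler_norm _) _; apply: le_trans drf _; apply: lerD => //.
    rewrite ler_wpM2l //; apply: le_trans dd _.
    by rewrite ler_wpM2r // ler_norm.
  rewrite /C3; move: E0; move: (lin_energy _ _ n) (lin_energy _ _ 0%N).
  move=> e1 e2; lra.
have S (t : seq (mode L d)) : uniq t ->
    \sum_(j <- t) Num.min (h * mode_norm R j `^ m) s * modulus (z n j) ^+ 2
    <= h * (8 * b * C3).
  move=> ut; have h1 := (LB n).1 t ut.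
  apply: le_trans (_ : \sum_(j <- t) 4 * b *
     (sin (lam j.1) * modulus (v n 0 j) ^+ 2) <= _).
    apply: ler_sum => j _; rewrite mod_v mulrA ler_wpM2r ?sqr_ge0 //.
    have xw : site_norm R j.1 `^ m <= b * omega j.1.
      have /andP[+ _] := wb j.1; by rewrite ler_pdivrMl.
    have := step_freq_ge s0 b1 (powR_ge0 _ _) xw.
    rewrite -hs -lamE => q; apply: le_trans q _.
    have := ler_wpM2l (ltW b0) (sin_half j.1); lra.
  rewrite -mulr_sumr; apply: le_trans (_ : 4 * b * (2 * (h * C3)) <= _).
    rewrite ler_wpM2l ?mulr_ge0 ?(ltW b0) //; apply: le_trans h1 _.
    by rewrite ler_wpM2l.
  by rewrite le_eqVlt; apply/orP; left; apply/eqP; ring.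
set T := h `^ _.
have T0 : 0 < T by rewrite powR_gt0.
have Tm : T `^ m = s^-1 by rewrite /T threshold_pow // sqh.
have mono x x' : 0 <= x -> x <= x' -> x `^ m <= x' `^ m.
  by move=> x0 xx; apply: ge0_ler_powR; rewrite ?nnegrE ?(ltW m0) // (le_trans x0).
have first : (\esum_(j in [set j | (mode_norm R j < T)%R])
     (mode_norm R j `^ m * modulus (z n j) ^+ 2)%:E <= (8 * b * C3)%:E)%E.
  apply/esum_le_iff => [j|t ut tT].
    by rewrite mulr_ge0 ?powR_ge0 ?sqr_ge0.
  rewrite -(ler_pM2l h0); apply: le_trans (S t ut); rewrite mulr_sumr big_seq [X in _ <= X]big_seq.
  apply: ler_sum => j /tT /= jT; rewrite mulrA ler_wpM2r ?sqr_ge0 //.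
  rewrite le_min lexx /= hs expr2 -mulrA -[X in _ <= X]mulr1 ler_wpM2l ?(ltW s0) //.
  rewrite -ler_pdivlMl // mulr1 -Tm; apply: mono; first exact: sqrtr_ge0.
  exact: ltW.
have second : (\esum_(j in [set j | (T <= mode_norm R j)%R])
     (modulus (z n j) ^+ 2)%:E <= (8 * b * C3 * s)%:E)%E.
  apply/esum_le_iff => [j|t ut tT]; first exact: sqr_ge0.
  rewrite -(ler_pM2l s0); apply: le_trans (_ : h * (8 * b * C3) <= _); last first.
    by rewrite hs le_eqVlt; apply/orP; left; apply/eqP; ring.
  apply: le_trans (S t ut); rewrite mulr_sumr big_seq [X in _ <= X]big_seq.
  apply: ler_sum => j /tT /= jT; rewrite ler_wpM2r ?sqr_ge0 //.
  rewrite le_min lexx andbT hs expr2 -mulrA -[X in X <= _]mulr1 ler_wpM2l ?(ltW s0) //.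
  by rewrite -ler_pdivrMl // mulr1 -Tm; apply: mono; first exact: ltW.
rewrite sqh; apply: le_trans (leeD first (lee_wpmul2l _ second)) _.
  by rewrite lee_fin invr_ge0 ltW.
rewrite -EFinM -EFinD lee_fin.
rewrite (_ : s^-1 * _ = 8 * b * C3); last by field; rewrite gt_eqF.
lra.
Qed.
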